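(* Let $u(\cdot)=U(|\cdot|)$ be a radial function on $\mathbb{R}^N$ and $v(\cdot)=V(|\cdot|)$ a radial function on $\mathbb{R}^{N+2}$ such that $\mathcal{F}_N(u)$ and $\mathcal{F}_{N+2}(v)$ are well-defined, $\lim_{r\to0^+}U(r)r^N=0$, $\lim_{r\to\infty}U(r)r^{\frac{N-1}{2}}=0$, and $rV(r)=U'(r)$ for $r>0$. Then $$\mathcal{F}_{N+2}(v)=-2\pi\,\mathcal{F}_N(u),$$ where both sides are regarded as functions of the radial variable $r=|\xi|$. As a consequence, for every $\alpha\ge0$, whenever the quantities are defined, $$\int_{\mathbb{R}^N}|\Delta^{\alpha+\frac12}u|^2\,dx=\frac{|\mathbb{S}^{N-1}|}{|\mathbb{S}^{N+1}|}\int_{\mathbb{R}^{N+2}}|\Delta^{\alpha}v|^2\,dx .$$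
   Context: $\mathcal{F}_k(\phi)(\xi)=\int_{\mathbb{R}^k}\phi(x)e^{-2\pi i x\cdot\xi}\,dx$ is the Fourier transform on $\mathbb{R}^k$. The Fourier transform of a radial function is radial and is identified with a function of $r=|\xi|>0$, so functions on $\mathbb{R}^N$ and on $\mathbb{R}^{N+2}$ can be compared. $|\mathbb{S}^{k-1}|$ is the surface measure of the unit sphere in $\mathbb{R}^k$. Powers of the Laplacian of real order $\beta\ge0$ are understood via the Fourier transform: $\int_{\mathbb{R}^k}|\Delta^\beta \phi|^2dx=(2\pi)^{4\beta}\int_{\mathbb{R}^k}|\xi|^{4\beta}|\mathcal{F}_k(\phi)(\xi)|^2d\xi$. *)

(* Defs.v *)
From HB Require Import structures.
From mathcomp Require Import all_boot all_order all_algebra.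
From mathcomp Require Import all_classical all_reals all_analysis.
From mathcomp Require Import measurable_realfun.
From mathcomp Require Export complex.
Set Implicit Arguments.
Unset Strict Implicit.
Unset Printing Implicit Defensive.
Import Order.TTheory GRing.Theory Num.Theory.
Import numFieldNormedType.Exports.
Import ComplexField.Normc.
Local Open Scope classical_set_scope.
Local Open Scope ring_scope.
Local Open Scope complex_scope.

Local Notation Re := complex.Re.
Local Notation Im := complex.Im.

(* R^n, with the sigma-algebra generated by the coordinates. [measurableTypeR R]
   is R with its Borel sigma-algebra. *)
Notation Rn R n := (n.-tuple (measurableTypeR R)).

Section lebesgue_Rn.
Variable R : realType.

Definition Rn_cons n (p : measurableTypeR R * Rn R n) : Rn R n.+1 :=
  [tuple of p.1 :: p.2].

Lemma measurable_Rn_cons n : measurable_fun setT (@Rn_cons n).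
Proof. exact: measurable_cons. Qed.

Definition Rn_uncons n (x : Rn R n.+1) : measurableTypeR R * Rn R n :=
  (thead x, [tuple of behead x]).

Lemma Rn_consK n : cancel (@Rn_cons n) (@Rn_uncons n).
Proof. by case=> a x; rewrite /Rn_uncons theadE; congr pair; exact: val_inj. Qed.

Lemma measurable_Rn_uncons n : measurable_fun setT (@Rn_uncons n).
Proof.
apply/measurable_fun_pair; last exact: measurable_behead.
exact: measurable_tnth.
Qed.

(* The library's sigma-finite instance on [m1 \x m2] is hidden by its instance
   for products of subprobabilities. *)
Lemma sigma_finite_product d1 d2 (T1 : measurableType d1)
    (T2 : measurableType d2) (m1 : {sigma_finite_measure set T1 -> \bar R})
    (m2 : {sigma_finite_measure set T2 -> \bar R}) :
  sigma_finite setT (m1 \x m2)%E.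
Proof.
have /sigma_finiteP[F [TF ndF Foo]] := sigma_finiteT m1.
have /sigma_finiteP[G [TG ndG Goo]] := sigma_finiteT m2.
exists (fun n => F n `*` G n).
  rewrite -setXTT TF TG predeqE => -[x y]; split.
    move=> [/= [n _ Fnx] [k _ Gky]]; exists (maxn n k) => //; split.
    - by move: x Fnx; exact/subsetPset/ndF/leq_maxl.
    - by move: y Gky; exact/subsetPset/ndG/leq_maxr.
  by move=> [n _ []/= ? ?]; split; exists n.
move=> k; have [? ?] := Foo k; have [? ?] := Goo k.
split; first exact: measurableX.
by rewrite product_measure1E// lte_mul_pinfty// ge0_fin_numE.
Qed.

Section step.
Variables (n : nat)
  (mu : {sigma_finite_measure set (Rn R n) -> \bar R}).

Definition lebesgue_step : set (Rn R n.+1) -> \bar R :=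
  pushforward (@lebesgue_measure R \x mu)%E (@Rn_cons n).

Let step0 : lebesgue_step set0 = 0%E.
Proof. by rewrite /lebesgue_step /pushforward preimage_set0 measure0. Qed.

Let step_ge0 A : (0 <= lebesgue_step A)%E.
Proof. by rewrite /lebesgue_step /pushforward; exact: measure_ge0. Qed.

Let step_sigma_additive : semi_sigma_additive lebesgue_step.
Proof.
have mpre F : measurable F -> measurable (@Rn_cons n @^-1` F).
  by move=> mF; rewrite -[X in measurable X]setTI; exact: measurable_Rn_cons.
move=> F mF tF mUF; rewrite /lebesgue_step /pushforward preimage_bigcup.
apply: measure_semi_sigma_additive; first by move=> i; exact: mpre.
- apply/trivIsetP => /= i j _ _ ij; rewrite -preimage_setI.
  by move/trivIsetP : tF => /(_ _ _ _ _ ij) ->//; rewrite preimage_set0.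
- by rewrite -preimage_bigcup; exact: mpre.
Qed.

HB.instance Definition _ := isMeasure.Build _ _ _ lebesgue_step
  step0 step_ge0 step_sigma_additive.

Lemma lebesgue_step_sigma_finite : sigma_finite setT lebesgue_step.
Proof.
have [F FT mF] : sigma_finite setT (@lebesgue_measure R \x mu)%E.
  exact: sigma_finite_product.
exists (fun i => @Rn_uncons n @^-1` F i).
  by rewrite -preimage_bigcup -FT preimage_setT.
move=> i; have [mFi Foo] := mF i; split.
  by rewrite -[X in measurable X]setTI; exact: measurable_Rn_uncons.
rewrite /lebesgue_step /pushforward -comp_preimage.
suff -> : @Rn_uncons n \o @Rn_cons n = id by [].
by apply/funext => p /=; rewrite Rn_consK.
Qed.

HB.instance Definition _ := Measure_isSigmaFinite.Build _ _ _ lebesgue_step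
  lebesgue_step_sigma_finite.

End step.

Fixpoint lebesgue_Rn n : {sigma_finite_measure set (Rn R n) -> \bar R} :=
  if n is m.+1 then lebesgue_step (lebesgue_Rn m) else \d_ [tuple].

End lebesgue_Rn.

Section fourier.
Variable R : realType.

Definition dotR k (x y : Rn R k) : R := \sum_(i < k) tnth x i * tnth y i.

Definition enorm k (x : Rn R k) : R := Num.sqrt (dotR x x).

Section complex_integral.
Context d (T : measurableType d) (mu : {measure set T -> \bar R}).

Definition cintegrable (D : set T) (f : T -> R[i]) : Prop :=
  mu.-integrable D (fun x => (Re (f x))%:E) /\
  mu.-integrable D (fun x => (Im (f x))%:E).

Definition cintegral (D : set T) (f : T -> R[i]) : R[i] :=
  (\int[mu]_(x in D) Re (f x)) +i* (\int[mu]_(x in D) Im (f x)).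

End complex_integral.

Definition expi (t : R) : R[i] := cos t +i* sin t.

Definition has_cderiv (f : R -> R[i]) (r : R) (l : R[i]) : Prop :=
  is_derive r 1 (fun s : R => Re (f s)) (Re l) /\
  is_derive r 1 (fun s : R => Im (f s)) (Im l).

Definition annulus k (e M : R) : set (Rn R k) :=
  [set x | e <= enorm x <= M].

Definition fourier_integrand k (phi : Rn R k -> R[i]) (xi x : Rn R k) : R[i] :=
  phi x * expi (- (2 * pi * dotR x xi)).

Definition fourier_trunc k (phi : Rn R k -> R[i]) (xi : Rn R k) (p : R * R) :
    R[i] :=
  cintegral (lebesgue_Rn R k) (annulus p.1 p.2) (fourier_integrand phi xi).

(* The integral over R^k defining the Fourier transform is the limit, as
   e -> 0+ and M -> +oo, of the integrals over e <= |x| <= M. It may converge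
   conditionally; if phi is integrable then, by [fourier_integrable] below, it
   converges to the Lebesgue integral over R^k. *)
Definition fourier_cvg k (phi : Rn R k -> R[i]) (xi : Rn R k) : Prop :=
  [/\ forall e M, 0 < e -> e <= M ->
        cintegrable (lebesgue_Rn R k) (@annulus k e M)
          (fourier_integrand phi xi),
      cvg (Re (fourier_trunc phi xi p) @[p --> (0^'+, +oo)]) &
      cvg (Im (fourier_trunc phi xi p) @[p --> (0^'+, +oo)])].

Definition fourier k (phi : Rn R k -> R[i]) (xi : Rn R k) : R[i] :=
  lim (Re (fourier_trunc phi xi p) @[p --> (0^'+, +oo)]) +i*
  lim (Im (fourier_trunc phi xi p) @[p --> (0^'+, +oo)]).

(* The frequency 0 is left out: transforms of radial functions are functions of
   r = |xi| > 0. *)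
Definition fourier_defined k (phi : Rn R k -> R[i]) : Prop :=
  forall xi : Rn R k, 0 < enorm xi -> fourier_cvg phi xi.

(* The integral of |Delta^beta phi|^2 over R^k. *)
Definition laplacian_energy k (beta : R) (phi : Rn R k -> R[i]) : \bar R :=
  (((2 * pi) `^ (4 * beta))%:E *
   \int[lebesgue_Rn R k]_xi
     (enorm xi `^ (4 * beta) * normc (fourier phi xi) ^+ 2)%:E)%E.

(* The surface measure of E, a subset of the unit sphere of R^k, is k times the
   Lebesgue measure of the cone {t w | 0 < t <= 1, w in E}. *)
Definition surface_measure k (E : set (Rn R k)) : \bar R :=
  let cone := [set x : Rn R k |
    0 < enorm x <= 1 /\ E [tuple tnth x i / enorm x | i < k]] in
  (k%:R%:E * lebesgue_Rn R k cone)%E.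

Definition sphere_area k : R :=
  fine (surface_measure [set x : Rn R k | enorm x = 1]).

Section integrable_case.

Lemma measurable_coordR k (i : 'I_k) :
  measurable_fun [set: Rn R k] (fun x : Rn R k => tnth x i : R).
Proof. exact: measurable_tnth. Qed.

Lemma measurable_dotR k (xi : Rn R k) :
  measurable_fun setT (fun x : Rn R k => dotR x xi).
Proof.
apply: measurable_sum => i; apply: measurable_funM => //.
exact: measurable_coordR.
Qed.

Lemma measurable_enorm k : measurable_fun setT (@enorm k).
Proof.
apply: (measurableT_comp (f := @Num.sqrt R)).
  by apply: continuous_measurable_fun; exact: sqrt_continuous.
by apply: measurable_sum => i; apply: measurable_funM;
  exact: measurable_coordR.
Qed.

Lemma measurable_annulus k e M : measurable (@annulus k e M).
Proof.
rewrite [annulus e M](_ : _ = setT `&` @enorm k @^-1` `[e, M]); last first.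
  by apply/seteqP; split => x; rewrite /annulus /= in_itv/= => // -[].
exact: measurable_enorm.
Qed.

Lemma measurable_enorm0 k : measurable [set x : Rn R k | enorm x = 0].
Proof.
rewrite [X in measurable X](_ : _ = setT `&` @enorm k @^-1` [set 0]).
  exact: measurable_enorm.
by rewrite setTI.
Qed.

Lemma enorm0_tnth k (x : Rn R k) i : enorm x = 0 -> tnth x i = 0.
Proof.
move=> /eqP; rewrite sqrtr_eq0 => x0.
have sq0 j : 0 <= tnth x j * tnth x j :> R by rewrite -expr2 sqr_ge0.
have /eqP : dotR x x = 0 by apply/eqP; rewrite eq_le x0/= sumr_ge0.
rewrite psumr_eq0// => /allP/(_ i); rewrite mem_index_enum => /(_ isT)/=.
by rewrite mulf_eq0 orbb => /eqP.
Qed.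

Lemma lebesgue_Rn_enorm0 k :
  lebesgue_Rn R k.+1 [set x : Rn R k.+1 | enorm x = 0] = 0%E.
Proof.
apply/eqP; rewrite eq_le measure_ge0 andbT /= /lebesgue_step /pushforward.
set mu := (_ \x _)%E.
have m0 : measurable [set (0 : measurableTypeR R)] := measurable_set1 (0 : R).
have : mu ([set (0 : measurableTypeR R)] `*` setT) = 0%E.
  rewrite /mu product_measure1E//.
  rewrite [X in (X * _)%E](_ : _ = 0%E) ?mul0e//.
  exact: lebesgue_measure_set1.
move=> <-; apply: le_measure; rewrite ?inE.
- rewrite -[X in measurable X]setTI.
  exact: (@measurable_Rn_cons R k measurableT _ (@measurable_enorm0 k.+1)).
- exact: measurableX.
- move=> [a x] /= /(@enorm0_tnth _ _ ord0); rewrite (tnth_nth 0)/= => ->.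
  by split.
Qed.

Lemma cvg_annulus k (f : Rn R k.+1 -> R) :
  (lebesgue_Rn R k.+1).-integrable setT (EFin \o f) ->
  (\int[lebesgue_Rn R k.+1]_(x in annulus p.1 p.2) f x)
    @[p --> ((0 : R)^'+, (+oo : set_system R))] -->
  (\int[lebesgue_Rn R k.+1]_x f x).
Proof.
set mu := lebesgue_Rn R k.+1 => intf.
pose A n : set (Rn R k.+1) := annulus n.+1%:R^-1 n.+1%:R.
pose h n := ((fun x => `|f x|%:E) \_ (~` A n)).
pose N := [set x : Rn R k.+1 | enorm x = 0].
have mN : measurable N by exact: measurable_enorm0.
have mA e M : measurable (~` @annulus k.+1 e M).
  by apply: measurableC; exact: measurable_annulus.
have intS D : measurable D -> mu.-integrable D (EFin \o f).
  by move=> mD; exact: integrableS intf.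
have intN D : measurable D -> mu.-integrable D (fun x => `|f x|%:E).
  by move=> mD; exact/integrable_norm/intS.
have inth n : mu.-integrable setT (h n).
  exact: ((integrable_mkcond _ (mA _ _)).1 (intN _ (mA _ _))).
have h0 x : (~` N) x -> h ^~ x @ \oo --> 0%E.
  move=> x0; have {}x0 : 0 < enorm x.
    by rewrite lt_neqAle sqrtr_ge0 andbT eq_sym; exact/eqP.
  apply: cvg_near_cst; near=> n; rewrite /h patchE ifF//.
  apply/negbTE; rewrite notin_setE => nA; apply: nA.
  rewrite /A /annulus /=; apply/andP; split; last first.
    rewrite (@le_trans _ _ n%:R)// ?ler_nat//.
    by near: n; exact: nbhs_infty_ger.
  by apply: ltW; near: n; exact: (near_infty_natSinv_lt (PosNum x0)).
have muN : mu N = 0%E by exact: lebesgue_Rn_enorm0.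
have cvgh : (\int[mu]_x h n x)%E @[n --> \oo] --> 0%E.
  have -> : 0%E = (\int[mu]_(x in ~` N) cst 0 x)%E by rewrite integral0.
  under eq_fun => n do
    rewrite (negligible_integral mN measurableT (inth n) muN) setTD.
  apply: (@dominated_cvg _ _ _ mu _ _ _ _ (fun x => `|f x|%:E)) => //.
  - exact: measurableC.
  - move=> n; apply: measurable_funS (measurable_int _ (inth n)) => //.
  - exact/intN/measurableC.
  - move=> n x _; rewrite /h patchE; case: ifPn => _.
      by rewrite gee0_abs ?lee_fin.
    by rewrite abse0 lee_fin.
apply/cvgrPdist_le => eps eps0.
have [n hn] : exists n, (\int[mu]_x h n x <= eps%:E)%E.
  have /fine_cvgP[_ /cvgrPdist_le/(_ _ eps0)] := cvgh.
  move=> -[n _ /(_ n (leqnn n))]/=; rewrite sub0r normrN => hn; exists n.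
  rewrite -(fineK (integrable_fin_num measurableT (inth n))) lee_fin.
  exact: le_trans (ler_norm _) hn.
exists ([set e | e <= n.+1%:R^-1], [set M | n.+1%:R <= M]) => /=.
  split; first by apply: nbhs_right_ltW; rewrite invr_gt0.
  by apply: nbhs_pinfty_ge; exact: num_real.
move=> [e M] /= [en nM].
have mAeM : measurable (@annulus k.+1 e M) by exact: measurable_annulus.
have AC : [set: Rn R k.+1] = annulus e M `|` ~` annulus e M by rewrite setUv.
rewrite [in X in X - _]AC Rintegral_setU//; last 2 first.
- by rewrite -AC.
- by apply/disj_setPS; rewrite setICr.
rewrite addrAC subrr add0r -lee_fin; apply: le_trans hn.
apply: (@le_trans _ _ (\int[mu]_(x in ~` annulus e M) `|f x|%:E)%E).
  rewrite EFin_normr_Rintegral//; last exact: (intS _ (mA _ _)).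
  apply: le_abse_integral; first exact: mA.
  exact: (measurable_int _ (intS _ (mA _ _))).
rewrite -integral_mkcond; apply: ge0_subset_integral => //.
- exact: mA.
- exact: (measurable_int _ (intN _ (mA _ _))).
- move=> x; apply: contra_not; rewrite /A /annulus /= => /andP[xn nx].
  by rewrite (le_trans en xn) (le_trans nx nM).
Unshelve. all: end_near. Qed.

Lemma fourier_integrand_integrable k (phi : Rn R k -> R[i]) xi :
  cintegrable (lebesgue_Rn R k) setT phi ->
  cintegrable (lebesgue_Rn R k) setT (fourier_integrand phi xi).
Proof.
set mu := lebesgue_Rn R k => -[iRe iIm].
pose t (x : Rn R k) : R := - (2 * pi * dotR x xi).
have mt : measurable_fun setT t.
  by apply: measurable_funN; apply: measurable_funM => //;
    exact: measurable_dotR.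
have icos g : mu.-integrable setT (EFin \o g) ->
    mu.-integrable setT (EFin \o (fun x => g x * cos (t x))).
  move=> ig; apply: (integrableMl (h := fun x => cos (t x)) measurableT ig).
    apply: (measurableT_comp (f := @cos R)) => //.
    by apply: continuous_measurable_fun; exact: continuous_cos.
  exists 1; split=> // M M1 x _ /=; apply: le_trans (ltW M1).
  by rewrite ler_norml cos_geN1 cos_le1.
have isin g : mu.-integrable setT (EFin \o g) ->
    mu.-integrable setT (EFin \o (fun x => g x * sin (t x))).
  move=> ig; apply: (integrableMl (h := fun x => sin (t x)) measurableT ig).
    apply: (measurableT_comp (f := @sin R)) => //.
    by apply: continuous_measurable_fun; exact: continuous_sin.
  exists 1; split=> // M M1 x _ /=; apply: le_trans (ltW M1).
  by rewrite ler_norml sin_geN1 sin_le1.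
split.
- have := integrableB measurableT (icos _ iRe) (isin _ iIm).
  apply: eq_integrable => // x _ /=.
  by rewrite /fourier_integrand -/(t x); case: (phi x).
- have := integrableD measurableT (isin _ iRe) (icos _ iIm).
  apply: eq_integrable => // x _ /=.
  by rewrite /fourier_integrand -/(t x); case: (phi x).
Qed.

Lemma fourier_integrable k (phi : Rn R k.+1 -> R[i]) xi :
  cintegrable (lebesgue_Rn R k.+1) setT phi ->
  fourier_cvg phi xi /\
  fourier phi xi = cintegral (lebesgue_Rn R k.+1) setT (fourier_integrand phi xi).
Proof.
move=> /(@fourier_integrand_integrable _ _ xi)[iRe iIm].
have cRe := cvg_annulus iRe; have cIm := cvg_annulus iIm.
split; last by congr Complex; exact: cvg_lim.
split.
- move=> e M _ _; split.
    by apply: integrableS iRe => //; exact: measurable_annulus.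
  by apply: integrableS iIm => //; exact: measurable_annulus.
- exact: cvgP cRe.
- exact: cvgP cIm.
Qed.

End integrable_case.

End fourier.

(* Main.v *)
(* Write z = (a, b, x) with x in R^N and s = |z|^2. Lebesgue measure of R^(N+2)
   becomes pi dx ds on s >= |x|^2, so integrating the transform of V over an
   annulus in R^(N+2) leaves, at fixed x, the integral of V(sqrt s) ds = 2 dU
   along a ray. Fubini then gives the identity on e <= |x| <= M up to two boundary
   terms, U(M) and U(e) times the Fourier transforms of the balls of radii M and e.
   The one at e is O(|U(e)| e^N). The Fourier transform of a ball is a Bessel
   function whose decay follows from an energy estimate for the Bessel equation;
   this makes the boundary term at M of size O(|U(M)| M^((N-1)/2)). Since V is only
   assumed integrable on annuli, the fundamental theorem of calculus is needed for
   an everywhere differentiable function with integrable, possibly discontinuous,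
   derivative. The equality of energies then compares two radial integrals: the
   measures |xi|^2 dxi on R^N and N / (2 pi) dxi on R^(N+2) have the same image
   under xi |-> |xi|. *)
Require Import Defs.
From HB Require Import structures.
From mathcomp Require Import all_boot all_order all_algebra.
From mathcomp Require Import all_classical all_reals all_analysis.
From mathcomp Require Import measurable_realfun.
From mathcomp Require Import ring lra.
Set Implicit Arguments.
Unset Strict Implicit.
Unset Printing Implicit Defensive.
Import Order.TTheory GRing.Theory Num.Theory.
Import numFieldNormedType.Exports.
Import ComplexField.Normc.
Local Open Scope classical_set_scope.
Local Open Scope ring_scope.
Local Open Scope complex_scope.

(** * Changes of variables *)

Section affine.
Variable R : realType.
Notation mu := (@lebesgue_measure R).
Local Open Scope ereal_scope.

(** All the integrals are of functions of the pair (x . xi, |x|^2), whose joint law is rotation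
    invariant; this takes the place of polar coordinates and makes s = |z|^2 the natural radial
    variable. In s, planar Lebesgue measure has the constant density pi and U' = r V becomes d/ds
    U(sqrt s) = V(sqrt s) / 2 with no weight left: this is the origin of 2 pi. The minus sign is
    that of the lower endpoint, where the ray starts on the paraboloid s = |x|^2. The obstacle is
    that the transforms may converge only conditionally. Every exchange of integrals is therefore
    made at fixed e and M, where V is integrable, and the limit is taken last, in an identity whose
    boundary terms are explicit. The two limits assumed of U are what these terms require: the
    transform of the ball of radius M is M^N times a Bessel factor O(M^(-(N+1)/2)), while for the
    small ball its volume is bound enough. *)

Lemma lebesgue_measure_affine (a b : R) (A : set (measurableTypeR R)) :
  (a != 0)%R -> measurable A ->
  mu A = `|a|%:E * mu [set x | A (a * x + b)%R].
Proof.
move=> a0 mA.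
pose phi (x : measurableTypeR R) : measurableTypeR R := (a * x + b)%R.
have mphi : measurable_fun setT phi.
  by apply: measurable_funD => //; exact: measurable_funM.
pose m1 : {measure set (measurableTypeR R) -> \bar R} :=
  measure_function_pushforward__canonical__measure_function_Measure mu mphi.
pose m := mscale (NngNum (normr_ge0 a)) m1.
apply: (@lebesgue_measure_unique R m) => // X /ocitvP[->|[[x y]] /= xy ->].
  by rewrite !measure0.
rewrite /m /mscale /= /pushforward.
have [a_gt0|a_le0] := ltP 0%R a.
  rewrite [X in _ = _ * mu X](_ : _ = `]((x - b) / a)%R, ((y - b) / a)%R]%classic); last first.
    apply/seteqP; split=> z /=; rewrite /phi !in_itv/=.
      by rewrite ltr_pdivrMr// ler_pdivlMr// ltrBlDr lerBrDr mulrC.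
    by rewrite ltr_pdivrMr// ler_pdivlMr// ltrBlDr lerBrDr mulrC.
  rewrite !lebesgue_measure_itv/= !lte_fin ltr_pM2r ?invr_gt0// ltrD2r.
  case: ifPn => _; last by rewrite mule0.
  rewrite -!EFinD -EFinM gtr0_norm//; congr EFin.
  by field.
have {a_le0}a_lt0 : (a < 0)%R by rewrite lt_neqAle a0.
(* For a < 0 the preimage of a half-open interval is half-open on the other side, with the length
   that the factor |a| requires. *)
rewrite [X in _ = _ * mu X](_ : _ = `[((y - b) / a)%R, ((x - b) / a)%R[%classic); last first.
  apply/seteqP; split=> z /=; rewrite /phi !in_itv/=.
    by rewrite ltr_ndivlMr// ler_ndivrMr// ltrBlDr lerBrDr mulrC andbC.
  by rewrite ltr_ndivlMr// ler_ndivrMr// ltrBlDr lerBrDr mulrC andbC.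
rewrite !lebesgue_measure_itv/= !lte_fin ltr_nM2r ?invr_lt0// ltrD2r.
case: ifPn => _; last by rewrite mule0.
rewrite -!EFinD -EFinM ltr0_norm//; congr EFin.
by field.
Qed.

Lemma ge0_integral_affine (a b : R) (f : R -> \bar R) : (a != 0)%R ->
  measurable_fun [set: R] f -> (forall x, 0 <= f x) ->
  \int[mu]_x f x = `|a|%:E * \int[mu]_x f (a * x + b)%R.
Proof.
move=> a0 mf f0.
pose phi (x : measurableTypeR R) : measurableTypeR R := (a * x + b)%R.
have mphi : measurable_fun setT phi.
  by apply: measurable_funD => //; exact: measurable_funM.
pose m1 : {measure set (measurableTypeR R) -> \bar R} :=
  measure_function_pushforward__canonical__measure_function_Measure mu mphi.
pose m := mscale (NngNum (normr_ge0 a)) m1.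
rewrite (eq_measure_integral m); last first.
  by move=> A mA _; exact: lebesgue_measure_affine.
rewrite ge0_integral_mscale//; congr (_ * _).
by rewrite (@ge0_integral_pushforward _ _ _ _ R _ mphi mu setT f).
Qed.

Lemma ge0_integral_translate (b : R) (f : R -> \bar R) :
  measurable_fun [set: R] f -> (forall x, 0 <= f x) ->
  \int[mu]_x f (x + b)%R = \int[mu]_x f x.
Proof.
move=> mf f0; rewrite (@ge0_integral_affine 1 b f)// ?oner_eq0// normr1 mul1e.
by under [RHS]eq_integral do rewrite mul1r.
Qed.

Lemma ge0_integral_opp (f : R -> \bar R) :
  measurable_fun [set: R] f -> (forall x, 0 <= f x) ->
  \int[mu]_x f (- x)%R = \int[mu]_x f x.
Proof.
move=> mf f0; rewrite (@ge0_integral_affine (-1) 0 f)// ?oppr_eq0 ?oner_eq0//.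
rewrite normrN1 mul1e.
by under [RHS]eq_integral do rewrite addr0 mulN1r.
Qed.

End affine.

(** * Iterated integrals and rotation invariance *)

Section iterated.
Variable R : realType.
Notation mu := (@lebesgue_measure R).
Notation M := (measurableTypeR R).
Local Open Scope ereal_scope.

Lemma dotR_cons n (a b : R) (x y : Rn R n) :
  dotR (Rn_cons (a, x)) (Rn_cons (b, y)) = (a * b + dotR x y)%R.
Proof.
rewrite /dotR big_ord_recl; congr (_ * _ + _)%R.
by apply: eq_bigr => i _; rewrite !tnthS.
Qed.

Lemma dotR_ge0 n (x : Rn R n) : (0 <= dotR x x)%R.
Proof. by apply: sumr_ge0 => i _; rewrite -expr2 sqr_ge0. Qed.

Lemma sqr_enorm n (x : Rn R n) : (enorm x ^+ 2 = dotR x x)%R.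
Proof. by rewrite sqr_sqrtr// dotR_ge0. Qed.

Lemma Rn_uncons_cons n (x : Rn R n.+1) : Rn_cons (Rn_uncons x) = x.
Proof. by apply: val_inj => /=; case: x => -[|a s]. Qed.

Lemma Rn_consP n (x : Rn R n.+1) :
  exists (a : R) (y : Rn R n), x = Rn_cons (a, y).
Proof. by exists (Rn_uncons x).1, (Rn_uncons x).2; rewrite -[LHS]Rn_uncons_cons. Qed.

Lemma ge0_integral_Rn_cons n (f : Rn R n.+1 -> \bar R) :
  measurable_fun setT f -> (forall x, 0 <= f x) ->
  \int[lebesgue_Rn R n.+1]_x f x =
  \int[mu]_a \int[lebesgue_Rn R n]_x f (Rn_cons (a, x)).
Proof.
move=> mf f0.
have mc := @measurable_Rn_cons R n.
have := @ge0_integral_pushforward _ _ _ _ R _ mc (mu \x lebesgue_Rn R n) setT f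
  measurableT mf (fun x _ => f0 x).
rewrite preimage_setT => h.
transitivity (\int[mu \x lebesgue_Rn R n]_p (f \o @Rn_cons R n) p); last first.
  rewrite (fubini_tonelli1 (f \o @Rn_cons R n))//.
    exact: (measurableT_comp mf mc).
  by move=> p; exact: f0.
by rewrite -h; apply: eq_measure_integral => A mA _.
Qed.

Lemma measurable_fun_dotR2 n (xi : Rn R n) :
  measurable_fun setT (fun x : Rn R n => (dotR x xi, dotR x x)).
Proof.
apply/measurable_fun_pair; first exact: measurable_dotR.
by apply: measurable_sum => i; apply: measurable_funM; exact: measurable_coordR.
Qed.

Lemma measurable_shear1 (m : R) :
  measurable_fun [set: M * M] (fun p : M * M => (p.1 + m * p.2, p.2)%R).
Proof.
by apply/measurable_fun_pair => //=; apply: measurable_funD => //;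
  apply: measurable_funM.
Qed.

Lemma measurable_shear2 (m : R) :
  measurable_fun [set: M * M] (fun p : M * M => (p.1, p.2 + m * p.1)%R).
Proof.
by apply/measurable_fun_pair => //=; apply: measurable_funD => //;
  apply: measurable_funM.
Qed.

Section plane.
Implicit Types F : M * M -> \bar R.

Lemma ge0_integral_swap F : measurable_fun setT F -> (forall p, 0 <= F p) ->
  \int[mu]_x \int[mu]_y F (x, y) = \int[mu]_y \int[mu]_x F (x, y).
Proof. exact: (@fubini_tonelli _ _ _ _ R mu mu F). Qed.

Lemma ge0_integral_shear2 F (m : R) : measurable_fun setT F ->
  (forall p, 0 <= F p) ->
  \int[mu]_x \int[mu]_y F (x, y + m * x)%R = \int[mu]_x \int[mu]_y F (x, y).
Proof.
move=> mF F0; apply: eq_integral => x _.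
apply: (@ge0_integral_translate _ _ (fun y => F (x, y))) => [|y]; last exact: F0.
exact: (measurableT_comp mF (pair1_measurable x)).
Qed.

Lemma ge0_integral_shear1 F (m : R) : measurable_fun setT F ->
  (forall p, 0 <= F p) ->
  \int[mu]_x \int[mu]_y F (x + m * y, y)%R = \int[mu]_x \int[mu]_y F (x, y).
Proof.
move=> mF F0.
pose G := F \o (fun p : M * M => (p.1 + m * p.2, p.2)%R).
have mG : measurable_fun setT G := measurableT_comp mF (measurable_shear1 m).
have G0 p : 0 <= G p by exact: F0.
transitivity (\int[mu]_y \int[mu]_x G (x, y)); first exact: (ge0_integral_swap mG G0).
transitivity (\int[mu]_y \int[mu]_x F (x, y)); last exact/esym/ge0_integral_swap.
apply: eq_integral => y _.
apply: (@ge0_integral_translate _ (m * y) (fun x => F (x, y))) => [|x]; last exact: F0.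
exact: (measurableT_comp mF (pair2_measurable y)).
Qed.

(* A rotation of angle different from [pi] is the product of three shears. *)
Lemma ge0_integral_rotation F (c s : R) : measurable_fun setT F ->
  (forall p, 0 <= F p) -> (c != -1)%R -> (c ^+ 2 + s ^+ 2 = 1)%R ->
  \int[mu]_x \int[mu]_y F (c * x - s * y, s * x + c * y)%R =
  \int[mu]_x \int[mu]_y F (x, y).
Proof.
(* For a rotation of angle theta, [t] is tan (theta / 2): the shears are horizontal by -t, vertical
   by s and horizontal by -t again. *)
move=> mF F0 c1 cs1; pose t := (s / (1 + c))%R.
have c10 : (1 + c != 0)%R by rewrite addrC -[1%R]opprK subr_eq0.
have st : (1 - s * t = c)%R.
  apply: (mulIf c10); rewrite /t mulrBl mul1r mulrA divfK//.
  have -> : (s * s = 1 - c * c)%R by rewrite -cs1; ring.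
  by ring.
have tc : (t + t * c = s)%R by rewrite -{1}(mulr1 t) -mulrDr /t divfK.
pose F1 := F \o (fun p : M * M => (p.1 + - t * p.2, p.2)%R).
have mF1 : measurable_fun setT F1 := measurableT_comp mF (measurable_shear1 _).
pose F2 := F1 \o (fun p : M * M => (p.1, p.2 + s * p.1)%R).
have mF2 : measurable_fun setT F2 := measurableT_comp mF1 (measurable_shear2 _).
have F10 p : 0 <= F1 p by exact: F0.
have F20 p : 0 <= F2 p by exact: F0.
transitivity (\int[mu]_x \int[mu]_y F1 (x, y)); last exact: ge0_integral_shear1.
transitivity (\int[mu]_x \int[mu]_y F2 (x, y)); last exact: ge0_integral_shear2.
transitivity (\int[mu]_x \int[mu]_y F2 (x + - t * y, y)%R); last first.
  exact: ge0_integral_shear1.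
apply: eq_integral => x _; apply: eq_integral => y _.
rewrite /F2 /F1 /=; congr (F (_, _)).
  by rewrite -[X in (_ - X * y)%R]tc -!st; ring.
by rewrite -st; ring.
Qed.

Lemma measurable_radial (b d : R) : measurable_fun [set: M * M]
  (fun p : M * M => (b * p.1 + d * p.2, p.1 ^+ 2 + p.2 ^+ 2)%R).
Proof.
by apply/measurable_fun_pair => /=; apply: measurable_funD;
  (apply: measurable_funM || apply: measurable_funX).
Qed.

(** The form b x + d y is rho times a coordinate of a rotated frame, and x^2 + y^2 does not see the
    rotation. The shears do not reach the half-turn, (b, d) = (-rho, 0), which is replaced by the
    reflection x |-> -x; for rho = 0 there is no direction to rotate. *)
Lemma ge0_integral_radial2 F (b d : R) : measurable_fun setT F ->
  (forall p, 0 <= F p) ->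
  \int[mu]_x \int[mu]_y F (b * x + d * y, x ^+ 2 + y ^+ 2)%R =
  \int[mu]_x \int[mu]_y F (Num.sqrt (b ^+ 2 + d ^+ 2) * x, x ^+ 2 + y ^+ 2)%R.
Proof.
move=> mF F0; set rho := Num.sqrt _.
have bd0 : (0 <= b ^+ 2 + d ^+ 2)%R by rewrite addr_ge0 ?sqr_ge0.
have rho2 : (rho ^+ 2 = b ^+ 2 + d ^+ 2)%R by rewrite sqr_sqrtr.
pose G := F \o (fun p : M * M => (rho * p.1 + 0 * p.2, p.1 ^+ 2 + p.2 ^+ 2)%R).
have mG : measurable_fun setT G := measurableT_comp mF (measurable_radial _ _).
have G0 p : 0 <= G p by exact: F0.
have GE x y : G (x, y) = F (rho * x, x ^+ 2 + y ^+ 2)%R.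
  by rewrite /G /= mul0r addr0.
have [rho0|rho0] := eqVneq rho 0%R.
  have [-> ->] : b = 0%R /\ d = 0%R.
    move: rho2; rewrite rho0 expr0n/= => /esym/eqP.
    by rewrite paddr_eq0 ?sqr_ge0// !sqrf_eq0 => /andP[/eqP -> /eqP ->].
  by apply: eq_integral => x _; apply: eq_integral => y _; rewrite rho0 !mul0r addr0.
transitivity (\int[mu]_x \int[mu]_y G (x, y)); last first.
  by apply: eq_integral => x _; apply: eq_integral => y _; rewrite GE.
have [b1|b1] := eqVneq (b / rho)%R (-1)%R.
  have bE : b = (- rho)%R by rewrite -[b](divfK rho0) b1 mulN1r.
  have d0 : d = 0%R.
    apply/eqP; rewrite -sqrf_eq0; apply/eqP.
    by move: rho2; rewrite bE sqrrN => /eqP; rewrite addrC -subr_eq subrr => /eqP.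
  transitivity (\int[mu]_x \int[mu]_y G (- x, y)%R).
    apply: eq_integral => x _; apply: eq_integral => y _.
    by rewrite GE bE d0 sqrrN mul0r addr0 mulNr mulrN.
  apply: (@ge0_integral_opp _ (fun x => \int[mu]_y G (x, y))).
    exact: (@measurable_fun_fubini_tonelli_F _ _ _ _ R mu G).
  by move=> x; apply: integral_ge0 => y _; exact: G0.
transitivity (\int[mu]_x \int[mu]_y
    G (b / rho * x - (- d / rho) * y, (- d / rho) * x + b / rho * y)%R).
  apply: eq_integral => x _; apply: eq_integral => y _; rewrite GE.
  congr (F (_, _)); first by field.
  transitivity ((b ^+ 2 + d ^+ 2) / rho ^+ 2 * (x ^+ 2 + y ^+ 2))%R; last by field.
  by rewrite -rho2 divff ?mul1r// expf_neq0.
apply: ge0_integral_rotation => //.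
transitivity ((b ^+ 2 + d ^+ 2) / rho ^+ 2)%R; first by field.
by rewrite -rho2 divff ?expf_neq0.
Qed.

End plane.

Lemma enorm_cons n (b : R) (x : Rn R n) :
  enorm (Rn_cons (b, x)) = Num.sqrt (b ^+ 2 + enorm x ^+ 2)%R.
Proof. by rewrite {1}/enorm dotR_cons sqr_enorm expr2. Qed.

Lemma enorm_ge0 n (x : Rn R n) : (0 <= enorm x)%R.
Proof. exact: sqrtr_ge0. Qed.

Lemma measurable_sqnorm n : measurable_fun setT (fun x : Rn R n => dotR x x).
Proof.
by apply: measurable_sum => i; apply: measurable_funM; exact: measurable_coordR.
Qed.

Lemma measurable_cons_dotR n (b : R) : measurable_fun setT
  (fun p : M * Rn R n => (b * p.1, p.1 ^+ 2 + dotR p.2 p.2)%R).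
Proof.
apply/measurable_fun_pair => /=; first exact: measurable_funM.
apply: measurable_funD; first exact: measurable_funX.
exact: (measurableT_comp (@measurable_sqnorm n) measurable_snd).
Qed.

(* The joint law of [x . xi] and [|x|^2] depends only on [|xi|]. *)
Lemma ge0_integral_dotR n (xi : Rn R n.+1) (F : M * M -> \bar R) :
  measurable_fun setT F -> (forall p, 0 <= F p) ->
  \int[lebesgue_Rn R n.+1]_x F (dotR x xi, dotR x x) =
  \int[mu]_a \int[lebesgue_Rn R n]_y F (enorm xi * a, a ^+ 2 + dotR y y)%R.
Proof.
elim: n xi F => [|n IH] xi F mF F0.
  have := @ge0_integral_Rn_cons 0 (fun x => F (dotR x xi, dotR x x))
    (measurableT_comp mF (measurable_fun_dotR2 xi)) (fun x => F0 _).
  move=> ->; have [b [y0 ->]] := Rn_consP xi.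
  rewrite enorm_cons /enorm.
  pose H a := \int[lebesgue_Rn R 0]_y F (`|b| * a, a ^+ 2 + dotR y y)%R.
  have mH : measurable_fun setT H.
    pose K := F \o (fun p : M * Rn R 0 => (`|b| * p.1, p.1 ^+ 2 + dotR p.2 p.2)%R).
    apply: (@measurable_fun_fubini_tonelli_F _ _ _ _ R (lebesgue_Rn R 0) K).
      exact: (measurableT_comp mF (@measurable_cons_dotR 0 `|b|)).
    by move=> p; exact: F0.
  have H0 a : 0 <= H a by apply: integral_ge0 => y _; exact: F0.
  transitivity (\int[mu]_a H a); last first.
    apply: eq_integral => a _; apply: eq_integral => y _.
    by rewrite {2}/dotR big_ord0 sqrtr0 expr0n addr0 sqrtr_sqr.
  have [b0|b0] := leP 0%R b.
    apply: eq_integral => a _; apply: eq_integral => y _.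
    by rewrite !dotR_cons {1}/dotR big_ord0 addr0 ger0_norm// mulrC.
  rewrite -(ge0_integral_opp mH H0).
  apply: eq_integral => a _; apply: eq_integral => y _.
  rewrite !dotR_cons {1}/dotR big_ord0 addr0 sqrrN expr2.
  by rewrite ltr0_norm// mulrNN mulrC.
have := @ge0_integral_Rn_cons n.+1 (fun x => F (dotR x xi, dotR x x))
  (measurableT_comp mF (measurable_fun_dotR2 xi)) (fun x => F0 _).
move=> ->; have [b [xi' ->]] := Rn_consP xi.
rewrite enorm_cons.
(* The induction hypothesis turns the lower part of the scalar product into [enorm xi' * c]. With
   the other n coordinates integrated out in [K], only a rotation of the plane of a and c
   remains. *)
pose K (p : M * M) := \int[lebesgue_Rn R n]_y F (p.1, p.2 + dotR y y)%R.
have mK : measurable_fun setT K.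
  pose L := F \o (fun p : (M * M) * Rn R n => (p.1.1, p.1.2 + dotR p.2 p.2)%R).
  apply: (@measurable_fun_fubini_tonelli_F _ _ _ _ R (lebesgue_Rn R n) L).
    apply: (measurableT_comp mF); apply/measurable_fun_pair => /=.
      exact: (measurableT_comp measurable_fst measurable_fst).
    apply: measurable_funD.
      exact: (measurableT_comp measurable_snd measurable_fst).
    exact: (measurableT_comp (@measurable_sqnorm n) measurable_snd).
  by move=> p; exact: F0.
have K0 p : 0 <= K p by apply: integral_ge0 => y _; exact: F0.
transitivity (\int[mu]_a \int[mu]_c K (b * a + enorm xi' * c, a ^+ 2 + c ^+ 2)%R).
  apply: eq_integral => a _.
  pose Fa := F \o (fun p : M * M => (b * a + p.1, a ^+ 2 + p.2)%R).
  transitivity (\int[lebesgue_Rn R n.+1]_x Fa (dotR x xi', dotR x x)).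
    by apply: eq_integral => x _; rewrite /Fa /= !dotR_cons mulrC expr2.
  rewrite IH; [|apply: (measurableT_comp mF)|by move=> p; exact: F0]; last first.
    by apply/measurable_fun_pair => /=; apply: measurable_funD.
  apply: eq_integral => c _; apply: eq_integral => y _.
  by rewrite /Fa /= addrA.
rewrite ge0_integral_radial2; [|exact: mK|exact: K0].
apply: eq_integral => a _.
pose G (x : Rn R n.+1) := F (Num.sqrt (b ^+ 2 + enorm xi' ^+ 2) * a, a ^+ 2 + dotR x x)%R.
transitivity (\int[lebesgue_Rn R n.+1]_x G x); last by [].
rewrite ge0_integral_Rn_cons; [|apply: (measurableT_comp mF)|by move=> x; exact: F0];
    last first.
  apply/measurable_fun_pair => //=.
  by apply: measurable_funD => //; exact: measurable_sqnorm.
apply: eq_integral => c _; apply: eq_integral => y _.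
by rewrite /G dotR_cons addrA expr2.
Qed.

End iterated.
(** * Fourier integrals of balls *)

Section ball_integrals.
Variable R : realType.
Notation mu := (@lebesgue_measure R).
Notation M := (measurableTypeR R).

(* By Poisson's integral, [besselI m r] is a constant multiple of
   [r^(-m/2) J_(m/2)(r)]. *)
Definition besselI (m : nat) (r : R) : R :=
  \int[mu]_(t in `[(- (pi / 2)), (pi / 2)]) (cos (r * sin t) * cos t ^+ m).

Lemma pihalf_gt0 : 0 < pi / 2 :> R.
Proof. by rewrite divr_gt0// pi_gt0. Qed.

Lemma ltNpihalf : - (pi / 2) < pi / 2 :> R.
Proof. by rewrite gtrN// pihalf_gt0. Qed.

Lemma continuous_integrable_itv (f : R -> R) (a b : R) : continuous f ->
  mu.-integrable `[a, b] (EFin \o f).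
Proof.
move=> cf; apply: continuous_compact_integrable; first exact: segment_compact.
exact: continuous_subspaceT.
Qed.

Lemma continuous_trig (m : nat) (r c : R) :
  continuous (fun t : R => cos (r * sin t + c) * cos t ^+ m).
Proof.
move=> t; apply: cvgM.
  apply: continuous_comp; last exact: continuous_cos.
  apply: cvgD; last exact: cvg_cst.
  by apply: cvgMr; exact: continuous_sin.
by apply: (@continuous_comp _ _ _ cos (fun x => x ^+ m)); [exact: continuous_cos|exact: exprn_continuous].
Qed.

Lemma derivable_oo_LRcontinuous_derivable (F : R -> R) (a b : R) :
  (forall x, derivable F x 1) -> derivable_oo_LRcontinuous F a b.
Proof.
move=> dF; split => [x _|//|].
- exact: dF.
- by apply: cvg_at_right_filter; exact/differentiable_continuous/derivable1_diffP.
- by apply: cvg_at_left_filter; exact/differentiable_continuous/derivable1_diffP.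
Qed.

Lemma integral_substitution_sin (G : R -> R) (r : R) : 0 < r -> continuous G ->
  (\int[mu]_(x in `[(- r)%R, r]) (G x)%:E)%E =
  (\int[mu]_(t in `[(- (pi / 2))%R, (pi / 2)%R]) (G (r * sin t) * (r * cos t))%R%:E)%E.
Proof.
move=> r0 cG; pose F (t : R) := r * sin t.
have dF (t : R) : is_derive t (1 : R) F (r * cos t).
  by rewrite /F; apply: is_deriveZ.
have F' : derive1 F = (fun t => r * cos t).
  by apply/funext => t; rewrite derive1E; exact: derive_val.
have cF' : continuous (fun t : R => r * cos t).
  by move=> t; apply: cvgMr; exact: continuous_cos.
have -> : r = F (pi / 2) by rewrite /F sin_pihalf mulr1.
have -> : - F (pi / 2) = F (- (pi / 2)) by rewrite /F sinN mulrN.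
rewrite integration_by_substitution_increasing.
- apply: eq_integral => t _.
  by rewrite fctE/= F' /F sin_pihalf mulr1.
- by rewrite ltW// ltNpihalf.
- by move=> x y xI yI xy; rewrite /F ltr_pM2l// ltr_sin.
- by rewrite F' => x _; exact: cF'.
- by rewrite F'; apply: cvgP; apply: cvg_at_right_filter; exact: cF'.
- by rewrite F'; apply: cvgP; apply: cvg_at_left_filter; exact: cF'.
- by apply: derivable_oo_LRcontinuous_derivable => x; apply: ex_derive.
- exact: continuous_subspaceT.
Qed.

Lemma continuous_ball_cos (n : nat) (k r : R) :
  continuous (fun x : R => cos (k * x) * Num.sqrt (r ^+ 2 - x ^+ 2) ^+ n).
Proof.
move=> x; apply: cvgM.
  by apply: continuous_comp; [exact: mulrl_continuous|exact: continuous_cos].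
have csq : continuous (fun y : R => Num.sqrt (r ^+ 2 - y ^+ 2)).
  move=> y; apply: continuous_comp; last exact: sqrt_continuous.
  by apply: cvgB; [exact: cvg_cst|exact: exprn_continuous].
exact: (continuous_comp (csq x) (@exprn_continuous _ n _)).
Qed.

(** A ball of radius r cut at height x has slices of volume proportional to the power of the square
    root. Under x = r sin t that root is r cos t, and dx brings one more such factor, hence the
    index [n.+1]. *)
Lemma integral_ball_cos (n : nat) (k r : R) : 0 <= r ->
  (\int[mu]_(x in `[(- r)%R, r]) (cos (k * x) * Num.sqrt (r ^+ 2 - x ^+ 2) ^+ n)%R%:E)%E =
   (r ^+ n.+1 * besselI n.+1 (k * r))%:E.
Proof.
rewrite le_eqVlt => /predU1P[<-|r0].
  by rewrite oppr0 set_itv1 integral_set1 exprS !mul0r.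
rewrite (integral_substitution_sin r0 (@continuous_ball_cos n k r)).
rewrite /besselI -RintegralZl//; last first.
  apply: continuous_integrable_itv.
  by have := @continuous_trig n.+1 (k * r) 0; under eq_fun do rewrite addr0.
rewrite /Rintegral fineK; last first.
  apply: integrable_fin_num => //; apply: continuous_integrable_itv => t.
  apply: cvgMr; move: t.
  by have := @continuous_trig n.+1 (k * r) 0; under eq_fun do rewrite addr0.
apply: eq_integral => t; rewrite inE/= in_itv/= => tI; congr EFin.
rewrite exprMn -{1}[r ^+ 2]mulr1 -mulrBr -cos2sin2 -exprMn sqrtr_sqr.
rewrite ger0_norm; last first.
  by apply: mulr_ge0; [exact: ltW|exact: cos_ge0_pihalf].
by rewrite exprMn !exprS !mulrA; ring.
Qed.

(* [besselI m.+1 0] is the integral of [(1 - x^2)^(m/2)] over [-1, 1]. *)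
Fixpoint unit_ball_volume (n : nat) : R :=
  if n is m.+1 then unit_ball_volume m * besselI m.+1 0 else 1.

Lemma measurable_le_indicator d (T : measurableType d) (f g : T -> M) :
  measurable_fun setT f -> measurable_fun setT g ->
  measurable_fun setT (fun x => ((f x <= g x)%R%:R : M)).
Proof.
move=> mf mg; have mA : measurable [set x | f x <= g x].
  have := measurable_fun_ler mf mg measurableT (Y := [set true]).
  by rewrite setTI; apply.
have -> : (fun x => ((f x <= g x)%R%:R : M)) = \1_[set x | f x <= g x].
  by apply/funext => x; rewrite indicE mem_setE.
exact: measurable_indic.
Qed.

Lemma measurable_sqnorm_le n : measurable_fun setT
  (fun p : M * Rn R n => ((dotR p.2 p.2 <= p.1)%R%:R : R)).
Proof.
apply: measurable_le_indicator => //.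
exact: (measurableT_comp (@measurable_sqnorm R n) measurable_snd).
Qed.

(** Slicing by the first coordinate gives the induction. For s < 0 the ball is empty, but
    [Num.sqrt s] is then 0 and its power 0 is 1, hence the explicit factor [(0 <= s)%R%:R]. *)
Lemma integral_sqnorm_le n (s : R) :
  (\int[lebesgue_Rn R n]_x ((dotR x x <= s)%R%:R)%:E)%E =
  ((0 <= s)%R%:R * (unit_ball_volume n * Num.sqrt s ^+ n))%:E.
Proof.
have [s0|s0] := ltP s 0.
  rewrite mul0r; apply: integral0_eq => x _.
  by rewrite leNgt (lt_le_trans s0 (dotR_ge0 x)).
rewrite mul1r; elim: n s s0 => [|n IH] s s0.
  rewrite integral_dirac//; last first.
    by apply/measurable_EFinP; exact: (measurableT_comp (@measurable_sqnorm_le 0) (pair1_measurable s)).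
  by rewrite diracE in_setT mul1e /dotR big_ord0 s0 expr0 mulr1.
rewrite (@ge0_integral_Rn_cons R n (fun x => ((dotR x x <= s)%R%:R)%:E)); last 2 first.
- by apply/measurable_EFinP; exact: (measurableT_comp (@measurable_sqnorm_le n.+1) (pair1_measurable s)).
- by move=> x; rewrite lee_fin ler0n.
(* The factor [cos (0 * a)] is 1; it gives the volumes of the slices the form evaluated by
   [integral_ball_cos] at frequency 0. *)
transitivity (\int[mu]_(a in `[(- Num.sqrt s)%R, Num.sqrt s])
    ((unit_ball_volume n)%:E *
      (cos (0 * a) * Num.sqrt (Num.sqrt s ^+ 2 - a ^+ 2) ^+ n)%R%:E))%E.
  rewrite [RHS]integral_mkcond; apply: eq_integral => a _.
  transitivity (\int[lebesgue_Rn R n]_x ((dotR x x <= s - a ^+ 2)%R%:R)%:E)%E.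
    by apply: eq_integral => x _; rewrite dotR_cons lerBrDl expr2.
  rewrite patchE mul0r cos0 mul1r -EFinM mem_setE in_itv/= -ler_norml.
  rewrite sqr_sqrtr// -(@ler_sqr _ `|a|) ?nnegrE ?sqrtr_ge0//.
  rewrite sqr_sqrtr// real_normK ?num_real//.
  case: ifPn => [as0|]; first by rewrite IH ?subr_ge0.
  rewrite -ltNge => sa; apply: integral0_eq => x _.
  rewrite leNgt (lt_le_trans _ (dotR_ge0 x))// subr_lt0//.
have cb : continuous (fun a : R => cos (0 * a) * Num.sqrt (Num.sqrt s ^+ 2 - a ^+ 2) ^+ n).
  exact: continuous_ball_cos.
rewrite integralZl//; last exact: continuous_integrable_itv.
rewrite integral_ball_cos ?sqrtr_ge0// mul0r -EFinM; congr EFin => /=.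
by ring.
Qed.

End ball_integrals.

(** * Values at 0 and the volumes of balls *)

Section bessel.
Variable R : realType.
Notation mu := (@lebesgue_measure R).
Notation M := (measurableTypeR R).

Lemma continuous_Rintegral_FTC (f F : R -> R) (a b : R) : a < b ->
  continuous f -> (forall t : R, is_derive t (1 : R) F (f t)) ->
  \int[mu]_(t in `[a, b]) f t = F b - F a.
Proof.
move=> ab cf dF; rewrite /Rintegral (@continuous_FTC2 _ f F)//.
- exact: continuous_subspaceT.
- by apply: derivable_oo_LRcontinuous_derivable => t; exact: ex_derive.
- by move=> t _; rewrite derive1E; exact: derive_val.
Qed.

Lemma continuous_cosX (m : nat) : continuous (fun t : R => cos t ^+ m).
Proof.
move=> t; exact: (continuous_comp (@continuous_cos R t) (@exprn_continuous _ m _)).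
Qed.

Lemma besselI0E (m : nat) :
  besselI m 0 = \int[mu]_(t in `[(- (pi / 2)), (pi / 2)]) (cos t ^+ m) :> R.
Proof. by apply: eq_Rintegral => t _; rewrite mul0r cos0 mul1r. Qed.

Lemma besselI0_0 : besselI 0 0 = pi :> R.
Proof.
rewrite besselI0E (@continuous_Rintegral_FTC _ id)//.
- by rewrite opprK -splitr.
- exact: ltNpihalf.
- exact: continuous_cosX.
Qed.

Lemma besselI1_0 : besselI 1 0 = 2 :> R.
Proof.
rewrite besselI0E (@continuous_Rintegral_FTC _ sin)//.
- by rewrite sinN sin_pihalf opprK.
- exact: ltNpihalf.
- exact: continuous_cosX.
Qed.

Lemma is_derive_cosX (m : nat) (t : R) :
  is_derive t (1 : R) (fun x : R => cos x ^+ m) (m%:R * cos t ^+ m.-1 * - sin t).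
Proof.
have -> : (fun x : R => cos x ^+ m) = (@cos R) ^+ m by rewrite exprfctE.
exact: is_deriveX.
Qed.

Lemma is_derive_mul (f g : R -> R) (t df dg : R) :
  is_derive t (1 : R) f df -> is_derive t (1 : R) g dg ->
  is_derive t (1 : R) (fun x => f x * g x) (f t * dg + g t * df).
Proof. exact: is_deriveM. Qed.

(** The function sin t cos^(m+1) t vanishes at both ends of the interval, so its derivative has
    integral 0. *)
Lemma besselI0_recurrence (m : nat) :
  m.+2%:R * besselI m.+2 0 = m.+1%:R * besselI m 0 :> R.
Proof.
pose F (t : R) := sin t * cos t ^+ m.+1.
pose f (t : R) := m.+2%:R * cos t ^+ m.+2 - m.+1%:R * cos t ^+ m.
have cf k c : continuous (fun t : R => c * cos t ^+ k).
  by move=> t; apply: cvgMr; exact: continuous_cosX.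
have dF t : is_derive t (1 : R) F (f t).
  apply: is_derive_eq (is_derive_mul (is_derive_sin t) (is_derive_cosX m.+1 t)) _.
  rewrite /f [m.+1.-1]/=.
  transitivity (cos t ^+ m.+2 - m.+1%:R * cos t ^+ m * sin t ^+ 2).
    by rewrite -exprSr; ring.
  rewrite sin2cos2 [cos t ^+ m.+2]exprS [cos t ^+ m.+1]exprS.
  by rewrite -[m.+2%:R]natr1; ring.
have : \int[mu]_(t in `[(- (pi / 2)), (pi / 2)]) f t = 0.
  rewrite (@continuous_Rintegral_FTC _ F) ?ltNpihalf//.
    by rewrite /F cosN cos_pihalf !expr0n/= !mulr0 subrr.
  by move=> t; apply: cvgB; exact: cf.
rewrite RintegralB//; last 2 first.
- by apply: continuous_integrable_itv; exact: cf.
- by apply: continuous_integrable_itv; exact: cf.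
rewrite !RintegralZl//; last 2 first.
- by apply: continuous_integrable_itv; exact: continuous_cosX.
- by apply: continuous_integrable_itv; exact: continuous_cosX.
by rewrite -!besselI0E => /eqP; rewrite subr_eq0 => /eqP.
Qed.

(** Passing from n to n + 2 multiplies the volume by two consecutive Wallis integrals. By the
    recurrence, their product times the larger index does not depend on the index; at the start it
    is pi times 2. *)
Lemma unit_ball_volumeSS (n : nat) :
  n.+2%:R * unit_ball_volume R n.+2 = 2 * pi * unit_ball_volume R n.
Proof.
have wallis k : k.+1%:R * besselI k.+1 0 * besselI k 0 = 2 * pi :> R.
  elim: k => [|k IH]; first by rewrite besselI0_0 besselI1_0 mul1r.
  by rewrite besselI0_recurrence mulrAC.
rewrite /= -(wallis n.+1); ring.
Qed.

Lemma unit_ball_volume2 : unit_ball_volume R 2 = pi.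
Proof.
apply: (mulfI (x := 2)) => //.
by rewrite (unit_ball_volumeSS 0) mulr1.
Qed.

Lemma unit_ball_volume_gt0 (n : nat) : 0 < unit_ball_volume R n.
Proof.
suff h : 0 < unit_ball_volume R n /\ 0 < unit_ball_volume R n.+1 by case: h.
elim: n => [|n [h1 h2]]; first by rewrite /= besselI1_0 mul1r; split.
split=> //; rewrite -(@pmulr_rgt0 _ n.+2%:R)// unit_ball_volumeSS.
by rewrite !mulr_gt0// pi_gt0.
Qed.

End bessel.

(** * Decay of solutions of Bessel's equation *)

Section bessel_decay.
Variable R : realType.

(* The energy [r^m (z^2 + y^2 + (m/r) y z)] is comparable with [r^m (z^2 + y^2)]
   for large [r], and its derivative [- m r^(m-2) y z] is at most [m/r^2] times
   itself, so that its product with [exp (m/r)] is nonincreasing. *)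
Lemma bessel_equation_decay (y z : R -> R) (m : nat) :
  (forall r : R, 0 < r -> is_derive r (1 : R) y (z r)) ->
  (forall r : R, 0 < r -> is_derive r (1 : R) z (- y r - m%:R / r * z r)) ->
  exists C r0 : R, 0 < r0 /\ forall r, r0 <= r -> r ^+ m * y r ^+ 2 <= C.
Proof.
(* From [r0] on, m / r <= 1, so the cross term of [q] takes away at most half of z^2 + y^2. The
   successor keeps [r0] positive when m = 0. *)
move=> dy dz; pose r0 : R := m.+1%:R.
have r00 : 0 < r0 by rewrite ltr0n.
pose q (r : R) := z r ^+ 2 + y r ^+ 2 + m%:R * (r^-1 * (y r * z r)).
pose P (r : R) := r ^+ m * q r * expR (m%:R * r^-1).
pose mr (r : R) := m%:R / r.
have dinv (r : R) : 0 < r -> is_derive r (1 : R) (fun s : R => s^-1) (- r ^- 2).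
  move=> r_gt0; have rn0 : r != 0 by rewrite gt_eqF.
  apply: is_derive_eq (@is_deriveV R id r 1 1 rn0 (is_derive_id r 1)) _.
  by rewrite [_ *: _]mulr1.
have dP (r : R) : 0 < r -> is_derive r (1 : R) P
    (r ^+ m * expR (mr r) * (- (mr r / r) * (y r * z r + q r))).
  move=> r_gt0; have rn0 : r != 0 by rewrite gt_eqF.
  have dX : is_derive r (1 : R) (fun s : R => s ^+ m) (mr r * r ^+ m).
    have -> : (fun s : R => s ^+ m) = (@id R) ^+ m by rewrite exprfctE.
    apply: is_derive_eq (is_deriveX m (is_derive_id r 1)) _.
    rewrite /mr [_ *: _]mulr1; case: (m) => [|k]; first by rewrite !mul0r.
    by rewrite /= exprS mulrA divfK.
  have dq : is_derive r (1 : R) q (- mr r * z r ^+ 2 - mr r * y r ^+ 2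
      - (mr r / r + mr r ^+ 2) * (y r * z r)).
    have dz2 := is_derive_mul (dz r r_gt0) (dz r r_gt0).
    have dy2 := is_derive_mul (dy r r_gt0) (dy r r_gt0).
    have dyz := is_derive_mul (dinv r r_gt0) (is_derive_mul (dy r r_gt0) (dz r r_gt0)).
    have -> : q = (fun r => z r * z r) + (fun r => y r * y r)
        + m%:R \*: (fun r => r^-1 * (y r * z r)).
      by apply/funext => s; rewrite /q !fctE.
    apply: is_derive_eq (is_deriveD (is_deriveD dz2 dy2) (is_deriveZ m%:R dyz)) _.
    rewrite /mr -[m%:R *: _]/(m%:R * _); by field.
  have dE : is_derive r (1 : R) (fun s : R => expR (m%:R * s^-1))
      (expR (mr r) * (- (mr r / r))).
    have h : is_derive r (1 : R) (fun s : R => m%:R * s^-1) (- (mr r / r)).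
      apply: is_derive_eq (is_deriveZ m%:R (dinv r r_gt0)) _.
      rewrite -[m%:R *: _]/(m%:R * _) /mr; by field.
    exact: (is_derive1_comp (is_derive_expR _) h).
  apply: is_derive_eq (is_derive_mul (is_derive_mul dX dq) dE) _.
  by rewrite /q -/(mr r) /mr; field.
exists (2 * P r0), r0; split=> // r r0r.
have pos (s : R) : r0 <= s -> 0 < s by exact: lt_le_trans.
have r_gt0 := pos _ r0r.
have key (s : R) : r0 <= s -> `|y s * z s| <= (z s ^+ 2 + y s ^+ 2) / 2 /\
    (z s ^+ 2 + y s ^+ 2) / 2 <= q s.
  move=> r0s; have s0 := pos _ r0s.
  have h1 : `|y s * z s| <= (z s ^+ 2 + y s ^+ 2) / 2.
    have a1 : 0 <= (y s - z s) ^+ 2 by exact: sqr_ge0.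
    have a2 : 0 <= (y s + z s) ^+ 2 by exact: sqr_ge0.
    by rewrite ler_norml; apply/andP; split; nra.
  split => //.
  have ms1 : 0 <= mr s <= 1.
    rewrite /mr divr_ge0 ?ler0n ?(ltW s0)//= ler_pdivrMr// mul1r.
    by apply: le_trans r0s; rewrite ler_nat.
  have : `|mr s * (y s * z s)| <= (z s ^+ 2 + y s ^+ 2) / 2.
    rewrite normrM; apply: le_trans h1; rewrite ger0_norm ?(andP ms1).1//.
    by rewrite ler_piMl// (andP ms1).2.
  by rewrite ler_norml /q mulrA -/(mr s) => /andP[h2 _]; lra.
have P_le : P r <= P r0.
  apply: (@ler0_derive1_nincry _ P r0) => // [s|s|].
  - by rewrite in_itv/= andbT => r0s; have := dP s (lt_trans r00 r0s) => ?; exact: ex_derive.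
  - rewrite in_itv/= andbT => r0s; rewrite derive1E.
    have s0 := lt_trans r00 r0s.
    have := dP s s0 => ?; rewrite derive_val.
    apply: mulr_ge0_le0; first by rewrite mulr_ge0 ?expR_ge0 ?exprn_ge0 ?(ltW s0).
    rewrite mulNr oppr_le0; apply: mulr_ge0.
      by rewrite !divr_ge0 ?ler0n ?(ltW s0).
    have [k1 k2] := key s (ltW r0s).
    by move: k1; rewrite ler_norml => /andP[k1 _]; lra.
  - apply: continuous_in_subspaceT => s.
    rewrite inE/= in_itv/= andbT => r0s; have := dP s (pos _ r0s) => ?.
    by apply/differentiable_continuous/derivable1_diffP; exact: ex_derive.
have [_ k2] := key r r0r.
have : r ^+ m * q r <= P r.
  rewrite /P ler_peMr//.
    apply: mulr_ge0; [by rewrite exprn_ge0 ?(ltW r_gt0)|apply: le_trans k2].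
    by rewrite divr_ge0// addr_ge0// sqr_ge0.
  by rewrite -expR0 ler_expR mulr_ge0 ?ler0n// invr_ge0 ltW.
move=> h; apply: (@le_trans _ _ (2 * (r ^+ m * q r))).
  rewrite [leRHS]mulrCA ler_wpM2l ?exprn_ge0 ?(ltW r_gt0)//.
  by have := sqr_ge0 (z r); lra.
by rewrite ler_wpM2l// (le_trans h).
Qed.

End bessel_decay.

(** * Bessel's equation for the Poisson integrals *)

Section bessel_derivative.
Variable R : realType.
Notation mu := (@lebesgue_measure R).

Lemma is_derive_cos_affine (a c r : R) :
  is_derive r (1 : R) (fun s : R => cos (s * a + c)) (- sin (r * a + c) * a).
Proof.
have h : is_derive r (1 : R) (fun s : R => s * a + c) a.
  have -> : (fun s : R => s * a + c) = (a \*: (@id R)) + cst c.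
    by apply/funext => s; rewrite mulrC.
  by apply: is_derive_eq; rewrite addr0 [_ *: _]mulr1.
exact: (is_derive1_comp (is_derive_cos _) h).
Qed.

(** The phase [c] covers two derivatives at once: [c = 0] serves [besselI], and [c = pi / 2], where
    the cosine becomes minus a sine, serves [dbesselI]. Differentiation under the integral is
    dominated by the constant 1. *)
Lemma is_derive_oscillatory (A : R -> R) (c r : R) : continuous A ->
  (forall t, `|A t| <= 1) ->
  is_derive r (1 : R)
    (fun s => \int[mu]_(t in `[(- (pi / 2)), (pi / 2)]) (cos (s * sin t + c) * A t))
    (\int[mu]_(t in `[(- (pi / 2)), (pi / 2)])
       (- sin (r * sin t + c) * sin t * A t)).
Proof.
move=> cA A1.
pose f (s t : R) := cos (s * sin t + c) * A t.
have df (s t : R) : is_derive s (1 : R) (f ^~ t) (- sin (s * sin t + c) * sin t * A t).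
  have h := is_derive_mul (is_derive_cos_affine (sin t) c s)
    (is_derive_cst (A t) s 1).
  by apply: is_derive_eq h _; rewrite mulr0 add0r mulrC.
have d1f (s t : R) : partial1of2 f s t = - sin (s * sin t + c) * sin t * A t.
  by rewrite partial1of2E; have := df s t => ?; exact: derive_val.
have cf (s : R) : continuous (f s).
  move=> t; apply: cvgM; last exact: cA.
  apply: continuous_comp; last exact: continuous_cos.
  apply: cvgD; last exact: cvg_cst.
  by apply: cvgMr; exact: continuous_sin.
have intf (s : R) : `](r - 1), (r + 1)[%classic s ->
    mu.-integrable `[(- (pi / 2)), (pi / 2)] (EFin \o f s).
  by move=> _; exact: continuous_integrable_itv.
have Ir : `](r - 1), (r + 1)[%classic r.
  by rewrite /= in_itv/= ltrBlDr ltrDl ltr01.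
have derf (s t : R) : `](r - 1), (r + 1)[%classic s ->
    `[(- (pi / 2)), (pi / 2)]%classic t -> derivable (f ^~ t) s 1.
  by move=> _ _; have := df s t => ?; exact: ex_derive.
have G_ub (s t : R) : `](r - 1), (r + 1)[%classic s ->
    `[(- (pi / 2)), (pi / 2)]%classic t -> `|partial1of2 f s t| <= cst 1 t.
  move=> _ _; rewrite d1f !normrM normrN.
  by rewrite /= mulr_ile1 ?mulr_ge0 ?normr_ge0 ?A1// mulr_ile1 ?normr_ge0 ?sin_max.
have i1 : mu.-integrable `[(- (pi / 2)), (pi / 2)] (EFin \o cst (1 : R)).
  by apply: continuous_integrable_itv; exact: cst_continuous.
apply: DeriveDef.
  by apply: (derivable_under_integral _ Ir intf derf _ i1 G_ub) => // t; exact: ler01.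
rewrite -derive1E.
rewrite (differentiation_under_integral _ Ir intf derf _ i1 G_ub)//.
by apply: eq_Rintegral => t _; exact: d1f.
Qed.

Definition dbesselI (m : nat) (r : R) : R :=
  \int[mu]_(t in `[(- (pi / 2)), (pi / 2)]) (- sin (r * sin t) * sin t * cos t ^+ m).

Lemma normr_cosX_le1 (m : nat) (t : R) : `|cos t ^+ m| <= 1.
Proof. by rewrite normrX exprn_ile1// cos_max. Qed.

Lemma is_derive_besselI (m : nat) (r : R) :
  is_derive r (1 : R) (besselI m) (dbesselI m r).
Proof.
have := is_derive_oscillatory 0 r (@continuous_cosX R m) (normr_cosX_le1 m).
rewrite /dbesselI /besselI.
under eq_fun do under eq_Rintegral do rewrite addr0.
by under eq_Rintegral do rewrite addr0.
Qed.

Lemma continuous_sin_cosX (m : nat) : continuous (fun t : R => sin t * cos t ^+ m).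
Proof.
by move=> t; apply: cvgM; [exact: continuous_sin|exact: continuous_cosX].
Qed.

(** Integration by parts: cos^(m+1) t sin (r sin t) vanishes at both endpoints, and its derivative
    in t is the combined integrand. *)
Lemma besselI_recurrence (m : nat) (r : R) :
  r * besselI m.+2 r + m.+1%:R * dbesselI m r = 0.
Proof.
pose F (t : R) := cos t ^+ m.+1 * sin (r * sin t).
pose f (t : R) := r * (cos (r * sin t) * cos t ^+ m.+2) +
  m.+1%:R * (- sin (r * sin t) * sin t * cos t ^+ m).
have cc k : continuous (fun t : R => cos (r * sin t) * cos t ^+ k).
  by have := @continuous_trig R k r 0; under eq_fun do rewrite addr0.
have cs : continuous (fun t : R => - sin (r * sin t) * sin t * cos t ^+ m).
  move=> t; apply: cvgM; last exact: continuous_cosX.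
  apply: cvgM; last exact: continuous_sin.
  apply: cvgN; apply: (@continuous_comp _ _ _ (fun t => r * sin t) sin).
    by apply: cvgMr; exact: continuous_sin.
  exact: continuous_sin.
have cf : continuous f.
  by move=> t; apply: cvgD; apply: cvgMr; [exact: cc|exact: cs].
have dF (t : R) : is_derive t (1 : R) F (f t).
  have ds : is_derive t (1 : R) (fun t : R => sin (r * sin t)) (cos (r * sin t) * (r * cos t)).
    by apply: (is_derive1_comp (is_derive_sin _)); exact: is_deriveZ.
  apply: is_derive_eq (is_derive_mul (is_derive_cosX m.+1 t) ds) _.
  by rewrite /f [m.+1.-1]/= [cos t ^+ m.+2]exprS; ring.
have h : \int[mu]_(t in `[(- (pi / 2)), (pi / 2)]) f t = 0.
  rewrite (continuous_Rintegral_FTC (@ltNpihalf R) cf dF).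
  by rewrite /F cosN cos_pihalf !expr0n/= !mul0r subrr.
rewrite -{}h /f RintegralD//; last 2 first.
- by apply: continuous_integrable_itv => t; apply: cvgMr; exact: cc.
- by apply: continuous_integrable_itv => t; apply: cvgMr; exact: cs.
by rewrite !RintegralZl//; apply: continuous_integrable_itv; (exact: cc || exact: cs).
Qed.

(** The second derivative carries the factor - sin^2 t = cos^2 t - 1, so it is I_(m+2) - I_m; the
    recurrence then replaces I_(m+2) by the first derivative. The result is the equation y'' +
    ((m+1)/r) y' + y = 0 written as a first-order system. *)
Lemma is_derive_dbesselI (m : nat) (r : R) : 0 < r ->
  is_derive r (1 : R) (dbesselI m) (- besselI m r - m.+1%:R / r * dbesselI m r).
Proof.
move=> r0.
have sc1 t : `|sin t * cos t ^+ m : R| <= 1.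
  by rewrite normrM mulr_ile1 ?normr_cosX_le1// sin_max.
have := is_derive_oscillatory (pi / 2) r (@continuous_sin_cosX m) sc1.
under eq_fun do under eq_Rintegral do rewrite cosDpihalf mulrA.
move=> h; apply: is_derive_eq h _.
have cc k : continuous (fun t : R => cos (r * sin t) * cos t ^+ k).
  by have := @continuous_trig R k r 0; under eq_fun do rewrite addr0.
transitivity (\int[mu]_(t in `[(- (pi / 2)), (pi / 2)])
    (cos (r * sin t) * cos t ^+ m.+2 - cos (r * sin t) * cos t ^+ m)).
  apply: eq_Rintegral => t _; rewrite sinDpihalf.
  transitivity (- cos (r * sin t) * sin t ^+ 2 * cos t ^+ m); first by ring.
  by rewrite sin2cos2 [cos t ^+ m.+2]exprS [cos t ^+ m.+1]exprS; ring.
rewrite RintegralB//; try (by apply: continuous_integrable_itv; exact: cc).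
rewrite -/(besselI m.+2 r) -/(besselI m r).
have := besselI_recurrence m r => /eqP; rewrite addr_eq0 => /eqP h.
apply: (mulfI (lt0r_neq0 r0)); rewrite mulrBr h; field.
by rewrite gt_eqF.
Qed.

Lemma besselI_decay (m : nat) :
  exists C r0 : R, 0 < r0 /\ forall r, r0 <= r -> r ^+ m.+1 * besselI m r ^+ 2 <= C.
Proof.
apply: (@bessel_equation_decay _ (besselI m) (dbesselI m)) => r r0.
  exact: is_derive_besselI.
exact: is_derive_dbesselI.
Qed.

End bessel_derivative.
(** * The fundamental theorem of calculus for integrable derivatives *)

Section monotone_dini.
Variable R : realType.
Notation mu := (@lebesgue_measure R).
Notation M := (measurableTypeR R).
Local Open Scope ereal_scope.

(* Adding [nu `]a, x]] to a function of [x] turns its finite lower right Dini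
   derivatives at points of [Z] into [+oo]. *)
Lemma null_set_dense_measure (Z : set M) (e : R) : measurable Z -> mu Z = 0 ->
  (0 < e)%R ->
  exists nu : {measure set M -> \bar R}, nu setT <= e%:E /\
    forall x, Z x -> forall k : nat, exists2 d : R, (0 < d)%R &
      forall y, (x < y < x + d)%R -> (k%:R * (y - x))%:E <= nu `]x, y]%classic.
Proof.
move=> mZ Z0 e0.
have Oex : forall n : nat, exists W : set M,
    [/\ open W, Z `<=` W & mu W <= (e / (2 ^ n.+1)%:R)%:E].
  move=> n; have en : (0 < e / (2 ^ n.+1)%:R)%R by rewrite divr_gt0// ltr0n expn_gt0.
  have Zoo : mu Z < +oo by rewrite Z0.
  have [W [oO ZO muW]] := lebesgue_regularity_outer mZ Zoo en.
  exists W; split => //.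
  have mO : measurable W by exact: open_measurable.
  have muE : mu ((W `\` Z) `|` Z) = mu (W `\` Z) + mu Z.
    apply: measureU => //; first exact: measurableD.
    by rewrite setDE -setIA setICl setI0.
  have -> : W = (W `\` Z) `|` Z by rewrite setUC setDUK.
  by rewrite muE Z0 adde0 ltW.
have [W hO] := choice Oex.
have mO n : measurable (W n : set M) by apply: open_measurable; have [] := hO n.
(* The open sets [W n] contain [Z] and have measures summing to at most e. Around a point of [Z] the
   first k of them share an interval, on which [nu] is at least k times Lebesgue measure. *)
pose nu : {measure set M -> \bar R} := mseries (fun n => mrestr mu (mO n)) 0.
exists nu; split.
  rewrite /nu/= /mseries; apply: le_trans (epsilon_trick0 xpredT (ltW e0)).
  apply: lee_nneseries => n *; first exact: measure_ge0.
  have h : mu (setT `&` W n) <= (e / (2 ^ n.+1)%:R)%:E.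
    by rewrite setTI; have [] := hO n.
  exact: h.
move=> x Zx k.
have [d d0 dO] : exists2 d : R, (0 < d)%R &
    forall y, (`|y - x| < d)%R -> forall n, (n < k)%N -> W n y.
  elim: k => [|k [d d0 IH]]; first by exists 1%R.
  have [oO ZO _] := hO k.
  have := (open_nbhs_nbhs (conj oO (ZO _ Zx))).
  move=> /nbhs_ballP[d' /= d'0 d'W]; exists (Num.min d d').
    by rewrite lt_min d0.
  move=> y; rewrite lt_min => /andP[yd yd'] n; rewrite ltnS leq_eqVlt => /predU1P[->|].
    by apply: d'W; rewrite /ball/= distrC.
  exact: IH.
exists d => // y /andP[xy yd].
apply: (@le_trans _ _ (\sum_(0 <= n < k) mrestr mu (mO n) `]x, y]%classic)).
  rewrite (eq_big_nat _ _ (F2 := fun=> (y - x)%:E)); last first.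
    move=> n /andP[_ nk]; rewrite /mrestr (_ : _ `&` _ = `]x, y]%classic).
      by rewrite lebesgue_measure_itv/= lte_fin xy EFinB.
    apply/setIidPl => z /=; rewrite in_itv/= => /andP[xz zy].
    by apply: dO => //; rewrite gtr0_norm ?subr_gt0// ltrBlDl (le_lt_trans zy).
  by rewrite sumEFin lee_fin big_const_nat iter_addr_0 subn0 mulr_natl.
rewrite /nu/= /mseries; apply: nneseries_lim_ge => n _ _; exact: measure_ge0.
Qed.

Local Close Scope ereal_scope.

(* The last two hypotheses say that the lower right Dini derivative of [h] is
   [> -oo] everywhere and [>= 0] off [Z]. *)
Lemma dini_nondecreasing (h : R -> R) (a b : R) (Z : set M) : a <= b ->
  measurable Z -> mu Z = 0%E -> {within `[a, b], continuous h} ->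
  (forall x, a <= x < b -> exists L d : R, 0 < d /\
    forall y, x < y < x + d -> y <= b -> L * (y - x) <= h y - h x) ->
  (forall x, a <= x < b -> ~ Z x -> forall e : R, 0 < e -> exists2 d : R, 0 < d &
    forall y, x < y < x + d -> y <= b -> - e * (y - x) <= h y - h x) ->
  h a <= h b.
Proof.
move=> ab mZ Z0 ch dini_lb dini_ge0; apply/ler_addgt0Pr => e e0.
(* The linear term of [H] will cost e1 (b - a) and the measure [nu] at most e1, together exactly
   e. *)
pose e1 := e / (b - a + 1).
have ba1 : 0 < b - a + 1 by rewrite ltr_wpDl ?ltr01// subr_ge0.
have e10 : 0 < e1 by rewrite divr_gt0.
have [nu [nuT nuZ]] := null_set_dense_measure mZ Z0 e10.
have nufin A : measurable A -> nu A \is a fin_num.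
  move=> mA; rewrite ge0_fin_numE//.
  apply: (@le_lt_trans _ _ e1%:E); last exact: ltry.
  by apply: le_trans nuT; apply: le_measure; rewrite ?inE.
have nuE A : measurable A -> nu A = (fine (nu A))%:E.
  by move=> mA; rewrite fineK// nufin.
have nu0 A : 0 <= fine (nu A) by exact: fine_ge0.
pose psi x := fine (nu `]a, x]%classic).
have psiD x y : a <= x -> x <= y -> psi y = psi x + fine (nu `]x, y]%classic).
  move=> ax xy; rewrite /psi -fineD ?nufin//.
  rewrite -measureU//.
    by rewrite -itv_bndbnd_setU// bnd_simp.
  apply/seteqP; split => // z /= []; rewrite !in_itv/= => /andP[_ zx] /andP[xz _].
  by move: (lt_le_trans xz zx); rewrite ltxx.
(* Off [Z] the linear term makes up for the slack in the Dini derivative; at points of [Z] the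
   growth of [psi] beats any finite lower bound. So [H] does not drop just to the right of any point
   of [[a, b[], and the supremum of [S] cannot be below b. *)
pose H x := h x + e1 * (x - a) + psi x.
pose S := [set x | a <= x <= b /\ H a <= H x].
have Sa : S a by split; rewrite ?lexx.
have ubS : ubound S b by move=> x [/andP[]].
have supS : has_sup S by split; [exists a|exists b].
pose c := sup S.
have ac : a <= c by exact: sup_upper_bound.
have cb : c <= b by apply: ge_sup => //; exists a.
(* The supremum belongs to [S]: [h] is continuous, and the other two terms of [H] are nondecreasing,
   so a jump of [psi] at [c] can only help. *)
have Sc : S c.
  split; first by rewrite ac.
  apply/ler_addgt0Pr => eta eta0.
  have [d d0 hd] : exists2 d : R, 0 < d & forall z, a <= z <= b -> `|z - c| < d ->
      h z < h c + eta.
    move/subspace_continuousP : ch => /(_ c); rewrite /= in_itv/= ac cb => /(_ isT).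
    move=> /cvgrPdist_lt/(_ _ eta0)[d /= d0 hd]; exists d => // z zab zc.
    have := hd z; rewrite /= in_itv/= distrC => /(_ zc zab).
    by rewrite /from_subspace ltr_norml => /andP[? _]; lra.
  have [z [/andP[az zb] Hz] zc] := sup_adherent d0 supS.
  have zlec : z <= c by apply: sup_upper_bound => //; split=> //; rewrite az.
  have hz : h z < h c + eta.
    by apply: hd; rewrite ?az// distrC ger0_norm ?subr_ge0// -/c in zc *; lra.
  have psiz : psi z <= psi c by rewrite (psiD z c)// lerDl.
  apply: (le_trans Hz); rewrite /H.
  have : e1 * (z - a) <= e1 * (c - a) by rewrite ler_wpM2l ?(ltW e10)//; lra.
  by lra.
have [cltb|] := ltP c b; last first.
  move=> bc; have cbE : c = b by apply/le_anti; rewrite cb bc.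
  move: (Sc.2); rewrite cbE /H subrr mulr0 addr0 /psi set_itvoc0 measure0 addr0 => Hc.
  apply: (le_trans Hc); rewrite -addrA lerD2l.
  have -> : e = e1 * (b - a) + e1 by rewrite -[X in _ + X]mulr1 -mulrDr /e1 divfK ?gt_eqF.
  rewrite lerD2l.
  by rewrite -lee_fin -nuE//; apply: le_trans nuT; apply: le_measure; rewrite ?inE.
have [d d0 Hd] : exists2 d : R, 0 < d & forall y, c < y < c + d -> y <= b -> H c <= H y.
  have acb : a <= c < b by rewrite ac.
  have [Zc|nZc] := pselect (Z c); last first.
    have [d d0 hd] := dini_ge0 c acb nZc e1 e10; exists d => // y cyd yb.
    have /andP[cy _] := cyd.
    rewrite /H (psiD c y) ?(ltW cy)//; have := hd y cyd yb.
    by have := nu0 `]c, y]%classic; lra.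
  have [L [d [d0 hd]]] := dini_lb c acb.
  pose k := (Num.truncn `|L|).+1.
  have Lk : - L <= k%:R.
    by apply: (le_trans (ler_norm _)); rewrite normrN ltW// truncnS_gt.
  have [d' d'0 hd'] := nuZ c Zc k.
  exists (Num.min d d'); first by rewrite lt_min d0.
  move=> y /andP[cy yd] yb.
  have /andP[yd1 yd2] : (y < c + d) && (y < c + d').
    by move: yd; rewrite -ltrBlDl lt_min !ltrBlDl.
  have h1 := hd y; rewrite cy yd1 in h1; have {}h1 := h1 isT yb.
  have h2 := hd' y; rewrite cy yd2 nuE// lee_fin in h2; have {}h2 := h2 isT.
  rewrite /H (psiD c y) ?(ltW cy)//.
  have h3 : - L * (y - c) <= k%:R * (y - c) by rewrite ler_wpM2r// subr_ge0 ltW.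
  have h4 : 0 <= e1 * (y - c) by rewrite mulr_ge0 ?(ltW e10)// subr_ge0 ltW.
  by lra.
pose y := Num.min b (c + d / 2).
have cy : c < y by rewrite lt_min cltb ltrDl divr_gt0.
have yb : y <= b by rewrite ge_min lexx.
have Sy : S y.
  split; first by rewrite yb (le_trans ac (ltW cy)).
  apply: le_trans (Sc.2) _; apply: Hd => //; rewrite cy/=.
  by rewrite gt_min ltrD2l; apply/orP; right; rewrite gtr_pMr// invf_lt1 ?ltr1n.
have := sup_upper_bound supS Sy; rewrite -/c.
by rewrite leNgt cy.
Qed.

End monotone_dini.

(** * Integrals of everywhere defined derivatives *)

Section ftc_everywhere.
Variable R : realType.
Notation mu := (@lebesgue_measure R).
Notation M := (measurableTypeR R).

Lemma is_derive_dist_le (f : R -> R) (x l : R) : is_derive x (1 : R) f l ->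
  forall e : R, 0 < e -> exists2 d : R, 0 < d &
    forall y, `|y - x| < d -> `|f y - f x - l * (y - x)| <= e * `|y - x|.
Proof.
move=> dfl e e0; have df : derivable f x 1 by exact: ex_derive.
have fl : 'D_1 f x = l by exact: derive_val.
have : h^-1 *: (f (h *: 1 + x) - f x) @[h --> (0 : R)^'] --> l.
  by rewrite -fl; exact: df.
move=> /cvgrPdist_le/(_ _ e0)[d /= d0 hd].
exists d => // y yd.
have [->|yx] := eqVneq y x; first by rewrite !subrr mulr0 subrr normr0 mulr0.
have yx0 : y - x != 0 by rewrite subr_eq0.
have := hd (y - x); rewrite /= sub0r normrN => /(_ yd yx0).
rewrite [_ *: 1]mulr1 subrK => h.
rewrite -ler_pdivrMr ?normr_gt0// -normf_div.
apply: le_trans h; rewrite distrC mulrBl mulfK//.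
by rewrite [_ *: _]mulrC.
Qed.

Lemma integrable_cst_itv (a b r : R) :
  mu.-integrable `[a, b] (EFin \o (fun=> r)).
Proof. by apply: continuous_integrable_itv; exact: cst_continuous. Qed.

(** Truncating [g] from above by k bounds the difference quotients of its primitive [F] by k, so
    [f - F] has lower Dini derivatives above -oo everywhere. Almost everywhere F' = min (g, k) <= g
    = f', so they are nonnegative there, and [dini_nondecreasing] applies. *)
Let truncated_FTC_le (f g : R -> R) (a b : R) (k : nat) : a <= b ->
  (forall x, a <= x <= b -> is_derive x (1 : R) f (g x)) ->
  mu.-integrable `[a, b] (EFin \o g) ->
  (\int[mu]_(x in `[a, b]) (Num.min (g x) k%:R)%:E <= (f b - f a)%:E)%E.
Proof.
move=> ab dfg ig.
have mab : measurable (`[a, b]%classic : set M) by exact: measurable_itv.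
pose gk (x : R) := Num.min (g x) k%:R.
have mg : measurable_fun `[a, b] g.
  by apply/measurable_EFinP; exact: measurable_int ig.
have igk : mu.-integrable `[a, b] (EFin \o gk).
  apply: (@le_integrable _ _ _ mu _ mab _ (fun x => (`|g x| + k%:R)%:E)).
  - by apply/measurable_EFinP; exact: measurable_minr.
  - move=> x _ /=; rewrite lee_fin [leRHS]ger0_norm ?addr_ge0//.
    rewrite /gk; case: (leP (g x) k%:R) => _; first by rewrite lerDl.
    by rewrite ger0_norm ?ler0n// lerDr.
  - exact: (integrableD mab (integrable_norm ig) (integrable_cst_itv a b k%:R)).
pose G := gk \_ `[a, b].
have iGA (A : set M) : measurable A -> mu.-integrable A (EFin \o G).
  move=> mA; have : mu.-integrable setT (EFin \o G).
    by rewrite /G -restrict_EFin; exact: ((integrable_mkcond _ mab).1 igk).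
  exact: integrableS.
have lG : locally_integrable setT G := integrable_locally_restrict mab igk.
pose F x := \int[mu]_(t in `[a, x]) G t.
have := @FTC1 R G (BLeft a) (fun y => iGA _ (measurable_itv _)) lG.
rewrite -/F => -[Z [mZ Z0 subZ]].
pose h x := f x - F x.
have FB x y : a <= x -> x <= y -> F y - F x = \int[mu]_(t in `]x, y]) G t.
  move=> ax xy; rewrite /F Rintegral_itvB//; exact: iGA.
have Fa : F a = 0 by rewrite /F set_itv1 Rintegral_set1.
have Fb : F b = \int[mu]_(x in `[a, b]) gk x.
  by apply: eq_Rintegral => x xab; rewrite /G patchE xab.
have Gk x : G x <= k%:R.
  by rewrite /G patchE; case: ifP => _; rewrite ?ge_min ?lexx ?orbT// ler0n.
rewrite -(fineK (integrable_fin_num mab igk)) lee_fin.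
rewrite -[leLHS]/(\int[mu]_(x in `[a, b]) gk x) -Fb; suff : h a <= h b by rewrite /h Fa subr0; lra.
(* The almost everywhere derivative of [F] is only known at points above [a], so [a] joins the
   exceptional set. *)
have mZa : measurable (Z `|` [set a]) by exact: measurableU.
have Za0 : mu (Z `|` [set a]) = 0%E.
  apply/eqP; rewrite eq_le measure_ge0 andbT.
  by rewrite -[leRHS](adde0 0%E) -{1}Z0 -(lebesgue_measure_set1 a) measureU2.
apply: (@dini_nondecreasing _ h a b (Z `|` [set a])) => //.
- have cf : {within `[a, b], continuous f}.
    apply: derivable_within_continuous => x; rewrite in_itv/= => xab.
    by have := dfg x xab => ?; exact: ex_derive.
  have cF : {within `[a, b], continuous F}.
    by apply: (@parameterized_integral_continuous _ a b G) => //; exact: iGA.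
  by move=> x; exact: (continuousB (cf x) (cF x)).
- move=> x /andP[ax xb]; have xab : a <= x <= b by rewrite ax ltW.
  have [d d0 hd] := is_derive_dist_le (dfg x xab) ltr01.
  exists (g x - 1 - k%:R), d; split => // y /andP[xy yd] yb.
  have yx0 : 0 < y - x by rewrite subr_gt0.
  have := hd y; rewrite gtr0_norm// ltrBlDl => /(_ yd).
  rewrite ler_norml => /andP[h1 _].
  have h2 : F y - F x <= k%:R * (y - x).
    rewrite FB// ?(ltW xy)//.
    apply: (@le_trans _ _ (\int[mu]_(t in `]x, y]) k%:R)).
      apply: le_Rintegral => //; first exact: iGA.
      apply: integrableS (integrable_cst_itv x y k%:R) => //.
      exact: subset_itv_oc_cc.
    by rewrite Rintegral_cst//= lebesgue_measure_itv/= lte_fin xy.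
  by rewrite /h; lra.
- move=> x /andP[ax xb] nZx e e0.
  have xa : x <> a by move=> xa; apply: nZx; right.
  have xab : a <= x <= b by rewrite ax ltW.
  have [dF F'] : derivable F x 1 /\ derive1 F x = G x.
    apply: contrapT => nF; apply: nZx; left; apply: subZ => /= hyp.
    by apply/nF/hyp; rewrite lte_fin lt_neqAle eq_sym ax andbT; exact/eqP.
  have dFx : is_derive x (1 : R) F (G x) by apply: DeriveDef; [exact: dF|rewrite -derive1E; exact: F'].
  have e20 : 0 < e / 2 by rewrite divr_gt0.
  have [d1 d10 hd1] := is_derive_dist_le (dfg x xab) e20.
  have [d2 d20 hd2] := is_derive_dist_le dFx e20.
  exists (Num.min d1 d2); first by rewrite lt_min d10.
  move=> y /andP[xy]; rewrite -ltrBlDl lt_min => /andP[yd1 yd2] yb.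
  have yx0 : 0 < y - x by rewrite subr_gt0.
  have := hd1 y; rewrite gtr0_norm// => /(_ yd1); rewrite ler_norml => /andP[h1 _].
  have := hd2 y; rewrite gtr0_norm// => /(_ yd2); rewrite ler_norml => /andP[_ h2].
  have h3 : G x * (y - x) <= g x * (y - x).
    rewrite ler_pM2r// /G patchE mem_set; last by rewrite /= in_itv/=.
    by rewrite /gk ge_min lexx.
  by rewrite /h; lra.
Qed.

Let FTC_le (f g : R -> R) (a b : R) : a <= b ->
  (forall x, a <= x <= b -> is_derive x (1 : R) f (g x)) ->
  mu.-integrable `[a, b] (EFin \o g) ->
  \int[mu]_(x in `[a, b]) g x <= f b - f a.
Proof.
move=> ab dfg ig.
have mab : measurable (`[a, b]%classic : set M) by exact: measurable_itv.
have mg : measurable_fun `[a, b] g.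
  by apply/measurable_EFinP; exact: measurable_int ig.
have cv : (\int[mu]_(x in `[a, b]) (Num.min (g x) n%:R)%:E)%E @[n --> \oo] -->
    (\int[mu]_(x in `[a, b]) (g x)%:E)%E.
  apply: (@dominated_cvg _ _ _ mu _ mab _ _ (fun x => `|g x|%:E)) => //.
  - by move=> n; apply/measurable_EFinP; exact: measurable_minr.
  - move=> x _; apply: cvg_near_cst; near=> n.
    congr EFin; apply/min_idPl; near: n; exact: nbhs_infty_ger.
  - exact: integrable_norm.
  - move=> n x _; rewrite lee_fin; case: (leP (g x) n%:R) => // ng.
    by rewrite ger0_norm ?ler0n// (le_trans (ltW ng)) ?ler_norm.
rewrite -lee_fin fineK; last exact: integrable_fin_num.
rewrite -(cvg_lim _ cv)//; apply: lime_le; first by apply/cvg_ex; eexists; exact: cv.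
by apply: nearW => n; exact: truncated_FTC_le.
Unshelve. all: end_near. Qed.

(** Letting the truncation level tend to infinity gives one inequality; the other is the same
    inequality for [\- f]. *)
Lemma derivable_everywhere_FTC (f g : R -> R) (a b : R) : a <= b ->
  (forall x, a <= x <= b -> is_derive x (1 : R) f (g x)) ->
  mu.-integrable `[a, b] (EFin \o g) ->
  \int[mu]_(x in `[a, b]) g x = f b - f a.
Proof.
move=> ab dfg ig; apply/le_anti; rewrite FTC_le//=.
have dNf x : a <= x <= b -> is_derive x (1 : R) (\- f) (- g x).
  by move=> xab; apply: is_deriveN; exact: dfg.
have igN : mu.-integrable `[a, b] (EFin \o (fun x => - g x)).
  by have := integrableN ig; apply: eq_integrable.
have := FTC_le ab dNf igN.
have -> : \int[mu]_(x in `[a, b]) - g x = - \int[mu]_(x in `[a, b]) g x.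
  under eq_Rintegral do rewrite -mulN1r.
  by rewrite RintegralZl// mulN1r.
by move=> /=; lra.
Qed.

End ftc_everywhere.
(** * From dimension n to dimension n + 2 *)

Section measure_on_line.
Variable R : realType.
Notation mu := (@lebesgue_measure R).
Notation M := (measurableTypeR R).
Local Open Scope ereal_scope.

Lemma measure_unique_cdf (m1 m2 : {measure set M -> \bar R}) :
  (forall t : R, m1 `]-oo, t]%classic = m2 `]-oo, t]%classic) ->
  (forall t : R, m1 `]-oo, t]%classic < +oo) ->
  forall A, measurable A -> m1 A = m2 A.
Proof.
move=> m12 m1oo; pose I n : set M := `](- n%:R)%R, n%:R]%classic.
have mNy (t : R) : measurable (`]-oo, t]%classic : set M) by exact: measurable_itv.
have ocE (m : {measure set M -> \bar R}) (x y : R) : (x <= y)%R ->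
    m `]-oo, y]%classic < +oo ->
    m `]x, y]%classic = m `]-oo, y]%classic - m `]-oo, x]%classic.
  move=> xy moo.
  have -> : `]x, y]%classic = `]-oo, y]%classic `\` `]-oo, x]%classic :> set R.
    apply/seteqP; split => z /=; rewrite !in_itv/=.
      by move=> /andP[xz ->]; split => //; apply/negP; rewrite -ltNge.
    by move=> [-> /negP]; rewrite -ltNge => ->.
  rewrite measureD//; congr (_ - m _).
  by apply/setIidPr => z /=; rewrite !in_itv/= => /le_trans; exact.
apply: (@measure_unique _ R M (@ocitv R) I erefl (@ocitvI R)) => //.
- by move=> n; exact/is_ocitv.
- rewrite -subTset => x _; exists (Num.truncn `|x|).+1 => //=.
  rewrite /I/= in_itv/=; have := truncnS_gt `|x|; rewrite ltr_norml => /andP[-> /ltW ->] //.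
- move=> A /ocitvP[->|[[a b] /= ab ->]]; first by rewrite !measure0.
  by rewrite !ocE ?(ltW ab) -?m12.
- move=> k; apply: le_lt_trans (m1oo k%:R); apply: le_measure.
  + by rewrite inE; exact: measurable_itv.
  + by rewrite inE.
  + by move=> z; rewrite /I/= !in_itv/= => /andP[].
Qed.

(* The domains of integration discard the negative values of [q1] and [q2]. *)
Lemma ge0_integral_eq_cdf d1 d2 (T1 : measurableType d1) (T2 : measurableType d2)
    (m1 : {measure set T1 -> \bar R}) (m2 : {measure set T2 -> \bar R})
    (q1 : T1 -> M) (q2 : T2 -> M) (H : M -> \bar R) :
  measurable_fun setT q1 -> measurable_fun setT q2 ->
  (forall t : R, (0 <= t)%R -> m1 (q1 @^-1` `[0%R, t]) = m2 (q2 @^-1` `[0%R, t])) ->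
  (forall t : R, (0 <= t)%R -> m1 (q1 @^-1` `[0%R, t]) < +oo) ->
  measurable_fun setT H -> (forall t, 0 <= H t) ->
  \int[m1]_(x in q1 @^-1` `[0%R, +oo[) H (q1 x) =
  \int[m2]_(x in q2 @^-1` `[0%R, +oo[) H (q2 x).
Proof.
move=> mq1 mq2 m12 m1oo mH H0.
have m0y : measurable (`[0%R, +oo[%classic : set M) by exact: measurable_itv.
pose p1 : {measure set M -> \bar R} :=
  measure_function_pushforward__canonical__measure_function_Measure m1 mq1.
pose p2 : {measure set M -> \bar R} :=
  measure_function_pushforward__canonical__measure_function_Measure m2 mq2.
have setIE (t : R) : `]-oo, t]%classic `&` `[0%R, +oo[%classic = `[0%R, t]%classic :> set R.
  apply/seteqP; split => z /=; rewrite !in_itv/= andbT; first by move=> [-> ->].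
  by move=> /andP[-> ->].
have r12 A : measurable A -> mrestr p1 m0y A = mrestr p2 m0y A.
  have h (t : R) : p1 `[0%R, t]%classic = p2 `[0%R, t]%classic /\
      p1 `[0%R, t]%classic < +oo.
    have [t0|t0] := leP 0%R t.
      by split; [exact: m12|exact: m1oo].
    by rewrite set_itv_ge ?measure0// -?ltNge ?bnd_simp ?t0// -ltNge.
  have e1 (t : R) : mrestr p1 m0y `]-oo, t]%classic = p1 `[0%R, t]%classic by rewrite -setIE.
  have e2 (t : R) : mrestr p2 m0y `]-oo, t]%classic = p2 `[0%R, t]%classic by rewrite -setIE.
  apply: measure_unique_cdf => t.
    exact: (etrans (e1 t) (etrans (h t).1 (esym (e2 t)))).
  by have := (h t).2; rewrite -e1.
rewrite -(@ge0_integral_pushforward _ _ _ _ R _ mq1 m1 _ H m0y (measurable_funTS mH)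
  (fun x _ => H0 x)).
rewrite -(@ge0_integral_pushforward _ _ _ _ R _ mq2 m2 _ H m0y (measurable_funTS mH)
  (fun x _ => H0 x)).
apply: (eq_measure_integral p2) => A mA AD.
have := r12 A mA; rewrite /mrestr.
by rewrite (_ : A `&` _ = A) //; exact: setIidl.
Qed.

Lemma ge0_integral_Rn2 (f : Rn R 2 -> \bar R) : measurable_fun setT f ->
  (forall x, 0 <= f x) ->
  \int[lebesgue_Rn R 2]_x f x =
  \int[mu]_a \int[mu]_b f (Rn_cons (a, Rn_cons (b, [tuple]))).
Proof.
move=> mf f0; rewrite (ge0_integral_Rn_cons mf f0); apply: eq_integral => a _.
have mfa : measurable_fun setT (fun y => f (Rn_cons (a, y))).
  exact: (measurableT_comp mf (measurableT_comp (@measurable_Rn_cons R 1) (pair1_measurable a))).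
rewrite (ge0_integral_Rn_cons mfa (fun x => f0 _)); apply: eq_integral => b _.
rewrite integral_dirac//; first by rewrite diracT mul1e.
exact: (measurableT_comp mfa (measurableT_comp (@measurable_Rn_cons R 0) (pair1_measurable b))).
Qed.

Lemma ge0_integral_Rn1 (f : Rn R 1 -> \bar R) : measurable_fun setT f ->
  (forall x, 0 <= f x) ->
  \int[lebesgue_Rn R 1]_x f x = \int[mu]_a f (Rn_cons (a, [tuple])).
Proof.
move=> mf f0; rewrite (ge0_integral_Rn_cons mf f0); apply: eq_integral => a _.
rewrite integral_dirac//; first by rewrite diracT mul1e.
exact: (measurableT_comp mf (measurableT_comp (@measurable_Rn_cons R 0) (pair1_measurable a))).
Qed.

Definition cball n (s : R) : set (Rn R n) := [set x | (dotR x x <= s)%R].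

Lemma in_cball n s (x : Rn R n) : (x \in cball s) = (dotR x x <= s)%R.
Proof. by apply/idP/idP; rewrite inE. Qed.

Lemma preimage_sqnorm_itv n s :
  (fun x : Rn R n => dotR x x : M) @^-1` `[0%R, s] = cball s.
Proof.
by apply/seteqP; split => x; rewrite /cball/= in_itv/= dotR_ge0.
Qed.

Lemma measurable_cball n s : measurable (@cball n s).
Proof.
rewrite -preimage_sqnorm_itv -[X in measurable X]setTI.
by apply: (@measurable_sqnorm R n) => //; exact: measurable_itv.
Qed.

Lemma lebesgue_Rn_cball n s : (0 <= s)%R ->
  lebesgue_Rn R n (cball s) = (unit_ball_volume R n * Num.sqrt s ^+ n)%:E.
Proof.
move=> s0; rewrite -[X in lebesgue_Rn R n X]setIT.
rewrite -(integral_indic _ measurableT (@measurable_cball n s)).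
transitivity (\int[lebesgue_Rn R n]_x ((dotR x x <= s)%R%:R)%:E).
  by apply: eq_integral => x _; rewrite indicE mem_setE.
by rewrite integral_sqnorm_le s0 mul1r.
Qed.

Lemma preimage_sqnorm_ge0 n : (fun x : Rn R n => dotR x x : M) @^-1` `[0%R, +oo[ = setT.
Proof. by apply/seteqP; split => x //= _; rewrite in_itv/= dotR_ge0. Qed.

(** A disc of squared radius t has area pi t, so the image of planar measure under a^2 + b^2 and the
    measure pi dt on the half-line have the same distribution function. *)
Lemma ge0_integral_disc (H : M -> \bar R) : measurable_fun setT H ->
  (forall t, 0 <= H t) ->
  \int[mu]_a \int[mu]_b H (a ^+ 2 + b ^+ 2)%R =
  pi%:E * \int[mu]_(t in `[0%R, +oo[) H t.
Proof.
move=> mH H0; have mq := @measurable_sqnorm R 2.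
transitivity (\int[lebesgue_Rn R 2]_x H (dotR x x)).
  rewrite (ge0_integral_Rn2 (measurableT_comp mH mq) (fun x => H0 _)).
  apply: eq_integral => a _; apply: eq_integral => b _; rewrite /= !dotR_cons.
  by rewrite [X in (_ + (_ + X))%R]big_ord0 addr0 !expr2.
have m0y : measurable (`[0%R, +oo[%classic : set M) by exact: measurable_itv.
pose m2 : {measure set M -> \bar R} := mscale (NngNum (pi_ge0 R)) mu.
have mid : measurable_fun [set: M] (fun t : M => t) by exact: measurable_id.
have v1 (t : R) : (0 <= t)%R ->
    lebesgue_Rn R 2 ((fun x : Rn R 2 => dotR x x : M) @^-1` `[0%R, t]) = (pi * t)%:E.
  move=> t0; rewrite preimage_sqnorm_itv.
  by apply: (etrans (lebesgue_Rn_cball 2 t0)); rewrite unit_ball_volume2 sqr_sqrtr.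
have v2 (t : R) : (0 <= t)%R -> m2 `[0%R, t]%classic = (pi * t)%:E.
  rewrite /m2/= /mscale/= lebesgue_measure_itv/= lte_fin.
  case: ltgtP => // [t0 _|<- _]; first by rewrite -EFinB subr0 -EFinM.
  by rewrite mulr0 mule0.
have := @ge0_integral_eq_cdf _ _ _ _ (lebesgue_Rn R 2) m2 _ _ H mq mid.
rewrite preimage_sqnorm_ge0 => ->//.
- by rewrite ge0_integral_mscale//; exact: measurable_funTS.
- by move=> t t0; exact: (etrans (v1 t t0) (esym (v2 t t0))).
- by move=> t t0; apply: (le_lt_trans _ (ltry (pi * t))); rewrite -(v1 t t0).
Qed.

End measure_on_line.

(** * Integrating out two coordinates *)

Section dimension_shift.
Variable R : realType.
Notation mu := (@lebesgue_measure R).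
Notation M := (measurableTypeR R).
Local Open Scope ereal_scope.
Implicit Types F : M * M -> \bar R.

(* For [z = (a, b, x)] in [R^(n+2)], the image of [da db] under
   [(a, b) |-> s = |z|^2] is [pi ds] on [s >= |x|^2]. *)
Definition above_paraboloid n (xi : Rn R n) F (p : Rn R n * M) : \bar R :=
  F (dotR p.1 xi, p.2) * ((dotR p.1 p.1 <= p.2)%R%:R)%:E.

Lemma measurable_above_paraboloid n (xi : Rn R n) F : measurable_fun setT F ->
  measurable_fun setT (above_paraboloid xi F).
Proof.
move=> mF; apply: emeasurable_funM.
  apply: (measurableT_comp mF); apply/measurable_fun_pair => //=.
  exact: (measurableT_comp (measurable_dotR xi) measurable_fst).
apply/measurable_EFinP; apply: measurable_le_indicator => //.
exact: (measurableT_comp (@measurable_sqnorm R n) measurable_fst).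
Qed.

Lemma above_paraboloid_ge0 n (xi : Rn R n) F : (forall p, 0 <= F p) ->
  forall p, 0 <= above_paraboloid xi F p.
Proof. by move=> F0 p; rewrite mule_ge0// lee_fin ler0n. Qed.

Let measurable_sum3 n (xi : Rn R n) F : measurable_fun setT F ->
  measurable_fun setT (fun p : (M * Rn R n) * M =>
    F (dotR p.1.2 xi, p.1.1 ^+ 2 + p.2 ^+ 2 + dotR p.1.2 p.1.2)%R).
Proof.
move=> mF; apply: (measurableT_comp mF).
have m2 : measurable_fun setT (fun p : (M * Rn R n) * M => p.1.2).
  exact: (measurableT_comp measurable_snd measurable_fst).
apply/measurable_fun_pair => /=; first exact: (measurableT_comp (measurable_dotR xi) m2).
apply: measurable_funD; last exact: (measurableT_comp (@measurable_sqnorm R n) m2).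
apply: measurable_funD; apply: measurable_funX => //.
exact: (measurableT_comp measurable_fst measurable_fst).
Qed.

(** Two zero coordinates in the frequency make the integrand depend on (a, b) only through a^2 +
    b^2. After [ge0_integral_disc], translating by |x|^2 turns the half-line into s >= |x|^2. *)
Lemma ge0_integral_RnSS0 n (xi : Rn R n) F : measurable_fun setT F ->
  (forall p, 0 <= F p) ->
  \int[lebesgue_Rn R n.+2]_z
    F (dotR z (Rn_cons (0%R, Rn_cons (0%R, xi))), dotR z z) =
  pi%:E * \int[lebesgue_Rn R n]_x \int[mu]_s above_paraboloid xi F (x, s).
Proof.
move=> mF F0.
pose F3 (p : (M * Rn R n) * M) :=
  F (dotR p.1.2 xi, p.1.1 ^+ 2 + p.2 ^+ 2 + dotR p.1.2 p.1.2)%R.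
have mF3 : measurable_fun setT F3 := measurable_sum3 xi mF.
have F30 p : 0 <= F3 p by exact: F0.
set eta := Rn_cons _.
pose Fz (z : Rn R n.+2) := F (dotR z eta, dotR z z).
have mFz : measurable_fun setT Fz := measurableT_comp mF (measurable_fun_dotR2 eta).
rewrite (ge0_integral_Rn_cons mFz (fun z => F0 _)).
transitivity (\int[mu]_a \int[lebesgue_Rn R n]_x \int[mu]_b F3 ((a, x), b)).
  apply: eq_integral => a _.
  pose Fa (y : Rn R n.+1) := Fz (Rn_cons (a, y)).
  have mFa : measurable_fun setT Fa.
    exact: (measurableT_comp mFz (measurableT_comp (@measurable_Rn_cons R n.+1) (pair1_measurable a))).
  rewrite (ge0_integral_Rn_cons mFa (fun z => F0 _)).
  pose Fab (p : M * Rn R n) := F3 ((a, p.2), p.1).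
  have mFab : measurable_fun setT Fab.
    apply: (measurableT_comp mF3); apply/measurable_fun_pair => //=.
    exact: (measurableT_comp (pair1_measurable a) measurable_snd).
  transitivity (\int[mu]_b \int[lebesgue_Rn R n]_x Fab (b, x)).
    apply: eq_integral => b _; apply: eq_integral => x _.
    by rewrite /Fa /Fz /Fab /F3 /eta !dotR_cons !mulr0 !add0r !expr2 addrA.
  exact: (fubini_tonelli (m1 := mu) (m2 := lebesgue_Rn R n) Fab mFab (fun p => F0 _)).
pose F2 (p : M * Rn R n) := \int[mu]_b F3 (p, b).
have mF2 : measurable_fun setT F2.
  exact: (measurable_fun_fubini_tonelli_F (m2 := mu) F3 mF3 F30).
have F20 p : 0 <= F2 p by apply: integral_ge0 => b _; exact: F0.
transitivity (\int[lebesgue_Rn R n]_x \int[mu]_a F2 (a, x)).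
  exact: (fubini_tonelli (m1 := mu) (m2 := lebesgue_Rn R n) F2 mF2 F20).
rewrite -ge0_integralZl//; last first.
- exact: pi_ge0.
- by move=> x _; apply: integral_ge0 => s _; exact: above_paraboloid_ge0.
- exact: (measurable_fun_fubini_tonelli_F (m2 := mu) _
    (measurable_above_paraboloid xi mF) (above_paraboloid_ge0 xi F0)).
apply: eq_integral => x _.
pose H (t : M) := F (dotR x xi, t + dotR x x)%R.
have mH : measurable_fun setT H.
  apply: (measurableT_comp mF); apply/measurable_fun_pair => //=.
  exact: measurable_funD.
have := ge0_integral_disc mH (fun t => F0 _).
rewrite /F2 /F3 /H /= => ->; congr (_ * _).
have mK : measurable_fun setT (fun s => above_paraboloid xi F (x, s)).
  exact: (measurableT_comp (measurable_above_paraboloid xi mF) (pair1_measurable x)).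
rewrite -(ge0_integral_translate (dotR x x) mK (fun s => above_paraboloid_ge0 xi F0 _)).
rewrite integral_mkcond; apply: eq_integral => s _.
rewrite patchE mem_setE in_itv/= andbT /above_paraboloid/= lerDr.
by case: ifPn => _; rewrite ?mule1 ?mule0.
Qed.

Lemma ge0_integral_dotR_enorm n (xi eta : Rn R n.+1) F : measurable_fun setT F ->
  (forall p, 0 <= F p) -> enorm xi = enorm eta ->
  \int[lebesgue_Rn R n.+1]_x F (dotR x xi, dotR x x) =
  \int[lebesgue_Rn R n.+1]_x F (dotR x eta, dotR x x).
Proof.
by move=> mF F0 xieta; rewrite (ge0_integral_dotR xi mF F0) (ge0_integral_dotR eta mF F0) xieta.
Qed.

(** By rotation invariance [eta] may be replaced by [xi] preceded by two zeros, which has the same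
    norm. *)
Lemma ge0_integral_RnSS n (xi : Rn R n) (eta : Rn R n.+2) F :
  measurable_fun setT F -> (forall p, 0 <= F p) -> enorm eta = enorm xi ->
  \int[lebesgue_Rn R n.+2]_z F (dotR z eta, dotR z z) =
  pi%:E * \int[lebesgue_Rn R n]_x \int[mu]_s above_paraboloid xi F (x, s).
Proof.
move=> mF F0 etaxi; rewrite -(ge0_integral_RnSS0 xi mF F0).
apply: ge0_integral_dotR_enorm => //.
by rewrite !enorm_cons expr0n/= !add0r sqr_sqrtr ?sqr_ge0// sqrtr_sqr ger0_norm// enorm_ge0.
Qed.

Lemma integral_dotR n (xi : Rn R n.+1) F : measurable_fun setT F ->
  \int[lebesgue_Rn R n.+1]_x F (dotR x xi, dotR x x) =
  \int[mu \x lebesgue_Rn R n]_p F (enorm xi * p.1, p.1 ^+ 2 + dotR p.2 p.2)%R.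
Proof.
have nonneg F' : measurable_fun setT F' -> (forall p, 0 <= F' p) ->
  \int[lebesgue_Rn R n.+1]_x F' (dotR x xi, dotR x x) =
  \int[mu \x lebesgue_Rn R n]_p F' (enorm xi * p.1, p.1 ^+ 2 + dotR p.2 p.2)%R.
  move=> mF' F'0; rewrite (ge0_integral_dotR xi mF' F'0).
  have mFc := measurableT_comp mF' (@measurable_cons_dotR R n (enorm xi)).
  by rewrite (fubini_tonelli1 (m1 := mu) (m2 := lebesgue_Rn R n) _ mFc (fun p => F'0 _)).
move=> mF; rewrite integralE [RHS]integralE; congr (_ - _).
  have h := nonneg (F^\+) (measurable_funepos mF) (fun p => funepos_ge0 _ _).
  transitivity (\int[lebesgue_Rn R n.+1]_x F^\+ (dotR x xi, dotR x x)).
    by apply: eq_integral => x _; rewrite !funeposE.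
  by rewrite h; apply: eq_integral => x _; rewrite !funeposE.
have h := nonneg (F^\-) (measurable_funeneg mF) (fun p => funeneg_ge0 _ _).
transitivity (\int[lebesgue_Rn R n.+1]_x F^\- (dotR x xi, dotR x x)).
  by apply: eq_integral => x _; rewrite !funenegE.
by rewrite h; apply: eq_integral => x _; rewrite !funenegE.
Qed.

Lemma integral_dotR_enorm n (xi eta : Rn R n.+1) F : measurable_fun setT F ->
  enorm xi = enorm eta ->
  \int[lebesgue_Rn R n.+1]_x F (dotR x xi, dotR x x) =
  \int[lebesgue_Rn R n.+1]_x F (dotR x eta, dotR x x).
Proof.
by move=> mF xieta; rewrite (integral_dotR xi mF) (integral_dotR eta mF) xieta.
Qed.

Lemma above_paraboloid_pos n (xi : Rn R n) F :
  (above_paraboloid xi F)^\+ = above_paraboloid xi (F^\+).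
Proof.
apply/funext => p; rewrite /above_paraboloid !funeposE.
by case: (_ <= _)%R; rewrite ?mule1// !mule0 maxxx.
Qed.

Lemma above_paraboloid_neg n (xi : Rn R n) F :
  (above_paraboloid xi F)^\- = above_paraboloid xi (F^\-).
Proof.
apply/funext => p; rewrite /above_paraboloid !funenegE.
by case: (_ <= _)%R; rewrite ?mule1// !mule0 oppe0 maxxx.
Qed.

Lemma above_paraboloid_abse n (xi : Rn R n) F (p : Rn R n * M) :
  `|above_paraboloid xi F p| = above_paraboloid xi (abse \o F) p.
Proof.
by rewrite /above_paraboloid /=; case: (_ <= _)%R; rewrite ?mule1// !mule0 abse0.
Qed.

Lemma ge0_integral_RnSS_prod n (xi : Rn R n) (eta : Rn R n.+2) F :
  measurable_fun setT F -> (forall p, 0 <= F p) -> enorm eta = enorm xi ->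
  \int[lebesgue_Rn R n.+2]_z F (dotR z eta, dotR z z) =
  pi%:E * \int[lebesgue_Rn R n \x mu]_p above_paraboloid xi F p.
Proof.
move=> mF F0 etaxi; rewrite (ge0_integral_RnSS mF F0 etaxi).
have mA := measurable_above_paraboloid xi mF.
by rewrite (fubini_tonelli1 (m1 := lebesgue_Rn R n) (m2 := mu) _ mA
  (above_paraboloid_ge0 xi F0)).
Qed.

Lemma integrable_RnSS n (xi : Rn R n) (eta : Rn R n.+2) F :
  measurable_fun setT F -> enorm eta = enorm xi ->
  (lebesgue_Rn R n.+2).-integrable setT (fun z => F (dotR z eta, dotR z z)) ->
  (lebesgue_Rn R n \x mu).-integrable setT (above_paraboloid xi F).
Proof.
move=> mF etaxi /integrableP[_ iF]; apply/integrableP; split.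
  exact: measurable_above_paraboloid.
pose G := abse \o F.
have mG : measurable_fun setT G by exact: measurableT_comp.
have hG := ge0_integral_RnSS_prod mG (fun p => abse_ge0 _) etaxi.
have -> : \int[lebesgue_Rn R n \x mu]_p `|above_paraboloid xi F p| =
    \int[lebesgue_Rn R n \x mu]_p above_paraboloid xi G p.
  by apply: eq_integral => p _; rewrite above_paraboloid_abse.
move: iF; rewrite -/(G _) hG.
rewrite -[X in _ < X -> _](@gt0_muley _ pi%:E) ?lte_fin ?pi_gt0//.
by rewrite lte_pmul2l// lte_fin pi_gt0.
Qed.

Lemma integral_RnSS n (xi : Rn R n) (eta : Rn R n.+2) F :
  measurable_fun setT F -> enorm eta = enorm xi ->
  (lebesgue_Rn R n.+2).-integrable setT (fun z => F (dotR z eta, dotR z z)) ->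
  \int[lebesgue_Rn R n.+2]_z F (dotR z eta, dotR z z) =
  pi%:E * \int[lebesgue_Rn R n \x mu]_p above_paraboloid xi F p.
Proof.
move=> mF etaxi iF; have iP := integrable_RnSS mF etaxi iF.
rewrite integralE [in RHS]integralE muleBr//; last first.
  apply: fin_num_adde_defl; rewrite fin_numN; exact: integrable_neg_fin_num iP.
rewrite above_paraboloid_pos above_paraboloid_neg.
have hp := ge0_integral_RnSS_prod (measurable_funepos mF) (fun p => funepos_ge0 _ _) etaxi.
have hn := ge0_integral_RnSS_prod (measurable_funeneg mF) (fun p => funeneg_ge0 _ _) etaxi.
rewrite -hp -hn; congr (_ - _).
  by apply: eq_integral => x _; rewrite !funeposE.
by apply: eq_integral => x _; rewrite !funenegE.
Qed.

End dimension_shift.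

(** * Fourier transforms of balls *)

Section fourier_ball.
Variable R : realType.
Notation mu := (@lebesgue_measure R).
Notation M := (measurableTypeR R).

(** Open, because it is what remains of the closed ball when the annulus is removed. The parameter
    is the squared radius, as in [cball]. *)
Definition oball n (s : R) : set (Rn R n) := [set x | dotR x x < s].

Lemma measurable_oball n s : measurable (@oball n s).
Proof.
rewrite (_ : oball s = setT `&` (fun x : Rn R n => dotR x x : M) @^-1` `]-oo, s[).
  exact: (@measurable_sqnorm R n).
by rewrite setTI; apply/seteqP; split => x; rewrite /oball/= in_itv.
Qed.

(** Only the cosine of the exponential is kept: against a radial function the sine integrates to 0,
    see [integral_radial_sin]. *)
Definition wave n (xi x : Rn R n) : R := cos (2 * pi * dotR x xi).

Lemma measurable_wave n (xi : Rn R n) : measurable_fun setT (wave xi).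
Proof.
apply: (measurableT_comp (f := @cos R)).
  by apply: continuous_measurable_fun; exact: continuous_cos.
by apply: measurable_funM => //; exact: measurable_dotR.
Qed.

Lemma normr_wave_le1 n (xi x : Rn R n) : `|wave xi x| <= 1.
Proof. exact: cos_max. Qed.

Lemma integrable_wave n (xi : Rn R n) (D : set (Rn R n)) s : measurable D ->
  D `<=` cball s -> (lebesgue_Rn R n).-integrable D (EFin \o wave xi).
Proof.
move=> mD Ds; apply: measurable_bounded_integrable => //.
- apply: (@le_lt_trans _ _ (lebesgue_Rn R n (cball (Num.max s 0)))).
    apply: le_measure; rewrite ?inE//; first exact: measurable_cball.
    by move=> x /Ds; rewrite /cball/= le_max => ->.
  by rewrite lebesgue_Rn_cball ?le_max ?lexx ?orbT// ltry.
- exact: measurable_funTS (measurable_wave xi).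
- exists 1; split => // K K1 x _; exact: le_trans (normr_wave_le1 _ _) (ltW K1).
Qed.

Definition fball n (xi : Rn R n) (s : R) : R :=
  \int[lebesgue_Rn R n]_(x in cball s) wave xi x.

Definition foball n (xi : Rn R n) (s : R) : R :=
  \int[lebesgue_Rn R n]_(x in oball s) wave xi x.

Lemma oball_sub_cball n s : @oball n s `<=` cball s.
Proof. by move=> x; exact: ltW. Qed.

Lemma normr_foball_le n (xi : Rn R n) s : 0 <= s ->
  `|foball xi s| <= unit_ball_volume R n * Num.sqrt s ^+ n.
Proof.
move=> s0; have mo := @measurable_oball n s.
have io := integrable_wave xi mo (@oball_sub_cball n s).
apply: (le_trans (le_normr_Rintegral mo io)).
rewrite -lee_fin fineK; last first.
  by apply: integrable_fin_num => //; exact: integrable_norm.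
rewrite -lebesgue_Rn_cball//.
apply: (@le_trans _ _ (\int[lebesgue_Rn R n]_(x in oball s) (cst 1 x))%E).
  apply: ge0_le_integral => //.
  - apply/measurable_EFinP; apply: measurableT_comp => //.
    exact: measurable_funTS (measurable_wave xi).
  - by move=> x _; rewrite lee_fin normr_wave_le1.
rewrite integral_cst// mul1e; apply: le_measure; rewrite ?inE//.
  exact: measurable_cball.
exact: oball_sub_cball.
Qed.

(** With [xi] rotated onto the first axis, the phase depends on the first coordinate a alone and the
    slice at a is a ball of R^n of squared radius s - a^2. What remains is [integral_ball_cos]. *)
Lemma fballE n (xi : Rn R n.+1) s : 0 <= s ->
  fball xi s = unit_ball_volume R n * Num.sqrt s ^+ n.+1 *
    besselI n.+1 (2 * pi * enorm xi * Num.sqrt s).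
Proof.
move=> s0; pose k := 2 * pi * enorm xi.
pose F (p : M * M) : \bar R := (cos (2 * pi * p.1) * (p.2 <= s)%R%:R)%:E.
have mF : measurable_fun setT F.
  apply/measurable_EFinP; apply: measurable_funM.
    apply: (measurableT_comp (f := @cos R)); last exact: measurable_funM.
    by apply: continuous_measurable_fun; exact: continuous_cos.
  exact: measurable_le_indicator.
pose Fp (p : M * Rn R n) := F (enorm xi * p.1, p.1 ^+ 2 + dotR p.2 p.2).
have mFp : measurable_fun setT Fp.
  exact: (measurableT_comp mF (@measurable_cons_dotR R n (enorm xi))).
have iFp : (mu \x lebesgue_Rn R n)%E.-integrable setT Fp.
  apply/integrableP; split => //.
  pose G (p : M * M) : \bar R := ((p.2 <= s)%R%:R)%:E.
  have mG : measurable_fun setT G by apply/measurable_EFinP; exact: measurable_le_indicator.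
  have mGp : measurable_fun setT
    (fun p : M * Rn R n => G (enorm xi * p.1, p.1 ^+ 2 + dotR p.2 p.2)).
    exact: (measurableT_comp mG (@measurable_cons_dotR R n (enorm xi))).
  apply: (@le_lt_trans _ _ (\int[mu \x lebesgue_Rn R n]_p
      G (enorm xi * p.1, p.1 ^+ 2 + dotR p.2 p.2)%R)%E).
    apply: ge0_le_integral => //.
    - exact: measurableT_comp.
    - move=> p _; rewrite /Fp /F /G/= lee_fin normrM [X in _ * X]ger0_norm ?ler0n//.
      by rewrite ler_piMl ?ler0n// cos_max.
  rewrite -(integral_dotR xi mG).
  by rewrite integral_sqnorm_le ltry.
transitivity (fine (\int[lebesgue_Rn R n.+1]_x F (dotR x xi, dotR x x))%E).
  congr fine; rewrite [LHS]integral_mkcond; apply: eq_integral => x _.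
  rewrite patchE in_cball /F/= /wave.
  by case: (dotR x x <= s)%R; rewrite ?mulr1// mulr0.
rewrite (integral_dotR xi mF) -(integral12_prod_meas1 iFp).
rewrite -[RHS]/(fine (_%:E)); congr fine.
transitivity (\int[mu]_(a in `[(- Num.sqrt s)%R, Num.sqrt s])
    ((unit_ball_volume R n)%:E *
      (cos (k * a) * Num.sqrt (Num.sqrt s ^+ 2 - a ^+ 2) ^+ n)%R%:E))%E; last first.
  rewrite integralZl//; last first.
    by apply: continuous_integrable_itv; exact: continuous_ball_cos.
  by rewrite integral_ball_cos ?sqrtr_ge0// -EFinM mulrA.
rewrite [RHS]integral_mkcond; apply: eq_integral => a _.
rewrite /fubini_F /Fp /F/=.
transitivity ((cos (k * a))%:E *
    \int[lebesgue_Rn R n]_x ((dotR x x <= s - a ^+ 2)%R%:R)%:E)%E.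
  rewrite -integralZl//; last first.
    apply/integrableP; split.
      apply/measurable_EFinP.
      exact: (measurableT_comp (@measurable_sqnorm_le R n) (pair1_measurable (s - a ^+ 2))).
    under eq_integral do rewrite gee0_abs ?lee_fin ?ler0n//.
    by rewrite integral_sqnorm_le ltry.
  by apply: eq_integral => x _; rewrite -EFinM lerBrDl /k !mulrA.
rewrite integral_sqnorm_le patchE mem_setE in_itv/= -ler_norml sqr_sqrtr//.
rewrite -(@ler_sqr _ `|a|) ?nnegrE ?sqrtr_ge0// sqr_sqrtr// real_normK ?num_real//.
rewrite subr_ge0; case: ifPn => _; last by rewrite mul0r mule0.
by rewrite mul1r -!EFinM; congr EFin; ring.
Qed.

End fourier_ball.

(** * The identity on an annulus *)

Section dimension_shift_identity.
Variable R : realType.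
Notation mu := (@lebesgue_measure R).
Notation M := (measurableTypeR R).

Lemma annulusE n (e r : R) (x : Rn R n) : 0 <= e -> 0 <= r ->
  (x \in annulus e r) = (e ^+ 2 <= dotR x x <= r ^+ 2).
Proof.
move=> e0 r0; rewrite -sqr_enorm !ler_sqr ?nnegrE ?enorm_ge0//.
by apply/idP/idP; rewrite inE.
Qed.

Lemma enorm_ray n (r : R) :
  enorm (Rn_cons (r, [tuple of nseq n (0 : R)] : Rn R n)) = `|r|.
Proof.
have e0 : enorm ([tuple of nseq n (0 : R)] : Rn R n) = 0.
  rewrite /enorm /dotR big1 ?sqrtr0// => i _.
  by rewrite (tnth_nth 0)/= nth_nseq ltn_ord mulr0.
by rewrite enorm_cons e0 expr0n addr0 sqrtr_sqr.
Qed.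

(** The profile is the radial function composed with the measurable ray s |-> (sqrt s, 0, ...,
    0). *)
Lemma measurable_radial_profile n (g : R -> R) (e r : R) : 0 < e -> 0 <= r ->
  measurable_fun (@annulus R n.+1 e r) (fun x => g (enorm x)) ->
  measurable_fun (`[(e ^+ 2), (r ^+ 2)] : set M) (fun s : M => g (Num.sqrt s)).
Proof.
move=> e0 r0 mg.
pose j (s : M) : Rn R n.+1 := Rn_cons (Num.sqrt s, [tuple of nseq n (0 : R)]).
have mj : measurable_fun setT j.
  apply: (measurableT_comp (@measurable_Rn_cons R n)).
  apply/measurable_fun_pair => //=.
  by apply: continuous_measurable_fun; exact: sqrt_continuous.
have -> : (fun s : M => g (Num.sqrt s)) = (fun x => g (enorm x)) \o j.
  by apply/funext => s /=; rewrite enorm_ray ger0_norm ?sqrtr_ge0.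
have ma := @measurable_annulus R n.+1 e r.
apply: (measurable_comp ma _ mg); last exact: measurable_funTS.
move=> _ [s /= + <-]; rewrite in_itv/= => /andP[es sr].
rewrite /annulus/= enorm_ray ger0_norm ?sqrtr_ge0//.
have s0 : 0 <= s by rewrite (le_trans _ es)// sqr_ge0.
by rewrite -ler_sqr ?nnegrE ?sqrtr_ge0 ?(ltW e0)// sqr_sqrtr// es -ler_sqr ?nnegrE ?sqrtr_ge0// sqr_sqrtr.
Qed.

(** The derivative of the square root, 1 / (2 sqrt s), cancels the factor r in f' = r g. *)
Lemma is_derive_sqrt_profile (f g : R -> R) :
  (forall r : R, 0 < r -> is_derive r (1 : R) f (r * g r)) ->
  forall s : R, 0 < s -> is_derive s (1 : R) (f \o Num.sqrt) (g (Num.sqrt s) / 2).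
Proof.
move=> df s s0; have q0 : 0 < Num.sqrt s by rewrite sqrtr_gt0.
have h := is_derive1_comp (df _ q0) (is_derive1_sqrt s0).
apply: is_derive_eq h _; field.
by rewrite gt_eqF.
Qed.

Section identity.
Variables (n : nat) (xi : Rn R n.+1) (eta : Rn R n.+3).
Variables (f g : R -> R) (e r : R).
Hypotheses (e0 : 0 < e) (er : e <= r) (etaxi : enorm eta = enorm xi).
Hypothesis df : forall s : R, 0 < s -> is_derive s (1 : R) f (s * g s).
Hypothesis ig : (lebesgue_Rn R n.+3).-integrable (@annulus R n.+3 e r)
  (fun z => (g (enorm z))%:E).

Let r0 : 0 < r := lt_le_trans e0 er.
Let A := e ^+ 2.
Let B := r ^+ 2.
Let A0 : 0 < A. Proof. by rewrite exprn_gt0. Qed.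
Let B0 : 0 < B. Proof. by rewrite exprn_gt0. Qed.
Let AB : A <= B.
Proof. by rewrite ler_sqr ?nnegrE ?(ltW e0) ?(ltW r0). Qed.

Let phi := f \o Num.sqrt.
Let gam (s : R) := g (Num.sqrt s).
Let gc : M -> R := gam \_ `[A, B].

Let mgc : measurable_fun setT gc.
Proof.
have mAB : measurable (`[A, B]%classic : set M) by exact: measurable_itv.
apply: ((measurable_restrictT _ mAB).1 _).
apply: (@measurable_radial_profile n.+2 g e r e0 (ltW r0)).
by apply/measurable_EFinP; exact: measurable_int ig.
Qed.

Let gcE (s : M) : gc s = if A <= s <= B then gam s else 0.
Proof. by rewrite /gc patchE mem_setE in_itv. Qed.

Let gc_annulus (z : Rn R n.+3) :
  gc (dotR z z) = ((fun z => g (enorm z)) \_ (annulus e r)) z.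
Proof.
rewrite /gc !patchE annulusE ?(ltW e0) ?(ltW r0)//.
by congr (if _ then _ else _); apply/idP/idP; rewrite inE/= in_itv.
Qed.

Let F (p : M * M) : \bar R := (gc p.2 * cos (2 * pi * p.1))%:E.

Let mcos : measurable_fun [set: M * M] (fun p : M * M => cos (2 * pi * p.1)).
Proof.
apply: (measurableT_comp (f := @cos R)); last exact: measurable_funM.
by apply: continuous_measurable_fun; exact: continuous_cos.
Qed.

Let mF : measurable_fun setT F.
Proof.
apply/measurable_EFinP; apply: measurable_funM => //.
exact: (measurableT_comp mgc measurable_snd).
Qed.

(** [F] without the cosine, whose zeros would hide the size of [gc]. It dominates [F] and yields the
    integrability of [gam]. *)
Let F1 (p : M * M) : \bar R := (gc p.2)%:E.

Let mF1 : measurable_fun setT F1.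
Proof. by apply/measurable_EFinP; exact: (measurableT_comp mgc measurable_snd). Qed.

Let iF1z : (lebesgue_Rn R n.+3).-integrable setT (fun z => F1 (dotR z eta, dotR z z)).
Proof.
have := (integrable_mkcond _ (@measurable_annulus R n.+3 e r)).1 ig.
apply: eq_integrable => // z _; rewrite /F1/= gc_annulus !patchE.
by case: ifP.
Qed.

Let iFz : (lebesgue_Rn R n.+3).-integrable setT (fun z => F (dotR z eta, dotR z z)).
Proof.
apply: le_integrable iF1z => //.
  exact: (measurableT_comp mF (measurable_fun_dotR2 eta)).
by move=> z _; rewrite /F /F1/= lee_fin normrM ler_piMr// cos_max.
Qed.

Let iK := integrable_RnSS mF etaxi iFz.
Let iK1 := integrable_RnSS mF1 etaxi iF1z.

(** Above the paraboloid, the fibre over s is a ball of squared radius s >= A, so its volume is at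
    least c > 0. The finite integral over the product thus bounds c times the integral of |gc|. *)
Let igam : mu.-integrable `[A, B] (EFin \o gam).
Proof.
have mAB : measurable (`[A, B]%classic : set M) by exact: measurable_itv.
apply: ((integrable_mkcond _ mAB).2 _).
rewrite restrict_EFin -/gc.
pose c : R := unit_ball_volume R n.+1 * Num.sqrt A ^+ n.+1.
have c0 : 0 < c by rewrite mulr_gt0 ?unit_ball_volume_gt0// exprn_gt0// sqrtr_gt0.
have mabs : measurable_fun setT (fun s => `|gc s|%:E).
  by apply/measurable_EFinP; exact: measurableT_comp.
apply/integrableP; split; first exact/measurable_EFinP.
have mA1 := measurable_above_paraboloid xi mF1.
have h := (@integrable21ltyP _ _ _ _ R (lebesgue_Rn R n.+1) mu _ mA1).1 iK1.
rewrite -(@lte_pmul2l _ c%:E)// gt0_muley ?lte_fin//.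
apply: le_lt_trans h.
rewrite -ge0_integralZl//; last by rewrite lee_fin ltW.
apply: ge0_le_integral => //.
- by move=> s _; rewrite mule_ge0// lee_fin ltW.
- exact: measurable_funeM.
- apply: (measurable_fun_fubini_tonelli_G (m1 := lebesgue_Rn R n.+1)
    (abse \o above_paraboloid xi F1)).
    exact: measurableT_comp.
  by move=> p; exact: abse_ge0.
move=> s _; have [/andP[As sB]|sAB] := boolP (A <= s <= B); last first.
  rewrite [(EFin \o gc) s]/= gcE (negbTE sAB) abse0 mule0.
  by apply: integral_ge0 => x _; exact: abse_ge0.
have s0 : 0 <= s by rewrite (le_trans _ As)// ltW.
under eq_integral => x _ do rewrite above_paraboloid_abse /above_paraboloid/=.
rewrite ge0_integralZl//; last first.
  apply/measurable_EFinP.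
  exact: (measurableT_comp (@measurable_sqnorm_le R n.+1) (pair1_measurable s)).
rewrite integral_sqnorm_le s0 mul1r muleC lee_wpmul2l// lee_fin.
rewrite /c ler_wpM2l ?(ltW (unit_ball_volume_gt0 _ _))//.
by rewrite lerXn2r ?nnegrE ?sqrtr_ge0// ler_wsqrtr.
Qed.

(** At fixed x, s runs up to B from the paraboloid or from the inner sphere, whichever is higher:
    hence the maximum. The factor 2 appears because [gam] is twice the derivative of [phi]. *)
Let inner (x : Rn R n.+1) : R := wave xi x * (dotR x x <= B)%R%:R *
  (2 * (phi B - phi (Num.max (dotR x x) A))).

Let innerE x : fubini_F mu (above_paraboloid xi F) x = (inner x)%:E.
Proof.
rewrite /fubini_F /inner; set q := dotR x x.
have [qB|Bq] := leP q B; last first.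
  rewrite mulr0 mul0r; apply: integral0_eq => s _; rewrite /above_paraboloid/= -/q.
  have [qs|] := boolP (q <= s)%R; last by rewrite mule0.
  by rewrite mule1 /F/= gcE [s <= B]leNgt (lt_le_trans Bq qs) andbF mul0r.
pose q' := Num.max q A.
have q'B : q' <= B by rewrite ge_max qB.
have Aq' : A <= q' by rewrite le_max lexx orbT.
have sub : `[q', B] `<=` `[A, B] by apply: subset_itvr; rewrite bnd_simp.
have igq : mu.-integrable `[q', B] (EFin \o gam) by exact: integrableS igam.
have mqB : measurable (`[q', B]%classic : set M) by exact: measurable_itv.
have igq2 : mu.-integrable `[q', B] (EFin \o (fun s => gam s / 2)).
  have := integrableZl mqB 2^-1 igq.
  by apply: eq_integrable => // s _ /=; rewrite mulrC.
have ftc : \int[mu]_(s in `[q', B]) (gam s / 2) = phi B - phi q'.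
  apply: derivable_everywhere_FTC => // s /andP[q's _].
  by apply: is_derive_sqrt_profile => //; apply: lt_le_trans A0 _; exact: le_trans q's.
transitivity (\int[mu]_(s in `[q', B]) ((2 * wave xi x)%:E * (gam s / 2)%:E))%E.
  rewrite [RHS]integral_mkcond; apply: eq_integral => s _.
  rewrite /above_paraboloid patchE /F/= gcE -/q mem_setE in_itv/= ge_max.
  case: (leP q s) => qs; case: (leP A s) => As; case: (leP s B) => sB //=;
    rewrite ?mul0r ?mule0 ?mule1//.
  by rewrite -EFinM /wave; congr EFin; field.
rewrite integralZl// -(fineK (integrable_fin_num mqB igq2)).
rewrite -[fine _]/(\int[mu]_(s in `[q', B]) (gam s / 2)) ftc -EFinM -/q'.
by congr EFin; rewrite [true%:R]/(1 : R) mulr1 -mulrA mulrCA.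
Qed.

Let iinner : (lebesgue_Rn R n.+1).-integrable setT (EFin \o inner).
Proof.
by have := integrable_fubini_F iK; apply: eq_integrable => // x _; exact: innerE.
Qed.

(** The upper limit contributes the constant f r on the whole closed ball. The lower one contributes
    f (|x|) on the annulus and the constant f e on the open ball inside it. The factor is pi from
    the plane times 2 from [inner]. *)
Lemma integral_wave_dimension_shift :
  \int[lebesgue_Rn R n.+3]_(z in annulus e r) (g (enorm z) * wave eta z) =
  2 * pi * (f r * fball xi (r ^+ 2) - f e * foball xi (e ^+ 2) -
    \int[lebesgue_Rn R n.+1]_(x in annulus e r) (f (enorm x) * wave xi x)).
Proof.
have K : \int[lebesgue_Rn R n.+3]_(z in annulus e r) (g (enorm z) * wave eta z) =
    pi * \int[lebesgue_Rn R n.+1]_x inner x.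
  transitivity (fine (\int[lebesgue_Rn R n.+3]_z F (dotR z eta, dotR z z))%E).
    congr fine; rewrite [LHS]integral_mkcond; apply: eq_integral => z _.
    rewrite /F/= gc_annulus !patchE.
    by case: ifP => _; rewrite // mul0r.
  rewrite (integral_RnSS mF etaxi iFz) -(integral12_prod_meas1 iK).
  rewrite (_ : (\int[_]_x _)%E = (\int[lebesgue_Rn R n.+1]_x (inner x)%:E)%E); last first.
    by apply: eq_integral => x _; exact: innerE.
  by rewrite fineM//; exact: integrable_fin_num.
pose c x := wave xi x * (dotR x x <= B)%R%:R.
have mcb := @measurable_cball R n.+1 B.
have iw : (lebesgue_Rn R n.+1).-integrable (cball B) (EFin \o wave xi).
  exact: (@integrable_wave _ _ xi _ B).
have cE : c = wave xi \_ (cball B).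
  apply/funext => x; rewrite patchE in_cball /c.
  by case: (_ <= _); rewrite ?mulr1// mulr0.
have ic : (lebesgue_Rn R n.+1).-integrable setT (EFin \o c).
  by rewrite cE -restrict_EFin; exact: ((integrable_mkcond _ mcb).1 iw).
have Rc : \int[lebesgue_Rn R n.+1]_x c x = fball xi B.
  by rewrite cE -Rintegral_mkcond.
(* [J] isolates the lower limits. It is integrable as a difference of integrable functions, which
   lets its integral be split over the annulus and the open ball; comparing with the difference
   itself gives the identity. *)
pose J x := phi B * c x - 2^-1 * inner x.
have JE x : J x = c x * phi (Num.max (dotR x x) A).
  by rewrite /J /inner /c; field.
have i1 : (lebesgue_Rn R n.+1).-integrable setT (fun x => (phi B * c x)%:E).
  by have := integrableZl measurableT (phi B) ic; apply: eq_integrable.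
have i2 : (lebesgue_Rn R n.+1).-integrable setT (fun x => (2^-1 * inner x)%:E).
  by have := integrableZl measurableT 2^-1 iinner; apply: eq_integrable.
have iJ : (lebesgue_Rn R n.+1).-integrable setT (EFin \o J).
  by have := integrableB measurableT i1 i2; apply: eq_integrable.
have RJ : \int[lebesgue_Rn R n.+1]_x J x =
    f r * fball xi B - 2^-1 * \int[lebesgue_Rn R n.+1]_x inner x.
  rewrite RintegralB// !RintegralZl// Rc.
  by rewrite /phi/= /B sqrtr_sqr gtr0_norm.
have mo := @measurable_oball R n.+1 A.
have ma := @measurable_annulus R n.+1 e r.
have in_a x : (x \in annulus e r) = (A <= dotR x x <= B) by apply: annulusE; exact: ltW.
have split_cball : cball B = annulus e r `|` @oball R n.+1 A.
  apply/seteqP; split => x.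
    rewrite /cball/= => xB; case: (leP A (dotR x x)) => Ax; last by right.
    by left; apply/set_mem; rewrite in_a Ax.
  move=> [xa|]; first by have := mem_set xa; rewrite in_a => /andP[].
  by rewrite /oball /cball/= => /ltW /le_trans; apply.
have RJ2 : \int[lebesgue_Rn R n.+1]_x J x =
    \int[lebesgue_Rn R n.+1]_(x in annulus e r) (f (enorm x) * wave xi x) +
    f e * foball xi A.
  transitivity (\int[lebesgue_Rn R n.+1]_(x in cball B) J x).
    rewrite [RHS]Rintegral_mkcond; apply: eq_Rintegral => x _.
    rewrite patchE in_cball JE /c; case: (dotR x x <= B) => //.
    by rewrite mulr0 mul0r.
  rewrite split_cball Rintegral_setU//; last 2 first.
  - by apply: integrableS iJ => //; exact: measurableU.
  - apply/disj_setPS => x [xa]; rewrite /oball/=.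
    by have := mem_set xa; rewrite in_a => /andP[Ax _]; rewrite ltNge Ax.
  congr (_ + _).
    apply: eq_Rintegral => x; rewrite in_a => /andP[Ax xB].
    by rewrite JE /c xB mulr1 max_l// mulrC.
  rewrite /foball -RintegralZl//; last exact: integrable_wave (@oball_sub_cball _ _ _).
  apply: eq_Rintegral => x; rewrite inE /oball/= => xA.
  rewrite JE /c (le_trans (ltW xA) AB) mulr1 max_r ?ltW//.
  by rewrite mulrC /phi/= /A sqrtr_sqr gtr0_norm.
rewrite K; move: RJ; rewrite RJ2 -/A -/B.
set S := \int[_]_x inner x; set T := \int[_]_(x in _) _.
move=> RJ; have -> : S = 2 * (f r * fball xi B - f e * foball xi A - T) by lra.
by ring.
Qed.

End identity.
End dimension_shift_identity.

(** * Radial integrals with the weight of the squared norm *)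

Section weighted_radial.
Variable R : realType.
Notation mu := (@lebesgue_measure R).
Notation M := (measurableTypeR R).

Lemma integral_sqr_itv (t : R) : 0 <= t ->
  (\int[mu]_(a in `[(- Num.sqrt t)%R, Num.sqrt t]) (a ^+ 2)%:E)%E =
  (2 / 3 * Num.sqrt t ^+ 3)%:E.
Proof.
move=> t0; have csq : continuous (fun a : R => a ^+ 2) by exact: exprn_continuous.
have [->|t1] := eqVneq t 0.
  by rewrite sqrtr0 oppr0 set_itv1 integral_set1 expr0n mulr0.
have st : - Num.sqrt t < Num.sqrt t by rewrite gtrN// sqrtr_gt0 lt_neqAle eq_sym t1.
have dF (a : R) : is_derive a 1 (3^-1 \*: (fun x : R => x ^+ 3)) (a ^+ 2).
  have -> : (fun x : R => x ^+ 3) = ((@id R) ^+ 3) by rewrite exprfctE.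
  apply: is_derive_eq (is_deriveZ 3^-1 (is_deriveX 3 (is_derive_id a 1))) _.
  rewrite /= -[(3^-1 *: _)]/(3^-1 * (3%:R * a ^+ 2 * 1)); by field.
have iS := continuous_integrable_itv (- Num.sqrt t) (Num.sqrt t) csq.
have mI : measurable (`[- Num.sqrt t, Num.sqrt t]%classic : set M) by exact: measurable_itv.
rewrite -(fineK (integrable_fin_num mI iS)).
have := continuous_Rintegral_FTC st csq dF; rewrite /Rintegral => ->.
by congr EFin; rewrite /= -![(3^-1 *: _)]/(3^-1 * _); field.
Qed.

Local Open Scope ereal_scope.

(** The case of the line and R^3. The weight a^2 is realized as area under a parabola, so that only
    distribution functions are compared: both equal (2/3) t^(3/2), which is (4 pi / 3) t^(3/2)
    divided by 2 pi. *)
Lemma ge0_integral_sqr_weight (H : M -> \bar R) : measurable_fun setT H ->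
  (forall t, 0 <= H t) ->
  \int[mu]_a ((a ^+ 2)%:E * H (a ^+ 2)%R) =
  ((2 * pi)^-1)%:E * \int[lebesgue_Rn R 3]_z H (dotR z z).
Proof.
move=> mH H0; have mq := @measurable_sqnorm R 3.
have pi2 : (0 <= (2 * pi)^-1 :> R)%R by rewrite invr_ge0 mulr_ge0// pi_ge0.
pose m2 : {measure set (Rn R 3) -> \bar R} := mscale (NngNum pi2) (lebesgue_Rn R 3).
pose P : {measure set (M * M) -> \bar R} := (mu \x mu).
pose D (p : M * M) : bool := ((0 <= p.2) && (p.2 < p.1 ^+ 2))%R.
(* The value -1 sends the complement of [D] off the half-line on which [ge0_integral_eq_cdf]
   compares the two sides. *)
pose q (p : M * M) : M := if D p then (p.1 ^+ 2)%R else (-1)%R.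
have inD p : (p \in [set p | D p]) = D p by apply/idP/idP; rewrite inE.
have msq : measurable_fun setT (fun p : M * M => (p.1 ^+ 2)%R : M).
  exact: measurable_funX.
have mD : measurable_fun setT D.
  apply: measurable_and; first exact: measurable_fun_ler.
  exact: measurable_fun_ltr.
have mq1 : measurable_fun setT q by exact: measurable_fun_ifT.
have qE (E : set M) : ~ E (-1)%R -> q @^-1` E = [set p | D p /\ E (p.1 ^+ 2)%R].
  move=> E1; apply/seteqP; split => p; rewrite /preimage/= /q.
    by case: ifP.
  by move=> [->].
(* [p.1 ^+ 2] is the length of the fibre of [D] over [p.1]. *)
have fib (K : M -> \bar R) : measurable_fun setT K -> (forall t, 0 <= K t) ->
    \int[P]_(p in [set p | D p]) K p.1 = \int[mu]_a ((a ^+ 2)%:E * K a).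
  move=> mK K0.
  have mDs : measurable [set p | D p].
    by rewrite -[X in measurable X]setTI; exact: (mD measurableT [set true]).
  pose f (p : M * M) : \bar R := K p.1 * ((D p)%:R)%:E.
  have mf : measurable_fun setT f.
    apply: emeasurable_funM; first exact: (measurableT_comp mK measurable_fst).
    apply/measurable_EFinP.
    rewrite (_ : (fun p => (D p)%:R) = \1_[set p | D p]); first exact: measurable_indic.
    by apply/funext => p; rewrite indicE mem_setE.
  have f0 p : 0 <= f p by rewrite mule_ge0// lee_fin ler0n.
  transitivity (\int[mu]_a \int[mu]_t f (a, t)); last first.
    apply: eq_integral => a _; rewrite /f/=.
    have mDa : measurable_fun setT (fun t : M => ((D (a, t))%:R)%:E : \bar R).
      apply/measurable_EFinP; rewrite (_ : (fun t => _) = \1_[set p | D p] \o pair a).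
        by apply: measurableT_comp; [exact: measurable_indic|exact: pair1_measurable].
      by apply/funext => t; rewrite /= indicE mem_setE.
    rewrite ge0_integralZl//.
    rewrite muleC; congr (_ * _).
    transitivity (mu `[0%R, (a ^+ 2)%R[%classic).
      rewrite -[X in mu X]setIT -integral_indic//.
      by apply: eq_integral => t _; rewrite indicE mem_setE in_itv.
    rewrite lebesgue_measure_itv/= lte_fin; case: ltP => a0.
      by rewrite -EFinB subr0.
    by congr EFin; apply/le_anti; rewrite sqr_ge0 a0.
  rewrite -(fubini_tonelli1 (m1 := mu) (m2 := mu) _ mf f0) integral_mkcond.
  apply: eq_integral => p _; rewrite patchE inD /f.
  by case: (D p); rewrite ?mule1// mule0.
have mT : measurable_fun setT (fun a : M => H (a ^+ 2)%R).
  by apply: (measurableT_comp mH); exact: measurable_funX.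
rewrite -(fib _ mT (fun a => H0 _)).
have m0y : ~ `[0%R, +oo[%classic (-1 : R)%R by rewrite /= in_itv/= lerNr oppr0 lt_geF.
have q0y : q @^-1` `[0%R, +oo[ = [set p | D p].
  by rewrite qE//; apply/seteqP; split => p /= => [[]//|Dp]; rewrite in_itv/= sqr_ge0.
have v1 (t : R) : (0 <= t)%R ->
    P (q @^-1` `[0%R, t]) = (2 / 3 * Num.sqrt t ^+ 3)%:E.
  move=> t0; pose K (a : M) : \bar R := ((a ^+ 2 <= t)%R%:R)%:E.
  have mK : measurable_fun setT K.
    by apply/measurable_EFinP; apply: measurable_le_indicator => //; exact: measurable_funX.
  have K0 a : 0 <= K a by rewrite lee_fin ler0n.
  have mqt : measurable (q @^-1` `[0%R, t]).
    by rewrite -[X in measurable X]setTI; apply: (mq1 measurableT); exact: measurable_itv.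
  transitivity (\int[P]_(p in [set p | D p]) K p.1).
    rewrite -[X in P X]setIT -(integral_indic P measurableT mqt) [RHS]integral_mkcond.
    apply: eq_integral => p _; rewrite patchE inD indicE /K.
    have -> : (p \in q @^-1` `[0%R, t]) = D p && (p.1 ^+ 2 <= t)%R.
      apply/idP/idP; rewrite inE /preimage/= /q in_itv/=.
        case: (D p) => [/andP[_ ->]//|/andP[h _]].
        by move: h; rewrite lerNr oppr0 lt_geF.
      by move=> /andP[-> ->]; rewrite sqr_ge0.
    by case: (D p).
  rewrite (fib K mK K0).
  transitivity (\int[mu]_(a in `[(- Num.sqrt t)%R, Num.sqrt t]) (a ^+ 2)%:E).
    rewrite [RHS]integral_mkcond; apply: eq_integral => a _.
    rewrite patchE mem_setE in_itv/= -ler_norml -ler_sqr ?nnegrE ?sqrtr_ge0//.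
    rewrite sqr_sqrtr// real_normK ?num_real// /K.
    by case: (_ <= t)%R; rewrite ?mule1// mule0.
  by rewrite integral_sqr_itv.
have v2 (t : R) : (0 <= t)%R ->
    m2 ((fun x : Rn R 3 => dotR x x : M) @^-1` `[0%R, t]) = (2 / 3 * Num.sqrt t ^+ 3)%:E.
  move=> t0; rewrite preimage_sqnorm_itv /m2/= /mscale/=.
  have -> := lebesgue_Rn_cball 3 t0.
  rewrite -EFinM; congr EFin.
  have h : unit_ball_volume R 3 = (4 * pi / 3)%R.
    apply: (mulfI (x := 3)) => //; rewrite (unit_ball_volumeSS R 1) /= besselI1_0.
    by field.
  set s3 := (Num.sqrt t ^+ 3)%R; rewrite -[LHS]/((2 * pi)^-1 * (unit_ball_volume R 3 * s3))%R h.
  by move: (pi : R) (pi_gt0 R) => p p0; field; exact: lt0r_neq0.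
have := @ge0_integral_eq_cdf _ _ _ _ _ P m2 _ _ H mq1 mq.
rewrite q0y preimage_sqnorm_ge0 => h.
transitivity (\int[P]_(x in [set p | D p]) H (q x)).
  by apply: eq_integral => p; rewrite inE/= /q => ->.
rewrite h//.
- by rewrite ge0_integral_mscale//; exact: measurableT_comp.
- by move=> t t0; exact: (etrans (v1 t t0) (esym (v2 t t0))).
- by move=> t t0; apply: (le_lt_trans _ (ltry (2 / 3 * Num.sqrt t ^+ 3)%R)); rewrite -(v1 t t0).
Qed.

(** When the integrand ignores the phase, integrating in x first leaves, over each s, the volume of
    the ball of R^n of squared radius s. *)
Lemma ge0_integral_sqnorm n (G : M -> \bar R) : measurable_fun setT G ->
  (forall t, 0 <= G t) ->
  \int[lebesgue_Rn R n.+2]_z G (dotR z z) =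
  pi%:E * \int[mu]_s (G s *
    ((0 <= s)%R%:R * (unit_ball_volume R n * Num.sqrt s ^+ n))%:E).
Proof.
move=> mG G0; pose F (p : M * M) := G p.2.
have mF : measurable_fun setT F by exact: (measurableT_comp mG measurable_snd).
have F0 p : 0 <= F p by exact: G0.
pose xi : Rn R n := [tuple of nseq n (0%R : R)].
rewrite (ge0_integral_RnSS0 xi mF F0); congr (_ * _).
have mA := measurable_above_paraboloid xi mF.
rewrite (fubini_tonelli (m1 := lebesgue_Rn R n) (m2 := mu) _ mA
  (above_paraboloid_ge0 xi F0)).
apply: eq_integral => s _; rewrite /above_paraboloid /F/= -integral_sqnorm_le.
apply: ge0_integralZl.
- exact: measurableT.
- apply/measurable_EFinP.
  exact: (measurableT_comp (@measurable_sqnorm_le R n) (pair1_measurable s)).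
- by move=> x _; rewrite lee_fin ler0n.
- exact: G0.
Qed.

(** In the variable s both sides are integrals over the half-line, whose densities match by
    [unit_ball_volumeSS]. On the line there is no plane to split off, and the claim is
    [ge0_integral_sqr_weight]. *)
Lemma ge0_integral_radial_weight n (H : M -> \bar R) : measurable_fun setT H ->
  (forall t, 0 <= H t) ->
  \int[lebesgue_Rn R n.+1]_x ((dotR x x)%:E * H (dotR x x)) =
  (n.+1%:R / (2 * pi))%:E * \int[lebesgue_Rn R n.+3]_z H (dotR z z).
Proof.
move=> mH H0; have mq := @measurable_sqnorm R n.+1.
case: n mq => [|n] mq.
  rewrite ge0_integral_Rn1.
  - rewrite mul1r -ge0_integral_sqr_weight//; apply: eq_integral => a _.
    rewrite dotR_cons (_ : dotR [tuple] [tuple] = 0%R) ?addr0//.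
    by rewrite /dotR big_ord0.
  - by apply: emeasurable_funM; [exact/measurable_EFinP|exact: (measurableT_comp mH)].
  - by move=> x; rewrite mule_ge0// lee_fin dotR_ge0.
pose G (s : M) : \bar R := `|s|%:E * H s.
have mG : measurable_fun setT G.
  by apply: emeasurable_funM => //; apply/measurable_EFinP; exact: normr_measurable.
have G0 s : 0 <= G s by rewrite mule_ge0// lee_fin normr_ge0.
transitivity (\int[lebesgue_Rn R n.+2]_x G (dotR x x)).
  by apply: eq_integral => x _; rewrite /G ger0_norm ?dotR_ge0.
rewrite (ge0_integral_sqnorm n mG G0) (ge0_integral_sqnorm n.+2 mH H0).
have k0 : (0 <= n.+2%:R / (2 * pi) :> R)%R by rewrite divr_ge0// mulr_ge0// pi_ge0.
rewrite muleCA; congr (_ * _).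
rewrite -ge0_integralZl//.
- apply: eq_integral => s _; rewrite /G.
  have [s0|s0] := leP 0%R s; last by rewrite !mul0r !mule0.
  rewrite (ger0_norm s0) !mul1r muleAC muleCA -!EFinM muleC; congr (_ * _%:E).
  rewrite -{1}(sqr_sqrtr s0); set t := Num.sqrt s.
  have := unit_ball_volumeSS R n; move: (pi : R) (pi_gt0 R) => p p0 e.
  have {}e : unit_ball_volume R n = (n.+2%:R / (2 * p) * unit_ball_volume R n.+2)%R.
    by rewrite mulrAC e; field; exact: lt0r_neq0.
  move: (_ / _)%R (unit_ball_volume _ n) (unit_ball_volume _ n.+2) e => c b b2 ->.
  by rewrite (exprD t 2 n); ring.
- apply: emeasurable_funM => //; apply/measurable_EFinP.
  apply: measurable_funM; first exact: measurable_le_indicator.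
  apply: measurable_funM => //; apply: measurable_funX.
  by apply: continuous_measurable_fun; exact: sqrt_continuous.
- move=> s _; apply: mule_ge0 => //; rewrite lee_fin; apply: mulr_ge0; first exact: ler0n.
  by apply: mulr_ge0; [exact/ltW/unit_ball_volume_gt0|exact/exprn_ge0/sqrtr_ge0].
Qed.

End weighted_radial.

(** * Areas of spheres *)

Section sphere.
Variable R : realType.

(** The cone over the unit sphere is the closed unit ball without its centre, and the centre is a
    null set in positive dimension. *)
Lemma sphere_areaE k : sphere_area R k.+1 = k.+1%:R * unit_ball_volume R k.+1.
Proof.
rewrite /sphere_area /surface_measure; set C := (X in lebesgue_Rn _ _ X).
have CE : C = cball 1 `\` [set x : Rn R k.+1 | enorm x = 0].
  apply/seteqP; split => x; rewrite /C /cball/= => -[x1 x2].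
    move: x1 => /andP[x0 x1]; split; last by apply/eqP; rewrite gt_eqF.
    by rewrite -sqr_enorm expr_le1// sqrtr_ge0.
  have x0 : 0 < enorm x by rewrite lt_neqAle sqrtr_ge0 andbT eq_sym; exact/eqP.
  split; first by rewrite x0 -(@expr_le1 _ 2)// ?sqrtr_ge0// sqr_enorm.
  rewrite {1}/enorm [X in Num.sqrt X](_ : _ = dotR x x / enorm x ^+ 2).
    by rewrite sqr_enorm divff ?sqrtr1// -sqr_enorm sqrf_eq0 gt_eqF.
  rewrite /dotR mulr_suml; apply: eq_bigr => i _; rewrite !tnth_mktuple expr2.
  by rewrite mulf_div.
have mC : measurable C.
  rewrite CE; apply: measurableD; first exact: measurable_cball.
  exact: measurable_enorm0.
have -> : lebesgue_Rn R k.+1 C = lebesgue_Rn R k.+1 (cball 1).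
  have -> : cball 1 = C `|` [set x : Rn R k.+1 | enorm x = 0].
    rewrite CE; apply/seteqP; split => x; rewrite /cball/=.
      by have [?|?] := pselect (enorm x = 0); [right|left].
    by move=> [[]//|x0]; rewrite -sqr_enorm x0 expr0n ler01.
  apply: esym; apply: measureU0 => //; first exact: measurable_enorm0.
  exact: lebesgue_Rn_enorm0.
have -> := lebesgue_Rn_cball k.+1 (@ler01 R).
by rewrite sqrtr1 expr1n mulr1.
Qed.

End sphere.
(** * The Fourier transform of radial functions *)

Section radial_limits.
Variable R : realType.
Notation M := (measurableTypeR R).

Lemma cvg0_dominated (F : set_system R) (FF : Filter F) (h k : R -> R) (c : R) :
  (\near F, `|h F| <= c * `|k F|) -> k @ F --> 0 -> h @ F --> 0.
Proof.
move=> hk k0; apply: norm_cvg0; apply: (@squeeze_cvgr _ _ _ _ (cst 0) (fun x => c * `|k x|)).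
- by near=> x; rewrite normr_ge0/=; near: x.
- exact: cvg_cst.
- rewrite -(mulr0 c); apply: cvgM; first exact: cvg_cst.
  by rewrite -(normr0 R); exact: cvg_norm.
Unshelve. all: end_near. Qed.

Lemma near_radii (P : R * R -> Prop) :
  (forall e r : R, 0 < e -> e <= r -> P (e, r)) ->
  \forall p \near ((0 : R)^'+, (+oo : set_system R)), P p.
Proof.
(* The two radii vary independently; separating them by 1 ensures e <= r. *)
move=> h; exists ([set e | 0 < e < 1], [set r | 1 <= r]) => /=.
  split; last by apply: nbhs_pinfty_ge; exact: num_real.
  by near=> e; apply/andP; split; near: e; [exact: nbhs_right_gt|exact: nbhs_right_lt].
move=> [e r]/= [/andP[e0 e1] r1]; apply: h => //; exact: le_trans (ltW e1) r1.
Unshelve. all: end_near. Qed.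

Section component.
Variables (n : nat) (xi : Rn R n.+1) (eta : Rn R n.+3) (f g : R -> R).
Hypotheses (xi0 : 0 < enorm xi) (etaxi : enorm eta = enorm xi).
Hypothesis f0 : f r * r ^+ n.+1 @[r --> 0^'+] --> 0.
Hypothesis foo : f r * r `^ (n%:R / 2) @[r --> +oo] --> 0.

Lemma cvg_foball : f e * foball xi (e ^+ 2) @[e --> 0^'+] --> 0.
Proof.
apply: (@cvg0_dominated _ _ _ _ (unit_ball_volume R n.+1) _ f0).
near=> e; have e0 : 0 < e by near: e; exact: nbhs_right_gt.
rewrite !normrM mulrCA ler_wpM2l ?normr_ge0//.
apply: le_trans (normr_foball_le xi (sqr_ge0 e)) _.
by rewrite sqrtr_sqr normrX.
Unshelve. all: end_near. Qed.

(** With k = 2 pi |xi| > 0, the transform is r^(n+1) I(k r) up to a constant, and I(k r) = O((k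
    r)^(-(n+2)/2)). This leaves r^(n/2), the weight in [foo]. Squares are compared to avoid
    half-integral powers. *)
Lemma cvg_fball : f r * fball xi (r ^+ 2) @[r --> +oo] --> 0.
Proof.
have [C [r0 [r00 decay]]] := besselI_decay R n.+1.
pose k : R := 2 * pi * enorm xi.
have k0 : 0 < k by rewrite !mulr_gt0// pi_gt0.
pose c := unit_ball_volume R n * Num.sqrt (C / k ^+ n.+2).
apply: (@cvg0_dominated _ _ _ _ c _ foo).
near=> r; have r1 : 0 < r by near: r; exact: nbhs_pinfty_gt.
have rk : r0 <= k * r.
  by rewrite mulrC -ler_pdivrMr//; near: r; exact: nbhs_pinfty_ge.
have V0 := unit_ball_volume_gt0 R n.
have p0 : 0 <= r `^ (n%:R / 2) by exact: powR_ge0.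
have C0 : 0 <= C.
  by apply: le_trans (decay _ rk); rewrite mulr_ge0 ?sqr_ge0// exprn_ge0// ltW// mulr_gt0.
rewrite /c !normrM mulrCA ler_wpM2l ?normr_ge0//.
rewrite fballE ?sqr_ge0// sqrtr_sqr (ger0_norm (ltW r1)) -/k.
rewrite -!mulrA normrM (gtr0_norm V0) ler_wpM2l ?(ltW V0)//.
rewrite (ger0_norm p0) -ler_sqr ?nnegrE ?normr_ge0//; last by rewrite mulr_ge0 ?sqrtr_ge0.
rewrite real_normK ?num_real// [leRHS]exprMn sqr_sqrtr; last first.
  by rewrite divr_ge0// exprn_ge0// ltW.
rewrite -(powR_mulrn 2 p0) -powRrM divfK// powR_mulrn ?(ltW r1)//.
rewrite mulrAC ler_pdivlMr ?exprn_gt0//.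
apply: le_trans (ler_wpM2r (exprn_ge0 n (ltW r1)) (decay _ rk)).
rewrite le_eqVlt; apply/orP; left; apply/eqP.
rewrite (_ : 2 * (pi * (enorm xi * r)) = k * r); last by rewrite /k !mulrA.
by move: (besselI _ _) => I; rewrite !exprMn !exprS; ring.
Unshelve. all: end_near. Qed.

Hypothesis df : forall s : R, 0 < s -> is_derive s (1 : R) f (s * g s).
Hypothesis ig : forall e r, 0 < e -> e <= r ->
  (lebesgue_Rn R n.+3).-integrable (@annulus R n.+3 e r) (fun z => (g (enorm z))%:E).
Variable L : R.
Hypothesis fL : \int[lebesgue_Rn R n.+1]_(x in annulus p.1 p.2) (f (enorm x) * wave xi x)
  @[p --> (0^'+, +oo)] --> L.

Lemma cvg_integral_wave_shift :
  \int[lebesgue_Rn R n.+3]_(z in annulus p.1 p.2) (g (enorm z) * wave eta z)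
    @[p --> (0^'+, +oo)] --> - (2 * pi) * L.
Proof.
pose b (r : R) := f r * fball xi (r ^+ 2).
pose a (e : R) := f e * foball xi (e ^+ 2).
pose T (p : R * R) := \int[lebesgue_Rn R n.+1]_(x in annulus p.1 p.2) (f (enorm x) * wave xi x).
have bc : b p.2 @[p --> ((0 : R)^'+, (+oo : set_system R))] --> 0.
  by apply: cvg_comp cvg_fball; exact: cvg_snd.
have ac : a p.1 @[p --> ((0 : R)^'+, (+oo : set_system R))] --> 0.
  by apply: cvg_comp cvg_foball; exact: cvg_fst.
have -> : - (2 * pi) * L = 2 * pi * (0 - 0 - L) by rewrite subrr sub0r mulrN mulNr.
apply: (@cvg_trans _ (2 * pi * (b p.2 - a p.1 - T p) @[p --> ((0 : R)^'+, (+oo : set_system R))])).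
  apply: near_eq_cvg.
  apply: near_radii => e r e0 er.
  by rewrite (integral_wave_dimension_shift e0 er etaxi df (ig e0 er)).
exact: (cvgM (cvg_cst (2 * pi)) (cvgB (cvgB bc ac) fL)).
Qed.

End component.

End radial_limits.

(** * Reduction to real cosine integrals *)

Section radial_fourier.
Variable R : realType.
Notation M := (measurableTypeR R).

(** Replacing [xi] by its opposite keeps the norm, hence the integral, but changes the sign of the
    sine. *)
Lemma integral_radial_sin n (xi : Rn R n.+1) (g : R -> R) (e r : R) :
  0 < e -> e <= r ->
  (lebesgue_Rn R n.+1).-integrable (@annulus R n.+1 e r) (fun x => (g (enorm x))%:E) ->
  \int[lebesgue_Rn R n.+1]_(x in annulus e r)
    (g (enorm x) * sin (2 * pi * dotR x xi)) = 0.
Proof.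
move=> e0 er ig; have r0 := ltW (lt_le_trans e0 er).
pose gc : M -> R := (fun s => g (Num.sqrt s)) \_ `[(e ^+ 2), (r ^+ 2)].
have mI : measurable (`[(e ^+ 2), (r ^+ 2)]%classic : set M) by exact: measurable_itv.
have mgc : measurable_fun setT gc.
  apply: ((measurable_restrictT _ mI).1 _).
  apply: (@measurable_radial_profile R n g e r e0 r0).
  by apply/measurable_EFinP; exact: measurable_int ig.
pose F (p : M * M) : \bar R := (gc p.2 * sin (2 * pi * p.1))%:E.
have msin : measurable_fun setT (fun p : M * M => sin (2 * pi * p.1)).
  apply: (measurableT_comp (f := @sin R)); last exact: measurable_funM.
  by apply: continuous_measurable_fun; exact: continuous_sin.
have mF : measurable_fun setT F.
  apply/measurable_EFinP; apply: measurable_funM => //.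
  exact: (measurableT_comp mgc measurable_snd).
have iF : (lebesgue_Rn R n.+1).-integrable setT (fun x => F (dotR x xi, dotR x x)).
  have := (integrable_mkcond _ (@measurable_annulus R n.+1 e r)).1 ig.
  apply: le_integrable => //; first exact: (measurableT_comp mF (measurable_fun_dotR2 xi)).
  move=> x _; rewrite /F /gc !patchE annulusE ?(ltW e0)// mem_setE in_itv/=.
  by case: ifP => _; rewrite ?mul0r// lee_fin normrM ler_piMr// sin_max.
transitivity (\int[lebesgue_Rn R n.+1]_x fine (F (dotR x xi, dotR x x))).
  rewrite [LHS]Rintegral_mkcond; apply: eq_Rintegral => x _.
  rewrite /F /gc/= !patchE annulusE ?(ltW e0)// mem_setE in_itv/=.
  by case: ifP => _; rewrite ?mul0r.
set I := (LHS); suff h : I = - I by lra.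
pose xi' : Rn R n.+1 := [tuple - tnth xi i | i < n.+1].
have dN x : dotR x xi' = - dotR x xi.
  by rewrite /dotR -sumrN; apply: eq_bigr => i _; rewrite tnth_mktuple mulrN.
have exi : enorm xi = enorm xi'.
  by rewrite /enorm /dotR; congr Num.sqrt; apply: eq_bigr => i _; rewrite !tnth_mktuple mulrNN.
transitivity (\int[lebesgue_Rn R n.+1]_x fine (F (dotR x xi', dotR x x))).
  exact: (congr1 fine (integral_dotR_enorm mF exi)).
rewrite -mulN1r -RintegralZl//.
by apply: eq_Rintegral => x _; rewrite dN /F/= mulrN sinN mulrN mulN1r.
Qed.

(** Multiplying by the conjugate exponential, which is bounded, undoes the exponential in the
    integrand: cos^2 + sin^2 = 1. Integrability at one frequency thus gives that of the function
    itself. *)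
Lemma cintegrable_fourier_integrand k (phi : Rn R k -> R[i]) xi D : measurable D ->
  cintegrable (lebesgue_Rn R k) D (fourier_integrand phi xi) ->
  cintegrable (lebesgue_Rn R k) D phi.
Proof.
set mu := lebesgue_Rn R k => mD -[iRe iIm].
pose t (x : Rn R k) : R := - (2 * pi * dotR x xi).
have mt : measurable_fun D t.
  apply: measurable_funTS; apply: measurable_funN; apply: measurable_funM => //.
  exact: measurable_dotR.
have icos g : mu.-integrable D (EFin \o g) ->
    mu.-integrable D (EFin \o (fun x => g x * cos (t x))).
  move=> ig; apply: (integrableMl (h := fun x => cos (t x)) mD ig).
    apply: (measurableT_comp (f := @cos R)) => //.
    by apply: continuous_measurable_fun; exact: continuous_cos.
  by exists 1; split=> // K K1 x _ /=; exact: le_trans (cos_max _) (ltW K1).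
have isin g : mu.-integrable D (EFin \o g) ->
    mu.-integrable D (EFin \o (fun x => g x * sin (t x))).
  move=> ig; apply: (integrableMl (h := fun x => sin (t x)) mD ig).
    apply: (measurableT_comp (f := @sin R)) => //.
    by apply: continuous_measurable_fun; exact: continuous_sin.
  by exists 1; split=> // K K1 x _ /=; exact: le_trans (sin_max _) (ltW K1).
split.
- have := integrableD mD (icos _ iRe) (isin _ iIm).
  apply: eq_integrable => // x _ /=; rewrite /fourier_integrand -/(t x).
  case: (phi x) => a b /=; rewrite -EFinD; congr EFin.
  by rewrite -[RHS]mulr1 -(cos2Dsin2 (t x)); ring.
- have := integrableB mD (icos _ iIm) (isin _ iRe).
  apply: eq_integrable => // x _ /=; rewrite /fourier_integrand -/(t x).
  case: (phi x) => a b /=; rewrite -EFinB; congr EFin.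
  by rewrite -[RHS]mulr1 -(cos2Dsin2 (t x)); ring.
Qed.

Lemma fourier_trunc_radial n (w : Rn R n.+1 -> R[i]) (W : R -> R[i]) xi (e r : R) :
  (forall x, w x = W (enorm x)) -> 0 < e -> e <= r ->
  cintegrable (lebesgue_Rn R n.+1) (annulus e r) w ->
  fourier_trunc w xi (e, r) =
  (\int[lebesgue_Rn R n.+1]_(x in annulus e r) (complex.Re (W (enorm x)) * wave xi x)) +i*
  (\int[lebesgue_Rn R n.+1]_(x in annulus e r) (complex.Im (W (enorm x)) * wave xi x)).
Proof.
move=> wW e0 er [iRe iIm]; have mA := @measurable_annulus R n.+1 e r.
set mu := lebesgue_Rn R n.+1.
pose t (x : Rn R n.+1) : R := 2 * pi * dotR x xi.
have mt : measurable_fun (annulus e r) t.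
  by apply: measurable_funTS; apply: measurable_funM => //; exact: measurable_dotR.
have {}iRe : mu.-integrable (annulus e r) (fun x => (complex.Re (W (enorm x)))%:E).
  by apply: eq_integrable iRe => // x _; rewrite wW.
have {}iIm : mu.-integrable (annulus e r) (fun x => (complex.Im (W (enorm x)))%:E).
  by apply: eq_integrable iIm => // x _; rewrite wW.
have icos g : mu.-integrable (annulus e r) (EFin \o g) ->
    mu.-integrable (annulus e r) (EFin \o (fun x => g x * wave xi x)).
  move=> ig; apply: (integrableMl (h := wave xi) mA ig).
    exact: measurable_funTS (measurable_wave xi).
  by exists 1; split=> // K K1 x _ /=; exact: le_trans (normr_wave_le1 _ _) (ltW K1).
have isin g : mu.-integrable (annulus e r) (EFin \o g) ->
    mu.-integrable (annulus e r) (EFin \o (fun x => g x * sin (t x))).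
  move=> ig; apply: (integrableMl (h := fun x => sin (t x)) mA ig).
    apply: (measurableT_comp (f := @sin R)) => //.
    by apply: continuous_measurable_fun; exact: continuous_sin.
  by exists 1; split=> // K K1 x _ /=; exact: le_trans (sin_max _) (ltW K1).
rewrite /fourier_trunc /cintegral; congr Complex.
- have s0 := integral_radial_sin (g := fun s => complex.Im (W s)) xi e0 er iIm.
  rewrite -[RHS]addr0 -[X in _ + X]s0.
  rewrite -RintegralD//; [|exact: icos|exact: isin].
  apply: eq_Rintegral => x _; rewrite /fourier_integrand wW -/(t x) /wave -/(t x).
  by case: (W _) => a b /=; rewrite cosN sinN mulrN opprK.
- have s0 := integral_radial_sin (g := fun s => complex.Re (W s)) xi e0 er iRe.
  rewrite -[RHS]subr0 -[X in _ - X]s0.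
  rewrite -RintegralB//; [|exact: icos|exact: isin].
  apply: eq_Rintegral => x _; rewrite /fourier_integrand wW -/(t x) /wave -/(t x).
  by case: (W _) => a b /=; rewrite cosN sinN mulrN addrC.
Qed.

End radial_fourier.

(** * The transforms in dimensions n + 1 and n + 3 *)

Section fourier_shift.
Variable R : realType.

Lemma normr_Re_le_normc (z : R[i]) : `|complex.Re z| <= normc z.
Proof.
by case: z => a b /=; rewrite -sqrtr_sqr ler_wsqrtr// lerDl sqr_ge0.
Qed.

Lemma normr_Im_le_normc (z : R[i]) : `|complex.Im z| <= normc z.
Proof.
by case: z => a b /=; rewrite -sqrtr_sqr ler_wsqrtr// lerDr sqr_ge0.
Qed.

Lemma fourier_radial_cvg n (w : Rn R n.+1 -> R[i]) (W : R -> R[i]) xi :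
  (forall x, w x = W (enorm x)) -> fourier_cvg w xi ->
  \int[lebesgue_Rn R n.+1]_(x in annulus p.1 p.2) (complex.Re (W (enorm x)) * wave xi x)
    @[p --> (0^'+, +oo)] --> complex.Re (fourier w xi) /\
  \int[lebesgue_Rn R n.+1]_(x in annulus p.1 p.2) (complex.Im (W (enorm x)) * wave xi x)
    @[p --> (0^'+, +oo)] --> complex.Im (fourier w xi).
Proof.
move=> wW [iw cRe cIm]; split.
- apply: cvg_trans cRe; apply: near_eq_cvg; apply: near_radii => e r e0 er.
  rewrite (fourier_trunc_radial xi wW e0 er)//.
  by apply: cintegrable_fourier_integrand (iw e r e0 er); exact: measurable_annulus.
- apply: cvg_trans cIm; apply: near_eq_cvg; apply: near_radii => e r e0 er.
  rewrite (fourier_trunc_radial xi wW e0 er)//.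
  by apply: cintegrable_fourier_integrand (iw e r e0 er); exact: measurable_annulus.
Qed.

Lemma fourier_dimension_shift n (U V : R -> R[i])
    (u : Rn R n.+1 -> R[i]) (v : Rn R n.+3 -> R[i]) xi eta :
  (forall x, u x = U (enorm x)) -> (forall x, v x = V (enorm x)) ->
  fourier_cvg u xi -> fourier_cvg v eta ->
  normc (U r) * r ^+ n.+1 @[r --> 0^'+] --> (0 : R) ->
  normc (U r) * r `^ (n%:R / 2) @[r --> +oo] --> (0 : R) ->
  (forall r : R, 0 < r -> has_cderiv U r (r%:C * V r)) ->
  0 < enorm xi -> enorm eta = enorm xi ->
  fourier v eta = (- (2 * pi))%:C * fourier u xi.
Proof.
move=> uU vV cu cv U0 Uoo dU xi0 etaxi.
have [uRe uIm] := fourier_radial_cvg uU cu.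
have [vRe vIm] := fourier_radial_cvg vV cv.
have iV e r : 0 < e -> e <= r -> cintegrable (lebesgue_Rn R n.+3) (annulus e r) v.
  move=> e0 er; case: cv => iv _ _.
  by apply: cintegrable_fourier_integrand (iv e r e0 er); exact: measurable_annulus.
have dom (c : R[i] -> R) (F : set_system R) (FF : Filter F) (p : R -> R) :
    (forall z, `|c z| <= normc z) ->
    normc (U r) * p r @[r --> F] --> (0 : R) -> c (U r) * p r @[r --> F] --> (0 : R).
  move=> cle; apply: (@cvg0_dominated _ _ _ _ _ 1); apply: nearW => r.
  rewrite mul1r !normrM ler_wpM2r ?normr_ge0//.
  exact: le_trans (cle _) (ler_norm _).
have eRe : complex.Re (fourier v eta) = - (2 * pi) * complex.Re (fourier u xi).
  apply: (cvg_unique _ vRe); first exact: Rhausdorff.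
  change (\int[lebesgue_Rn R n.+3]_(x in annulus p.1 p.2) (complex.Re (V (enorm x)) * wave eta x)
    @[p --> (0^'+, +oo)] --> - (2 * pi) * complex.Re (fourier u xi)).
  apply: (@cvg_integral_wave_shift _ n xi eta (fun r => complex.Re (U r))
    (fun r => complex.Re (V r)) xi0 etaxi _ _ _ _ _ uRe).
  - exact: (dom _ _ _ _ normr_Re_le_normc).
  - exact: (dom _ _ _ _ normr_Re_le_normc).
  - move=> s s0; have [h _] := dU s s0; apply: is_derive_eq h _.
    by case: (V s) => a b /=; rewrite mul0r subr0.
  - move=> e r e0 er; have [h _] := iV e r e0 er.
    by apply: eq_integrable h => [|x _]; [exact: measurable_annulus|rewrite vV].
have eIm : complex.Im (fourier v eta) = - (2 * pi) * complex.Im (fourier u xi).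
  apply: (cvg_unique _ vIm); first exact: Rhausdorff.
  change (\int[lebesgue_Rn R n.+3]_(x in annulus p.1 p.2) (complex.Im (V (enorm x)) * wave eta x)
    @[p --> (0^'+, +oo)] --> - (2 * pi) * complex.Im (fourier u xi)).
  apply: (@cvg_integral_wave_shift _ n xi eta (fun r => complex.Im (U r))
    (fun r => complex.Im (V r)) xi0 etaxi _ _ _ _ _ uIm).
  - exact: (dom _ _ _ _ normr_Im_le_normc).
  - exact: (dom _ _ _ _ normr_Im_le_normc).
  - move=> s s0; have [_ h] := dU s s0; apply: is_derive_eq h _.
    by case: (V s) => a b /=; rewrite mul0r addr0.
  - move=> e r e0 er; have [_ h] := iV e r e0 er.
    by apply: eq_integrable h => [|x _]; [exact: measurable_annulus|rewrite vV].
move: eRe eIm; case: (fourier v eta) => a b; case: (fourier u xi) => c d /= -> ->.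
by congr Complex; rewrite mul0r ?subr0 ?addr0.
Qed.

End fourier_shift.
(** * Energies *)

Section measurable_transform.
Variable R : realType.
Notation mu := (@lebesgue_measure R).
Notation M := (measurableTypeR R).

(** Parametrized by the squared norm, so that [ray n (dotR xi xi)] represents the sphere through
    [xi]. *)
Definition ray n (s : R) : Rn R n.+1 :=
  Rn_cons (Num.sqrt s, [tuple of nseq n (0 : R)]).

Lemma enorm_sqrt_ray n s : enorm (@ray n s) = Num.sqrt s.
Proof. by rewrite enorm_ray ger0_norm ?sqrtr_ge0. Qed.

Lemma measurable_ray n : measurable_fun [set: M] (@ray n).
Proof.
apply: (measurableT_comp (@measurable_Rn_cons R n)).
apply/measurable_fun_pair => //=.
by apply: continuous_measurable_fun; exact: sqrt_continuous.
Qed.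

Lemma measurable_wave_ray n :
  measurable_fun [set: M * Rn R n.+1] (fun p => wave (ray n p.1) p.2).
Proof.
apply: (measurableT_comp (f := @cos R)).
  by apply: continuous_measurable_fun; exact: continuous_cos.
apply: measurable_funM => //; apply: measurable_sum => i; apply: measurable_funM.
  exact: (measurableT_comp (measurable_coordR i) measurable_snd).
apply: (measurableT_comp (measurable_coordR i)).
exact: (measurableT_comp (@measurable_ray n) measurable_fst).
Qed.

(** Tonelli's theorem makes the integrals of the positive and negative parts measurable in s. *)
Lemma measurable_integral_wave_ray n (h : Rn R n.+1 -> R) D : measurable D ->
  (lebesgue_Rn R n.+1).-integrable D (EFin \o h) ->
  measurable_fun [set: M]
    (fun s => \int[lebesgue_Rn R n.+1]_(x in D) (h x * wave (ray n s) x)).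
Proof.
move=> mD ih.
have mh : measurable_fun setT (h \_ D).
  by apply: ((measurable_restrictT _ mD).1 _); apply/measurable_EFinP; exact: measurable_int ih.
pose K (p : M * Rn R n.+1) : \bar R := ((h \_ D) p.2 * wave (ray n p.1) p.2)%:E.
have mK : measurable_fun setT K.
  apply/measurable_EFinP; apply: measurable_funM.
    exact: (measurableT_comp mh measurable_snd).
  exact: measurable_wave_ray.
have mpos := @measurable_fun_fubini_tonelli_F _ _ _ _ _ (lebesgue_Rn R n.+1) K^\+%E
  (measurable_funepos mK) (fun p => funepos_ge0 _ p).
have mneg := @measurable_fun_fubini_tonelli_F _ _ _ _ _ (lebesgue_Rn R n.+1) K^\-%E
  (measurable_funeneg mK) (fun p => funeneg_ge0 _ p).
have := measurableT_comp (@fine_measurable R setT measurableT) (emeasurable_funB mpos mneg).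
congr measurable_fun; apply/funext => s; rewrite /= /Rintegral integral_mkcond.
congr fine; rewrite [RHS]integralE /fubini_F.
congr (_ - _)%E; apply: eq_integral => x _.
  by rewrite /K !funeposE/= !patchE; case: ifP => _//; rewrite mul0r.
by rewrite /K !funenegE/= !patchE; case: ifP => _//; rewrite mul0r.
Qed.

(** Measurability passes to limits of sequences; this sequence of annuli follows the filter that
    defines the transform. *)
Lemma cvg_radii : (k.+1%:R^-1 : R, k.+1%:R : R) @[k --> \oo] --> ((0 : R)^'+, (+oo : set_system R)).
Proof.
apply: cvg_pair => /=.
  move=> P P0; have : \forall k \near \oo, 0 < (harmonic k : R) -> P (harmonic k).
    exact: (@cvg_harmonic R _ P0).
  by apply: filterS => k; apply; exact: harmonic_gt0.
by have := @cvgr_idn R; rewrite -cvg_shiftS.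
Qed.

Lemma measurable_fourier_ray n (w : Rn R n.+1 -> R[i]) (W : R -> R[i]) :
  (forall x, w x = W (enorm x)) -> fourier_defined w ->
  measurable_fun (`]0, +oo[%classic : set M) (fun s => complex.Re (fourier w (ray n s))) /\
  measurable_fun (`]0, +oo[%classic : set M) (fun s => complex.Im (fourier w (ray n s))).
Proof.
move=> wW dw.
have dray s : `]0, +oo[%classic s -> fourier_cvg w (ray n s).
  by rewrite /= in_itv/= andbT => s0; apply: dw; rewrite enorm_sqrt_ray sqrtr_gt0.
have iw e r : 0 < e -> e <= r -> cintegrable (lebesgue_Rn R n.+1) (annulus e r) w.
  move=> e0 er; have [iw _ _] : fourier_cvg w (ray n 1).
    by apply: dw; rewrite enorm_sqrt_ray sqrtr1.
  by apply: cintegrable_fourier_integrand (iw e r e0 er); exact: measurable_annulus.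
have mA e r := @measurable_annulus R n.+1 e r.
have iWk (k : nat) := iw (k.+1%:R^-1) k.+1%:R.
split; apply: measurable_fun_cvg.
- move=> k; apply: measurable_funTS.
  apply: (@measurable_integral_wave_ray n (fun x => complex.Re (W (enorm x)))
    (annulus k.+1%:R^-1 k.+1%:R)) => //.
  have [||h _] := iWk k; first by rewrite invr_gt0.
    by rewrite (@le_trans _ _ 1)// ?invf_le1// ler1n.
  by apply: eq_integrable h => // x _; rewrite wW.
- move=> s /dray ds; have [h _] := fourier_radial_cvg wW ds.
  exact: cvg_comp cvg_radii h.
- move=> k; apply: measurable_funTS.
  apply: (@measurable_integral_wave_ray n (fun x => complex.Im (W (enorm x)))
    (annulus k.+1%:R^-1 k.+1%:R)) => //.
  have [||_ h] := iWk k; first by rewrite invr_gt0.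
    by rewrite (@le_trans _ _ 1)// ?invf_le1// ler1n.
  by apply: eq_integrable h => // x _; rewrite wW.
- move=> s /dray ds; have [_ h] := fourier_radial_cvg wW ds.
  exact: cvg_comp cvg_radii h.
Qed.

End measurable_transform.

Section energy.
Variable R : realType.
Notation M := (measurableTypeR R).

Variables (n : nat) (U V : R -> R[i]) (u : Rn R n.+1 -> R[i]) (v : Rn R n.+3 -> R[i]).
Hypothesis uU : forall x, u x = U (enorm x).
Hypothesis du : fourier_defined u.
Hypothesis shift : forall (xi : Rn R n.+1) (eta : Rn R n.+3),
  0 < enorm xi -> enorm eta = enorm xi ->
  fourier v eta = (- (2 * pi))%:C * fourier u xi.
Variable alpha : R.
Hypothesis alpha0 : 0 <= alpha.

(** The energy density as a function of s = |xi|^2. It is set to 0 for s <= 0, as convergence of the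
    transform is assumed only at nonzero frequencies. *)
Let W : M -> R := (fun s => Num.sqrt s `^ (4 * alpha) *
  normc (fourier u (ray n s)) ^+ 2) \_ `]0, +oo[.

Let WE s : 0 < s -> W s = Num.sqrt s `^ (4 * alpha) * normc (fourier u (ray n s)) ^+ 2.
Proof. by move=> s0; rewrite /W patchE mem_setE in_itv/= s0. Qed.

Let W_ge0 s : 0 <= W s.
Proof.
rewrite /W patchE; case: ifP => // _.
by rewrite mulr_ge0 ?powR_ge0 ?sqr_ge0.
Qed.

Let mW : measurable_fun setT W.
Proof.
have mI : measurable (`]0, +oo[%classic : set M) by exact: measurable_itv.
apply: ((measurable_restrictT _ mI).1 _).
have [mRe mIm] := measurable_fourier_ray uU du.
rewrite (_ : (fun s : M => _) = fun s => Num.sqrt s `^ (4 * alpha) *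
    (complex.Re (fourier u (ray n s)) ^+ 2 + complex.Im (fourier u (ray n s)) ^+ 2)).
  apply: measurable_funM.
    apply: measurable_funTS; apply: (measurableT_comp (@measurable_powR R _)).
    by apply: continuous_measurable_fun; exact: sqrt_continuous.
  by apply: measurable_funD; exact: measurable_funX.
apply/funext => s; congr (_ * _); case: (fourier _ _) => a b /=.
by rewrite sqr_sqrtr// addr_ge0 ?sqr_ge0.
Qed.

Let enorm_gt0 k (x : Rn R k) : enorm x != 0 -> 0 < enorm x.
Proof. by move=> x0; rewrite lt_neqAle eq_sym x0 enorm_ge0. Qed.

Let sqr_normc_shift (xi : Rn R n.+1) (eta : Rn R n.+3) :
  0 < enorm xi -> enorm eta = enorm xi ->
  normc (fourier v eta) ^+ 2 = (2 * pi) ^+ 2 * normc (fourier u xi) ^+ 2.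
Proof.
move=> xi0 e; rewrite (shift xi0 e) normcM exprMn; congr (_ * _).
by rewrite /= expr0n addr0 sqr_sqrtr ?sqr_ge0// sqrrN.
Qed.

(* [fourier u] is radial because [shift] compares all its values on a sphere
   with one value of [fourier v]. *)
Let sqr_normc_radial (xi : Rn R n.+1) : 0 < enorm xi ->
  normc (fourier u xi) ^+ 2 = normc (fourier u (ray n (dotR xi xi))) ^+ 2.
Proof.
move=> xi0; have exi : enorm (ray n (dotR xi xi)) = enorm xi.
  by rewrite enorm_sqrt_ray.
have pi2 : (2 * pi) ^+ 2 != 0 :> R by rewrite expf_neq0// mulf_neq0// gt_eqF// pi_gt0.
apply: (mulfI pi2).
have er : enorm (ray n.+2 (dotR xi xi)) = enorm xi := enorm_sqrt_ray _ _.
have xi0' : 0 < enorm (ray n (dotR xi xi)) by rewrite exi.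
exact: etrans (esym (sqr_normc_shift xi0 er)) (sqr_normc_shift xi0' (etrans er (esym exi))).
Qed.

Let W_sqnorm (xi : Rn R n.+1) : 0 < enorm xi ->
  W (dotR xi xi) = enorm xi `^ (4 * alpha) * normc (fourier u xi) ^+ 2.
Proof.
move=> xi0; rewrite (sqr_normc_radial xi0); apply: WE.
by rewrite -sqr_enorm exprn_gt0.
Qed.

Let W_sqnormSS (eta : Rn R n.+3) : 0 < enorm eta ->
  enorm eta `^ (4 * alpha) * normc (fourier v eta) ^+ 2 =
  (2 * pi) ^+ 2 * W (dotR eta eta).
Proof.
move=> eta0; have er : enorm eta = enorm (ray n (dotR eta eta)).
  by rewrite enorm_sqrt_ray.
have d0 : 0 < dotR eta eta by rewrite -sqr_enorm exprn_gt0.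
have r0 : 0 < enorm (ray n (dotR eta eta)) by rewrite -er.
rewrite (sqr_normc_shift r0 er) mulrCA; congr (_ * _).
by apply/esym; exact: WE.
Qed.

(** The extra order 1/2 multiplies the density by |xi|^2 and the constant by (2 pi)^2; the weight
    |xi|^2 is then traded for two more dimensions. *)
Lemma energy_u :
  laplacian_energy (alpha + 2^-1) u =
  (((2 * pi) `^ (4 * alpha) * (2 * pi) ^+ 2)%:E *
   ((n.+1%:R / (2 * pi))%:E * \int[lebesgue_Rn R n.+3]_z (W (dotR z z))%:E))%E.
Proof.
have pi2 : 0 < 2 * pi :> R by rewrite mulr_gt0// pi_gt0.
have a2 : 4 * (alpha + 2^-1) = 4 * alpha + 2%:R :> R by field.
have pw (b : R) : 0 <= b -> b `^ (4 * (alpha + 2^-1)) = b `^ (4 * alpha) * b ^+ 2.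
  move=> b0; rewrite a2 powRD ?powR_mulrn//; apply/implyP => /eqP h.
  by have : 4 * alpha + 2%:R != 0 :> R; [rewrite gt_eqF// ltr_wpDl// mulr_ge0|rewrite h eqxx].
rewrite /laplacian_energy (pw _ (ltW pi2)); congr (_ * _)%E.
rewrite -(@ge0_integral_radial_weight R n (EFin \o W)); last 2 first.
- by apply/measurable_EFinP; exact: mW.
- by move=> t; rewrite lee_fin.
apply: eq_integral => xi _; rewrite -EFinM; congr EFin.
rewrite (pw _ (enorm_ge0 xi)) sqr_enorm.
(* At the origin the weight |xi|^2 makes both sides vanish, whatever the transform is there. *)
have [x0|/enorm_gt0 x0] := eqVneq (enorm xi) 0.
  by rewrite -sqr_enorm x0 expr0n mulr0 !mul0r.
by rewrite (W_sqnorm x0) -mulrA mulrCA.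
Qed.

(** Unlike in [energy_u], no weight is left to cancel the value at the origin (for alpha = 0 the
    power is 1 there), so the densities agree only off a null set. *)
Lemma energy_v :
  laplacian_energy alpha v =
  (((2 * pi) `^ (4 * alpha))%:E *
   (((2 * pi) ^+ 2)%:E * \int[lebesgue_Rn R n.+3]_z (W (dotR z z))%:E))%E.
Proof.
rewrite /laplacian_energy; congr (_ * _)%E.
pose f (eta : Rn R n.+3) : \bar R :=
  (enorm eta `^ (4 * alpha) * normc (fourier v eta) ^+ 2)%:E.
pose h (eta : Rn R n.+3) : \bar R := (((2 * pi) ^+ 2)%:E * (W (dotR eta eta))%:E)%E.
pose z0 : Rn R n.+3 := [tuple (0 : R) | i < n.+3].
have mh : measurable_fun setT h.
  apply: emeasurable_funM; first exact: measurable_cst.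
  apply/measurable_EFinP; exact: (measurableT_comp mW (@measurable_sqnorm R n.+3)).
have fh eta : enorm eta != 0 -> f eta = h eta.
  move=> /enorm_gt0 e0; rewrite /h -EFinM; congr EFin; exact: W_sqnormSS.
have f0 eta : enorm eta = 0 -> eta = z0.
  move=> e0; apply: eq_from_tnth => i.
  by rewrite (enorm0_tnth i e0) tnth_mktuple.
(* Measurability of [f] comes from that of [h], since a single value is changed. *)
have fE : f = fun eta => if enorm eta == 0 then f z0 else h eta.
  by apply/funext => eta; case: eqVneq => [/f0 ->|/fh].
have mf : measurable_fun setT f.
  rewrite fE; apply: measurable_fun_ifT => //.
  by apply: measurable_fun_eqr => //; exact: measurable_enorm.
transitivity (\int[lebesgue_Rn R n.+3]_z h z)%E.
  apply: ae_eq_integral => //.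
  exists [set x | enorm x = 0]; split; first exact: measurable_enorm0.
    exact: lebesgue_Rn_enorm0.
  move=> eta /= fhn; apply/eqP; apply/negPn/negP => e0; apply: fhn => _.
  exact: fh.
apply: ge0_integralZl.
- exact: measurableT.
- by apply/measurable_EFinP; exact: (measurableT_comp mW (@measurable_sqnorm R n.+3)).
- by move=> z _; rewrite lee_fin.
- by rewrite lee_fin sqr_ge0.
Qed.

(** By [unit_ball_volumeSS] the ratio of the sphere areas is (n+1) / (2 pi), the constant of
    [ge0_integral_radial_weight]. *)
Lemma laplacian_energy_shift :
  laplacian_energy (alpha + 2^-1) u =
  ((sphere_area R n.+1 / sphere_area R n.+3)%:E * laplacian_energy alpha v)%E.
Proof.
rewrite energy_u energy_v !muleA -!EFinM; congr (_%:E * _)%E.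
rewrite !sphere_areaE unit_ball_volumeSS.
have := unit_ball_volume_gt0 R n.+1; move: (unit_ball_volume R n.+1) => b b0.
move: (pi : R) (pi_gt0 R) => p p0; field.
by rewrite !lt0r_neq0.
Qed.

End energy.

Unset Implicit Arguments.

Theorem theorem1p2 (R : realType) (N : nat) (hN : (0 < N)%N)
  (U V : R -> R[i]) (u : Rn R N -> R[i]) (v : Rn R N.+2 -> R[i])
  (hu : forall x, u x = U (enorm x))
  (hv : forall x, v x = V (enorm x))
  (hFu : fourier_defined u) (hFv : fourier_defined v)
  (hU0 : normc (U r) * r ^+ N @[r --> 0^'+] --> (0 : R))
  (hUoo : normc (U r) * r `^ ((N%:R - 1) / 2) @[r --> +oo] --> (0 : R))
  (hUV : forall r : R, 0 < r -> has_cderiv U r (r%:C * V r)) :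
  (forall (xi : Rn R N) (eta : Rn R N.+2),
     0 < enorm xi -> enorm eta = enorm xi ->
     fourier v eta = (- (2 * pi))%:C * fourier u xi) /\
  (forall alpha : R, 0 <= alpha ->
     laplacian_energy (alpha + 2^-1) u =
     ((sphere_area R N / sphere_area R N.+2)%:E *
      laplacian_energy alpha v)%E).
Proof.
case: N hN u v hu hv hFu hFv hU0 hUoo => // n _ u v hu hv hFu hFv hU0 hUoo.
have Uoo : normc (U r) * r `^ (n%:R / 2) @[r --> +oo] --> (0 : R).
  by move: hUoo; rewrite -natr1 addrK.
have shift (xi : Rn R n.+1) (eta : Rn R n.+3) : 0 < enorm xi ->
    enorm eta = enorm xi -> fourier v eta = (- (2 * pi))%:C * fourier u xi.
  move=> xi0 etaxi; have eta0 : 0 < enorm eta by rewrite etaxi.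
  exact: (fourier_dimension_shift hu hv (hFu xi xi0) (hFv eta eta0) hU0 Uoo hUV).
split=> // alpha alpha0; exact: (laplacian_energy_shift hu hFu shift alpha0).
Qed.
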